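(* Let $n\ge2$ be an integer, let $m=\lfloor\tfrac n2\rfloor$, and let $S'$ be the solvmanifold, with metric Lie algebra $\mathfrak s'=\mathfrak a\oplus\mathfrak n'$ as defined in the context, associated to the solvmanifold corresponding to the noncompact symmetric space $\mathsf{SO}(n,\mathbf H)/\mathsf U(n)$. Let $Z$ be any characteristic element, with corresponding set of simple roots $\Lambda'=\{\alpha\in\Lambda\mid\alpha(Z)=0\}$, and let $(S'_{\Lambda'},g')$ be the solvmanifold attached to $S'$, i.e. the simply connected solvable Lie group with Lie algebra $\mathfrak s'_{\Lambda'}=\mathfrak a_{\Lambda'}\oplus\mathfrak n'_{\Lambda'}$, equipped with the left-invariant metric $g'$ determined by the inner product restricted from $\mathfrak s'$. Then $(S'_{\Lambda'},g')$ is an Einstein solvmanifold.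
   Context: A (Riemannian) solvmanifold is a solvable Lie group with a left-invariant Riemannian metric; a metric Lie algebra is a Lie algebra with an inner product, and it determines a simply connected Lie group with left-invariant metric. Einstein means that the Ricci tensor is a constant multiple of the metric. The Lie algebra. $$\mathfrak g=\mathfrak{so}(n,\mathbf H)=\left\{\begin{pmatrix}X&Y\\-\overline Y&\overline X\end{pmatrix}\in\mathfrak{gl}(2n,\mathbf C)\ \Big|\ X=-X^t,\ Y=\overline Y^t\right\},$$ a real Lie algebra with Cartan involution $\sigma(A)=-\overline A^t$, Killing form $B$, and $B_\sigma(X,Y)=-B(X,\sigma(Y))$. For $r\ne s$, $E_{rs}$ denotes the skew-symmetric $2n\times2n$ matrix with $1$ in entry $(r,s)$, $-1$ in entry $(s,r)$ and zeros elsewhere. Let $\mathfrak a=\operatorname{span}_{\mathbf R}\{H_j=\tfrac{i}{\sqrt2}(E_{2j-1,2j}-E_{n+2j-1,n+2j})\mid 1\le j\le m\}$, and let $\omega_j\in\mathfrak a^*$ be given by $\omega_j(H_k)=\tfrac1{\sqrt2}\delta_{jk}$. Positive (restricted) roots: $\Delta^+=\{\omega_j\pm\omega_k\mid 1\le j<k\le m\}\cup\{2\omega_j\mid 1\le j\le m\}$ if $n$ is even, and this set together with $\{\omega_j\mid 1\le j\le m\}$ if $n$ is odd. Let $\Lambda=\{\alpha_1,\dots,\alpha_m\}$ be the set of simple roots of $\Delta^+$. Root spaces (real spans). For $1\le j<k\le m$, $\mathfrak n_{\omega_j\pm\omega_k}=\operatorname{span}\{A^\pm_{jk},B^\pm_{jk},C^\pm_{jk},D^\pm_{jk}\}$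 with $A^\pm_{jk}=\tfrac12\big((E_{2j-1,2k-1}\mp E_{2j,2k}+E_{n+2j-1,n+2k-1}\mp E_{n+2j,n+2k})+i(\mp E_{2j-1,2k}-E_{2j,2k-1}\pm E_{n+2j-1,n+2k}+E_{n+2j,n+2k-1})\big)$, $B^\pm_{jk}=\tfrac12\big((E_{2j-1,2k}\pm E_{2j,2k-1}+E_{n+2j-1,n+2k}\pm E_{n+2j,n+2k-1})+i(\pm E_{2j-1,2k-1}-E_{2j,2k}\mp E_{n+2j-1,n+2k-1}+E_{n+2j,n+2k})\big)$, $C^\pm_{jk}=\tfrac12\big((E_{2j-1,n+2k}\mp E_{2j,n+2k-1}\mp E_{2k-1,n+2j}+E_{2k,n+2j-1})+i(\mp E_{2j-1,n+2k-1}-E_{2j,n+2k}\pm E_{2k-1,n+2j-1}+E_{2k,n+2j})\big)$, $D^\pm_{jk}=\tfrac12\big((E_{2j-1,n+2k-1}+E_{2k-1,n+2j-1}\pm E_{2j,n+2k}\pm E_{2k,n+2j})+i(\pm E_{2j-1,n+2k}-E_{2j,n+2k-1}+E_{2k-1,n+2j}\mp E_{2k,n+2j-1})\big)$. For $1\le k\le m$, $\mathfrak n_{2\omega_k}=\operatorname{span}\{G_k\}$ with $G_k=\tfrac1{\sqrt2}\big((E_{2k-1,n+2k-1}+E_{2k,n+2k})+i(E_{2k-1,n+2k}-E_{2k,n+2k-1})\big)$. If $n$ is odd, for $1\le k\le m$, $\mathfrak n_{\omega_k}=\operatorname{span}\{X_k,Y_k,Z_k,W_k\}$ with $X_k=\tfrac1{\sqrt2}\big((E_{2k,n}+E_{n+2k,2n})+i(E_{2k-1,n}-E_{n+2k-1,2n})\big)$,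 $Y_k=\tfrac1{\sqrt2}\big((E_{2k-1,n}+E_{n+2k-1,2n})-i(E_{2k,n}-E_{n+2k,2n})\big)$, $Z_k=\tfrac1{\sqrt2}\big((E_{2k,2n}+E_{n,n+2k})+i(E_{2k-1,2n}-E_{n,n+2k-1})\big)$, $W_k=\tfrac1{\sqrt2}\big((E_{2k-1,2n}+E_{n,n+2k-1})-i(E_{2k,2n}-E_{n,n+2k})\big)$. Put $\mathfrak n=\sum_{\alpha\in\Delta^+}\mathfrak n_\alpha$ and $\mathfrak s=\mathfrak a\oplus\mathfrak n$, with inner product $\langle\,,\rangle=2B_\sigma|_{\mathfrak a\times\mathfrak a}+B_\sigma|_{\mathfrak n\times\mathfrak n}$ ($\mathfrak a\perp\mathfrak n$); the corresponding simply connected solvmanifold is the symmetric space $\mathsf{SO}(n,\mathbf H)/\mathsf U(n)$. Let $\mathcal B$ be the basis of $\mathfrak n$ consisting of the vectors listed above. The associated metric Lie algebra $\mathfrak s'$. Let $\mathfrak g^{\mathbf C}=\mathfrak g\otimes_{\mathbf R}\mathbf C$, viewed as a real Lie algebra, and let $\sqrt{-1}$ be the imaginary unit of the second tensor factor (distinct from the matrix scalar $i$). If $n$ is even, replace each of the basis vectors $B^-_{jk},C^-_{jk},A^+_{jk},D^+_{jk}$ ($1\le j<k\le m$) and $G_k$ ($1\le k\le m$) in $\mathcal B$ by its product with $\sqrt{-1}$; if $n$ is odd, replace each of $X_k,Z_k$ ($1\le k\le m$) and $B^+_{jk},C^+_{jk},B^-_{jk},C^-_{jk}$ ($1\le j<k\le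 m$) by its product with $\sqrt{-1}$. All other vectors of $\mathcal B$ are left unchanged. Let $\mathfrak n'\subset\mathfrak g^{\mathbf C}$ be the real span of the resulting set, and $\mathfrak s'=\mathfrak a\oplus\mathfrak n'$, a real solvable Lie subalgebra of $\mathfrak g^{\mathbf C}$. Its inner product is the one for which the linear bijection $\mathfrak s\to\mathfrak s'$ that is the identity on $\mathfrak a$ and sends each vector of $\mathcal B$ to its (possibly replaced) counterpart is an isometry. $S'$ is the simply connected solvmanifold with metric Lie algebra $\mathfrak s'$. Attached subalgebras. Let $\{H^1,\dots,H^m\}$ be the basis of $\mathfrak a$ with $\alpha_i(H^j)=\delta_{ij}$. A characteristic element is $Z=c_{i_1}H^{i_1}+\dots+c_{i_k}H^{i_k}$ with $k\ge1$, distinct indices $i_1,\dots,i_k$, and positive integers $c_{i_1},\dots,c_{i_k}$; then $\Lambda'=\{\alpha\in\Lambda\mid\alpha(Z)=0\}=\Lambda\setminus\{\alpha_{i_1},\dots,\alpha_{i_k}\}$. Put $\mathfrak a_{\Lambda'}=\operatorname{span}\{H^{i_1},\dots,H^{i_k}\}$ and $\mathfrak n'_{\Lambda'}=\sum_{\alpha\in\Delta^+,\ \alpha(Z)>0}\mathfrak n'_\alpha$, where $\mathfrak n'_\alpha=\{X\in\mathfrak n'\mid[A,X]=\alpha(A)X\ \ \forall A\in\mathfrak a\}$. *)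

(* Defs.v *)
From HB Require Import structures.
From mathcomp Require Import all_boot all_order all_algebra.
From mathcomp Require Import boolp reals.
From mathcomp Require Import complex.
From mathcomp Require Import zify.

Set Implicit Arguments.
Unset Strict Implicit.
Unset Printing Implicit Defensive.

Import Order.TTheory GRing.Theory Num.Theory.
Local Open Scope ring_scope.

(* {x | P x} as a vector subspace; it is 0 if P does not define a subspace. *)
Section Comprehension.
Variables (K : fieldType) (V : vectType K).

Definition vspace_of (P : V -> Prop) : {vspace V} :=
  if pselect (exists U : {vspace V}, forall x, x \in U <-> P x) is left h
  then projT1 (cid h) else 0%VS.

Lemma mem_vspace_of (P : V -> Prop) :
  P 0 -> (forall a x y, P x -> P y -> P (a *: x + y)) ->
  forall x, x \in vspace_of P <-> P x.
Proof.
move=> P0 PD; rewrite /vspace_of; case: pselect => [h|]; first by case: (cid h).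
case; pose inP (U : {vspace V}) := forall x, x \in U -> P x.
have ex0 : exists d, `[< exists2 U, inP U & \dim U = d >].
  exists 0%N; apply/asboolP; exists 0%VS; last exact: dimv0.
  by move=> x; rewrite memv0 => /eqP ->.
have bnd d : `[< exists2 U, inP U & \dim U = d >] -> (d <= \dim {:V})%N.
  by move=> /asboolP[U _ <-]; apply: dimvS; apply: subvf.
case: (ex_maxnP ex0 bnd) => d /asboolP[U inU dimU] maxd.
exists U => x; split=> [|Px]; first exact: inU.
have sUx : (U <= U + <[x]>)%VS by apply: addvSl.
suff /eqP -> : (U == U + <[x]>)%VS by rewrite memvE addvSr.
rewrite eqEdim sUx /= dimU; apply: maxd; apply/asboolP.
exists (U + <[x]>)%VS => // _ /memv_addP[u uU [_ /vlineP[k ->] ->]].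
by rewrite addrC; apply: PD => //; apply: inU.
Qed.

End Comprehension.

(* Metric Lie algebras: a subspace U of a vector space V, with a bracket and  *)
(* a form on V that are only considered on U.  The elements of U stand for    *)
(* the left-invariant vector fields of the simply connected Lie group of U.   *)
Section MetricLieAlgebra.
Variables (R : realType) (V : vectType R).
Variables (br : V -> V -> V) (U : {vspace V}) (ip : V -> V -> R).

Definition trace_on (f : V -> V) : R :=
  \sum_(i < \dim U) coord (vbasis U) i (f (vbasis U)`_i).

Definition killing_form (x y : V) : R := trace_on (fun z => br x (br y z)).

Definition bilinear_on (W : lmodType R) (f : V -> V -> W) : Prop :=
  forall a : R, {in U & &, forall x y z,
    f (a *: x + y) z = a *: f x z + f y z /\
    f z (a *: x + y) = a *: f z x + f z y}.

Record lie_algebra : Prop := LieAlgebra {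
  lie_closed : {in U &, forall x y, br x y \in U};
  lie_bilinear : bilinear_on br;
  lie_alternating : {in U, forall x, br x x = 0};
  lie_jacobi : {in U & &, forall x y z,
    br x (br y z) + br y (br z x) + br z (br x y) = 0} }.

Definition derived (W : {vspace V}) : {vspace V} :=
  <<[seq br x y | x <- vbasis W, y <- vbasis W]>>%VS.

Definition solvable_lie : Prop := exists k, iter k derived U = 0%VS.

Record inner_product : Prop := InnerProduct {
  ip_bilinear : bilinear_on (ip : V -> V -> R^o);
  ip_sym : {in U &, forall x y, ip x y = ip y x};
  ip_pos : {in U, forall x, x != 0 -> 0 < ip x x} }.

(* The Levi-Civita connection on left-invariant fields: for these the metric  *)
(* is constant, so compatibility reads <D z x, y> + <x, D z y> = 0.           *)
Record levi_civita (D : V -> V -> V) : Prop := LeviCivita {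
  lc_closed : {in U &, forall x y, D x y \in U};
  lc_bilinear : bilinear_on D;
  lc_torsion_free : {in U &, forall x y, D x y - D y x = br x y};
  lc_metric : {in U & &, forall x y z, ip (D z x) y + ip x (D z y) = 0} }.

Definition curvature (D : V -> V -> V) (x y z : V) : V :=
  D x (D y z) - D y (D x z) - D (br x y) z.

Definition ricci (D : V -> V -> V) (x y : V) : R :=
  trace_on (fun z => curvature D z x y).

(* Existential in D, but D is determined on U by the Koszul formula. *)
Definition einstein : Prop :=
  exists2 D, levi_civita D &
    exists c : R, {in U &, forall x y, ricci D x y = c * ip x y}.

Definition einstein_solvmanifold : Prop :=
  [/\ lie_algebra, solvable_lie, inner_product & einstein].

End MetricLieAlgebra.

(* L (x)_R C as L * L: the pair (x, y) stands for x + sqrt(-1) y.             *)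
Section Complexification.
Variables (R : realType) (L : vectType R) (br : L -> L -> L).

Definition complexified_bracket (x y : L * L) : L * L :=
  (br x.1 y.1 - br x.2 y.2, br x.1 y.2 + br x.2 y.1).

Definition to_complexified (x : L) : L * L := (x, 0).

Definition mul_sqrtm1 (x : L * L) : L * L := (- x.2, x.1).

End Complexification.

(* gl(N, C) as a real vector space. *)
Definition gl (R : realType) (N : nat) : Type := 'M[R[i]]_N.

Section RealVectorSpace.
Variables (R : realType) (N : nat).
Implicit Types (a b : R) (A B : 'M[R[i]]_N).
Local Open Scope complex_scope.

Definition real_scale a A := a%:C *: A.

Fact real_scaleA a b A :
  real_scale a (real_scale b A) = real_scale (a * b) A.
Proof. by rewrite /real_scale scalerA -rmorphM. Qed.
Fact real_scale1 : left_id 1 real_scale.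
Proof. by move=> A; rewrite /real_scale rmorph1 scale1r. Qed.
Fact real_scaleDr : right_distributive real_scale +%R.
Proof. by move=> a A B; rewrite /real_scale scalerDr. Qed.
Fact real_scaleDl A : {morph real_scale^~ A : a b / a + b}.
Proof. by move=> a b; rewrite /real_scale rmorphD scalerDl. Qed.

HB.instance Definition _ := GRing.Zmodule.copy (gl R N) 'M[R[i]]_N.
HB.instance Definition _ := GRing.Zmodule_isLmodule.Build R (gl R N)
  real_scaleA real_scale1 real_scaleDr real_scaleDl.

Fact gl_vect_iso : Vector.axiom (N * N + N * N) (gl R N).
Proof.
exists (fun A : gl R N => row_mx (mxvec (map_mx (@complex.Re R) A))
                                 (mxvec (map_mx (@complex.Im R) A))).
  move=> a A B; rewrite scale_row_mx add_row_mx -!linearP /=.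
  congr (row_mx (mxvec _) (mxvec _)); apply/matrixP=> i j; rewrite !mxE /=;
    by case: (A i j) (B i j) => x y [z t] /=; rewrite ?mul0r ?subr0 ?addr0.
exists (fun v : 'rV_(N * N + N * N) =>
  \matrix_(i, j) (vec_mx (lsubmx v) i j +i* vec_mx (rsubmx v) i j) : gl R N).
  move=> A; apply/matrixP=> i j.
  by rewrite mxE row_mxKl row_mxKr !mxvecK !mxE; case: (A i j).
move=> v; rewrite -[RHS]hsubmxK; congr row_mx; rewrite -[RHS]vec_mxK;
  by congr mxvec; apply/matrixP=> i j; rewrite !mxE.
Qed.
HB.instance Definition _ := Lmodule_hasFinDim.Build R (gl R N) gl_vect_iso.

End RealVectorSpace.

(* Throughout, the paper's 2n-by-2n matrices are indexed by 'I_(n + n).       *)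
Section SoStar.
Variables (R : realType) (n : nat).
Local Notation m := n./2.
Local Notation M := 'M[R[i]]_(n + n).
Local Notation G := (gl R (n + n)).
Local Notation "'ii'" := ('i%C : R[i]).
Local Notation isqrt2 := (((Num.sqrt 2)^-1)%:C%C : R[i]).

Definition commutator (A B : G) : G := (A *m B - B *m A)%R.

Definition conj_mx k l (A : 'M[R[i]]_(k, l)) := map_mx (@conjc R) A.

Definition in_so_nH (A : G) : Prop :=
  exists X Y : 'M[R[i]]_n,
    [/\ A = block_mx X Y (- conj_mx Y) (conj_mx X), X = - X^T
      & Y = (conj_mx Y)^T].

Definition so_nH : {vspace G} := vspace_of in_so_nH.

Lemma mem_so_nH (A : G) : A \in so_nH <-> in_so_nH A.
Proof.
apply: mem_vspace_of.
  by exists 0, 0; rewrite /conj_mx !(map_mx0, oppr0, trmx0) block_mx0.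
move=> a _ _ [X1 [Y1 [-> hX1 hY1]]] [X2 [Y2 [-> hX2 hY2]]].
have conjaD (P Q : 'M[R[i]]_n) :
    conj_mx (a%:C%C *: P + Q) = a%:C%C *: conj_mx P + conj_mx Q.
  by apply/matrixP=> i j; rewrite !mxE rmorphD rmorphM /= oppr0.
exists (a%:C%C *: X1 + X2), (a%:C%C *: Y1 + Y2); split.
- rewrite !conjaD opprD -scalerN -add_block_mx -scale_block_mx.
  by [].
- by rewrite [X1 in LHS]hX1 [X2 in LHS]hX2 linearP /= opprD scalerN.
- by rewrite conjaD linearP /= -hY1 -hY2.
Qed.

Definition cartan_involution (A : G) : G := - (conj_mx A)^T.

Definition B_sigma (x y : G) : R :=
  - killing_form commutator so_nH x (cartan_involution y).

(* E_{rs}, with the paper's indices r <> s in 1..2n. *)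
Definition E (r s : nat) : M :=
  \matrix_(a, b) (((a.+1 == r) && (b.+1 == s))%:R
                  - ((a.+1 == s) && (b.+1 == r))%:R).
Arguments E (r s)%_N.

Section BasisVectors.
(* e = 1 for the upper signs, e = -1 for the lower ones; 1 <= j < k <= m. *)
Variables (e : R[i]) (j k : nat).

Definition vecH : M :=
  (ii * isqrt2) *: (E (2*j-1) (2*j) - E (n+2*j-1) (n+2*j)).

Definition vecA : M := 2^-1 *:
  ((E (2*j-1) (2*k-1) - e *: E (2*j) (2*k)
    + E (n+2*j-1) (n+2*k-1) - e *: E (n+2*j) (n+2*k))
   + ii *: (- (e *: E (2*j-1) (2*k)) - E (2*j) (2*k-1)
            + e *: E (n+2*j-1) (n+2*k) + E (n+2*j) (n+2*k-1))).

Definition vecB : M := 2^-1 *: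
  ((E (2*j-1) (2*k) + e *: E (2*j) (2*k-1)
    + E (n+2*j-1) (n+2*k) + e *: E (n+2*j) (n+2*k-1))
   + ii *: (e *: E (2*j-1) (2*k-1) - E (2*j) (2*k)
            - e *: E (n+2*j-1) (n+2*k-1) + E (n+2*j) (n+2*k))).

Definition vecC : M := 2^-1 *:
  ((E (2*j-1) (n+2*k) - e *: E (2*j) (n+2*k-1)
    - e *: E (2*k-1) (n+2*j) + E (2*k) (n+2*j-1))
   + ii *: (- (e *: E (2*j-1) (n+2*k-1)) - E (2*j) (n+2*k)
            + e *: E (2*k-1) (n+2*j-1) + E (2*k) (n+2*j))).

Definition vecD : M := 2^-1 *:
  ((E (2*j-1) (n+2*k-1) + E (2*k-1) (n+2*j-1)
    + e *: E (2*j) (n+2*k) + e *: E (2*k) (n+2*j))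
   + ii *: (e *: E (2*j-1) (n+2*k) - E (2*j) (n+2*k-1)
            + E (2*k-1) (n+2*j) - e *: E (2*k) (n+2*j-1))).

Definition vecG : M := isqrt2 *:
  ((E (2*k-1) (n+2*k-1) + E (2*k) (n+2*k))
   + ii *: (E (2*k-1) (n+2*k) - E (2*k) (n+2*k-1))).

Definition vecX : M := isqrt2 *:
  ((E (2*k) n + E (n+2*k) (2*n))
   + ii *: (E (2*k-1) n - E (n+2*k-1) (2*n))).

Definition vecY : M := isqrt2 *:
  ((E (2*k-1) n + E (n+2*k-1) (2*n))
   - ii *: (E (2*k) n - E (n+2*k) (2*n))).

Definition vecZ : M := isqrt2 *:
  ((E (2*k) (2*n) + E n (n+2*k))
   + ii *: (E (2*k-1) (2*n) - E n (n+2*k-1))).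

Definition vecW : M := isqrt2 *:
  ((E (2*k-1) (2*n) + E n (n+2*k-1))
   - ii *: (E (2*k) (2*n) - E n (n+2*k))).

End BasisVectors.

Definition basis_a : m.-tuple G := [tuple (vecH i.+1 : G) | i < m].

Definition space_a : {vspace G} := <<basis_a>>%VS.

(* The basis of n; each vector comes with a flag telling whether it is        *)
(* multiplied by sqrt(-1) in n'.  The sign is + if s holds, - otherwise.      *)
Definition flagged_pair (s : bool) (j k : nat) : seq (G * bool) :=
  let e : R[i] := if s then 1 else -1 in
  [:: (vecA e j k : G, ~~ odd n && s);
      (vecB e j k : G, odd n || ~~ s);
      (vecC e j k : G, odd n || ~~ s);
      (vecD e j k : G, ~~ odd n && s)].

Definition flagged_single (k : nat) : seq (G * bool) :=
  (vecG k : G, ~~ odd n) ::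
  if odd n then [:: (vecX k : G, true); (vecY k : G, false);
                    (vecZ k : G, true); (vecW k : G, false)]
  else [::].

Definition flagged_basis_n : seq (G * bool) :=
  flatten [seq flagged_pair true jk.1 jk.2 ++ flagged_pair false jk.1 jk.2
          | jk <- [seq (j, k) | j <- iota 1 m, k <- iota 1 m] & (jk.1 < jk.2)%N]
  ++ flatten [seq flagged_single k | k <- iota 1 m].

Definition basis_n : seq G := [seq vb.1 | vb <- flagged_basis_n].

Definition space_n : {vspace G} := <<basis_n>>%VS.

Definition ip_s (x y : G) : R :=
  let pa := daddv_pi space_a space_n in
  let pn := daddv_pi space_n space_a in
  2 * B_sigma (pa x) (pa y) + B_sigma (pn x) (pn y).

Definition bracketC : G * G -> G * G -> G * G := complexified_bracket commutator.

Definition basis_n' : seq (G * G) :=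
  [seq if vb.2 then mul_sqrtm1 (to_complexified vb.1) else to_complexified vb.1
  | vb <- flagged_basis_n].

Definition space_n' : {vspace G * G} := <<basis_n'>>%VS.

Definition basis_s : seq G := basis_a ++ basis_n.

Definition basis_s' : seq (G * G) :=
  [seq to_complexified h | h <- basis_a] ++ basis_n'.

(* The inverse of the linear bijection s -> s' mapping basis_s to basis_s'. *)
Definition s'_to_s (x : G * G) : G :=
  \sum_(i < size basis_s') coord (in_tuple basis_s') i x *: basis_s`_i.

Definition ip_s' (x y : G * G) : R := ip_s (s'_to_s x) (s'_to_s y).

(* Elements of the dual of a are represented by linear forms on gl(2n, C);    *)
(* only their values on a are meaningful.  All the forms used are linear      *)
(* combinations of the omega j, so they are equal iff they agree on a.        *)
Definition omega (j : 'I_m) : 'Hom(G, R^o) :=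
  (Num.sqrt 2)^-1 *: linfun (coord basis_a j : G -> R^o).

Lemma basis_aE (i : 'I_m) : basis_a`_i = (vecH i.+1 : G).
Proof. by rewrite -tnth_nth tnth_mktuple. Qed.

Lemma free_basis_a : free basis_a.
Proof.
have half_lt (i : 'I_m) : ((i.*2).+1 < n)%N.
  by have := ltn_ord i; lia.
apply/freeP => t t0 j.
pose r : 'I_(n + n) := lshift n (Ordinal (ltnW (half_lt j))).
pose s : 'I_(n + n) := lshift n (Ordinal (half_lt j)).
have sumE (A : 'I_m -> G) :
    complex.Im ((\sum_i t i *: A i : G) r s) = \sum_i t i * complex.Im (A i r s).
  apply: (big_rec2 (fun (B : G) x => complex.Im (B r s) = x)) => [|i x B _ <-].
    by rewrite mxE.
  rewrite mxE raddfD /= mxE; case: (A i r s) => u v /=.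
  by rewrite mul0r addr0.
have entry (i : 'I_m) :
    complex.Im ((basis_a`_i : G) r s) = (Num.sqrt 2)^-1 * (i == j)%:R.
  rewrite basis_aE !mxE /=; have hi := half_lt i; have hj := half_lt j.
  have -> : (j.*2.+1 == 2 * i.+1 - 1)%N && (j.*2.+2 == 2 * i.+1)%N = (i == j).
    by rewrite -val_eqE /=; apply/idP/idP; lia.
  have -> : (j.*2.+1 == 2 * i.+1)%N && (j.*2.+2 == 2 * i.+1 - 1)%N = false by lia.
  have -> : (j.*2.+1 == n + 2 * i.+1 - 1)%N && (j.*2.+2 == n + 2 * i.+1)%N = false
    by lia.
  have -> : (j.*2.+1 == n + 2 * i.+1)%N && (j.*2.+2 == n + 2 * i.+1 - 1)%N = false
    by lia.
  by case: (i == j); rewrite /= ?(subr0, mulr0, mulr1, mul0r, mul1r, addr0, add0r).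
have := sumE (fun i => basis_a`_i); rewrite t0 mxE /= (bigD1 j) //= big1 ?addr0.
  rewrite entry eqxx mulr1 => /esym/eqP; rewrite mulf_eq0 invr_eq0 sqrtr_eq0.
  by rewrite real_leNgt ?num_real // ltr0n orbF => /eqP.
by move=> i /negPf nij; rewrite entry nij !mulr0.
Qed.

Lemma omegaE (j k : 'I_m) :
  omega j (vecH k.+1 : G) = (Num.sqrt 2)^-1 * (j == k)%:R.
Proof.
by rewrite -basis_aE /omega scale_lfunE lfunE /= coord_free ?free_basis_a // eq_sym.
Qed.

Definition ordered_pairs : seq ('I_m * 'I_m) :=
  [seq jk : 'I_m * 'I_m <- enum {: 'I_m * 'I_m} | (jk.1 < jk.2)%N].

Definition positive_roots : seq 'Hom(G, R^o) :=
  [seq omega jk.1 + omega jk.2 | jk <- ordered_pairs]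
  ++ [seq omega jk.1 - omega jk.2 | jk <- ordered_pairs]
  ++ [seq omega j *+ 2 | j <- enum 'I_m]
  ++ (if odd n then [seq omega j | j <- enum 'I_m] else [::]).

(* A simple root is a positive root that is not a sum of two positive roots. *)
Definition simple_roots : seq 'Hom(G, R^o) :=
  [seq al <- positive_roots |
    all2rel (fun be ga => al != be + ga) positive_roots].

Definition in_root_space' (al : 'Hom(G, R^o)) (X : G * G) : Prop :=
  X \in space_n' /\
  {in space_a, forall A : G, bracketC (to_complexified A) X = (al A : R) *: X}.

Lemma commutator_linear (A : G) : linear (commutator A).
Proof.
move=> a x y.
have -> : a *: x + y = (a%:C%C *: (x : M) + y)%R :> M by [].
have -> : a *: commutator A x + commutator A y =
  (a%:C%C *: (commutator A x : M) + commutator A y)%R :> M by [].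
rewrite /commutator mulmxDr mulmxDl -scalemxAr -scalemxAl scalerBr.
by rewrite opprD addrACA.
Qed.

Lemma bracketCE (A : G) (X : G * G) :
  bracketC (to_complexified A) X = (commutator A X.1, commutator A X.2).
Proof.
have c0 (B : G) : commutator 0 B = 0.
  by rewrite /commutator mul0mx mulmx0 subrr.
by rewrite /bracketC /complexified_bracket /= !c0 subr0 addr0.
Qed.

Definition root_space' (al : 'Hom(G, R^o)) : {vspace G * G} :=
  vspace_of (in_root_space' al).

Lemma mem_root_space' (al : 'Hom(G, R^o)) (X : G * G) :
  X \in root_space' al <-> in_root_space' al X.
Proof.
have lin A (a : R) (x y : G * G) : bracketC (to_complexified A) (a *: x + y) =
    a *: bracketC (to_complexified A) x + bracketC (to_complexified A) y.
  by rewrite !bracketCE /= !commutator_linear.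
apply: mem_vspace_of.
  split=> [|A _]; first exact: mem0v.
  have := lin A (-1) 0 0; rewrite scaler0 addr0 scaleN1r addNr => ->.
  by rewrite scaler0.
move=> a x y [nx hx] [ny hy]; split=> [|A aA]; first by rewrite memvD ?memvZ.
by rewrite lin hx ?hy // scalerDr !scalerA mulrC.
Qed.

Definition attached_n' (Z : G) : {vspace G * G} :=
  (\sum_(al <- positive_roots | (0 < (al Z : R))%R) root_space' al)%VS.

(* Hd is the family H^1, ..., H^m and I = {i_1, ..., i_k}. *)
Definition attached_a (Hd : 'I_m -> G) (I : {set 'I_m}) : {vspace G * G} :=
  <<[seq to_complexified (Hd i) | i <- enum I]>>%VS.

End SoStar.

(* Main.v *)
(* The flags record an involutive automorphism theta of so(n, H) which is the *)
(* identity on a: theta v = - v for the vectors of the basis multiplied by    *)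
(* sqrt(-1) and theta v = v for the others.  Therefore s' lies in the real    *)
(* form g' = so(n, H)^theta + sqrt(-1) so(n, H)^(-theta) of the complexified  *)
(* algebra.  Its Killing form is x, y |-> Q x (st y), with Q a Euclidean      *)
(* product and st the opposite of a Cartan involution, and s'_Lambda' is the  *)
(* solvable part b + nn of a parabolic subalgebra of g'.  Taking the trace of *)
(* the Killing form along a frame adapted to nn, st nn and the Levi factor    *)
(* turns the Ricci form of b + nn into a constant multiple of the metric, as  *)
(* soon as the mean curvature vector sum_e [e, st e] of nn is in b.  Here a   *)
(* need not be maximal abelian in the symmetric part of g', but that vector   *)
(* is fixed by the conjugation tau, and a is maximal among such elements.     *)
Require Import Defs.
From mathcomp Require Import all_boot all_order all_algebra.
From mathcomp Require Import reals complex.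
From HB Require Import structures.
From mathcomp Require Import ring lra zify.

Set Implicit Arguments.
Unset Strict Implicit.
Unset Printing Implicit Defensive.

Import Order.TTheory GRing.Theory Num.Theory.
Local Open Scope ring_scope.

(** Write k for so(n, H) and q(x, y) for Re tr(x dag(y)). On k the form [B_sigma] is kappa q with
    kappa = 2n - 2.

    Let rho be conjugation by the quaternionic structure. Then k consists of the skew-symmetric
    matrices fixed by rho. Every basis vector of n has the form X + rho X, with X a multiple of the
    wedge of two common eigenvectors of the H_j. In this form weights add. Also theta A = L conj(A)
    conj(L), for a suitable matrix L, acts on the vector by a sign read off from scalars. So theta
    is an isometric involutive automorphism of k that commutes with the Cartan involution, is
    trivial on a, and is -1 on the vectors multiplied by sqrt(-1) and 1 on the others
    ([root_vector_pair], [root_vector_G], [root_vector_short]).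

    Hence s' lies in g' = k^theta + sqrt(-1) k^(-theta). The Killing form of g' is that of k
    extended to complex scalars ([killing_real_form]). Sending x + sqrt(-1) y to x + y is an
    isometry on g' ([real_form_fold]) and gives the bijection from s' to s, so the metric of s' is
    2Q on a and Q on n', where Q is the Euclidean product of g'.

    The rest is a statement about parabolic subalgebras. Let nn be the sum of the positive
    eigenspaces of ad Z and b the part of a where all roots vanishing at Z vanish. Split g' into nn,
    its transpose st nn, and the remainder, which b centralizes. For x, y in nn, let S1, S0 and Pn
    be the sums of products of components of [x, .] and [y, .] over these pieces. Computing the
    Killing form along the splitting gives Q(x, y) = 2 S1 + 2 S0 + Pn, while the mean curvature
    vector Hn satisfies Q([Hn, x], y) = Pn + S0 ([killing_nilrad]). On b the form is twice a trace
    over nn ([killing_torus]). Substituted in the general Ricci formula [ricci_koszul], these give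
    Ric = -1/4 of the metric ([einstein_nilrad]).

    This requires Hn to lie in b. The key input is that a Hermitian element of k orthogonal to a and
    n is zero ([symmetric_eq0]), from which both completeness properties of g' follow
    ([real_form_complete], [real_form_complete_sym]). Finally, positive roots are natural
    combinations of simple roots ([root_simple_sum]), so b is the span of the chosen H^i, and nn is
    the attached nilpotent part. *)

Record euclidean (R : realType) (V : vectType R) (Q : V -> V -> R) : Prop :=
  Euclidean {
    euclidean_lin : forall x, scalar (Q x);
    euclidean_sym : forall x y, Q x y = Q y x;
    euclidean_pos : forall x, x != 0 -> 0 < Q x x }.

(** * Euclidean products, Parseval frames and traces *)

Section Frames.
Variables (R : realType) (V : vectType R) (Q : V -> V -> R).
Hypothesis EQ : euclidean Q.
Implicit Types (W : {vspace V}) (F : seq V).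

HB.instance Definition _ x :=
  GRing.isLinear.Build R V R *%R (Q x) (euclidean_lin EQ x).

(** A Parseval frame: independence is not asked, so the orthogonal projection of an orthonormal
    basis qualifies, and traces and norms are still computed by sums over it. *)
Definition frame W F : Prop :=
  {subset F <= W} /\ {in W, forall x, x = \sum_(e <- F) Q e x *: e}.

Lemma eucl_eq0 x : Q x x = 0 -> x = 0.
Proof.
move=> Qx; apply/eqP/negP=> /negP /(euclidean_pos EQ); by rewrite Qx ltxx.
Qed.

Lemma euclZl a x y : Q (a *: x) y = a * Q x y.
Proof. by rewrite euclidean_sym // linearZ /= euclidean_sym. Qed.

Lemma euclDl x y z : Q (x + y) z = Q x z + Q y z.
Proof. by rewrite !(euclidean_sym EQ _ z) linearD. Qed.

Lemma eucl_suml I r (P : pred I) (f : I -> V) z :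
  Q (\sum_(i <- r | P i) f i) z = \sum_(i <- r | P i) Q (f i) z.
Proof.
rewrite euclidean_sym // linear_sum /=; apply: eq_bigr => i _.
exact: euclidean_sym.
Qed.

(* Gram-Schmidt *)
Lemma frame_ex W : exists F, frame W F.
Proof.
have [d] := ubnP (\dim W); elim: d W => // d IHd W dW.
have [->|W0] := eqVneq W 0%VS.
  by exists [::]; split=> // x; rewrite memv0 big_nil => /eqP.
pose w := vpick W; have w0 : w != 0 by rewrite vpick0.
have Ww : w \in W by apply: memv_pick.
have Qw := euclidean_pos EQ w0.
pose v := (Num.sqrt (Q w w))^-1 *: w.
have Qv : Q v v = 1.
  rewrite euclZl linearZ /= mulrA -invfM -expr2 sqr_sqrtr ?ltW //.
  by rewrite mulVf // gt_eqF.
have Wv : v \in W by apply: memvZ.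
pose K := lker (linfun (Q v : V -> R^o)).
have memK x : x \in K = (Q v x == 0) by rewrite memv_ker lfunE.
have ltW' : (\dim (W :&: K) < d)%N.
  rewrite -ltnS; apply: leq_trans dW; rewrite ltnS ltn_neqAle dimvS ?capvSl //.
  rewrite andbT (eq_sym _ (\dim W)); apply/negP=> /eqP dE.
  have : v \in (W :&: K)%VS.
    suff -> : (W :&: K)%VS = W by [].
    by apply/eqP; rewrite eqEdim capvSl dE leqnn.
  by rewrite memv_cap memK Qv oner_eq0 andbF.
have [F [FW FE]] := IHd _ ltW'.
exists (v :: F); split=> [x|x Wx].
  rewrite inE => /predU1P[-> //|/FW]; by rewrite memv_cap => /andP[].
rewrite big_cons; apply/eqP; rewrite addrC -subr_eq; apply/eqP.
have W'x : x - Q v x *: v \in (W :&: K)%VS.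
  rewrite memv_cap memvB ?memvZ //= memK linearB linearZ /= Qv mulr1 subrr.
  by [].
rewrite [LHS]FE //; apply: eq_big_seq => e /FW; rewrite memv_cap memK.
move=> /andP[_ /eqP ve]; rewrite linearB linearZ /= (euclidean_sym EQ e v) ve.
by rewrite mulr0 subr0.
Qed.

Lemma parseval W F : frame W F ->
  {in W, forall x y, Q x y = \sum_(e <- F) Q e x * Q e y}.
Proof.
move=> [_ FE] x Wx y; rewrite {1}(FE x Wx) eucl_suml.
by apply: eq_bigr => e _; rewrite euclZl.
Qed.

Lemma linear_frame (U : lmodType R) (f : V -> U) W F : linear f -> frame W F ->
  {in W, forall x, f x = \sum_(e <- F) Q e x *: f e}.
Proof.
move=> f_lin [_ FE] x Wx; rewrite {1}(FE x Wx).
have f0 : f 0 = 0.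
  by have := f_lin (-1) 0 0; rewrite scaler0 addr0 scaleN1r addNr.
elim: F {FE} => [|e F IHF]; first by rewrite !big_nil.
by rewrite !big_cons f_lin IHF.
Qed.

(** Expand the basis in the frame, exchange the sums, then collect the coordinates of f e in the
    basis. *)
Lemma trace_on_frame W F f : frame W F -> linear f ->
  {in W, forall x, f x \in W} -> trace_on W f = \sum_(e <- F) Q e (f e).
Proof.
move=> FF f_lin fW; rewrite /trace_on; set b := vbasis W.
have bW (i : 'I_(\dim W)) : b`_i \in W by rewrite vbasis_mem ?mem_nth ?size_tuple.
under eq_bigr => i _.
  rewrite (linear_frame f_lin FF (bW i)) linear_sum /=.
  under eq_bigr => e _ do rewrite linearZ /=.
  over.
rewrite exchange_big /=; apply: eq_big_seq => e /(proj1 FF) We.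
rewrite {2}(coord_vbasis (fW e We)) linear_sum /=.
by apply: eq_bigr => i _; rewrite linearZ /= mulrC.
Qed.

(** The identity tr(fg) = tr(gf) on W, source of the vanishing traces below. *)
Lemma trace_comm W F f g : frame W F -> linear f -> linear g ->
  {in W, forall x, f x \in W} -> {in W, forall x, g x \in W} ->
  \sum_(e <- F) Q e (f (g e)) = \sum_(e <- F) Q e (g (f e)).
Proof.
move=> FF f_lin g_lin fW gW.
pose S f g := \sum_(e <- F) \sum_(e' <- F) Q e' (g e) * Q e (f e').
have SE f1 g1 : linear f1 -> {in W, forall x, g1 x \in W} ->
    \sum_(e <- F) Q e (f1 (g1 e)) = S f1 g1.
  move=> f1_lin g1W; apply: eq_big_seq => e /(proj1 FF) We.
  rewrite (linear_frame f1_lin FF (g1W e We)) linear_sum /=.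
  by apply: eq_bigr => e' _; rewrite linearZ.
rewrite !SE // /S exchange_big /=.
by apply: eq_bigr => e _; apply: eq_bigr => e' _; rewrite mulrC.
Qed.

Lemma frame_cat W W' F F' : frame W F -> frame W' F' ->
  {in W & W', forall x y, Q x y = 0} -> frame (W + W') (F ++ F').
Proof.
move=> [FW FE] [FW' FE'] WW'; split=> [x|_ /memv_addP[x Wx [y W'y ->]]].
  rewrite mem_cat => /orP[/FW|/FW'] xW.
    exact: (subvP (addvSl _ _)).
  exact: (subvP (addvSr _ _)).
rewrite big_cat /= {1}(FE x Wx) {1}(FE' y W'y).
congr (_ + _); apply: eq_big_seq => e.
  by move=> /FW We; rewrite linearD /= (WW' e y) ?addr0.
by move=> /FW' We; rewrite linearD /= (euclidean_sym EQ e x) (WW' x e) ?add0r.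
Qed.

Lemma frame_proj W F : frame W F -> forall x,
  (\sum_(e <- F) Q e x *: e \in W) /\
  {in W, forall y, Q y (x - \sum_(e <- F) Q e x *: e) = 0}.
Proof.
move=> FF x; split.
  by rewrite big_seq; apply: memv_suml => e /(proj1 FF) We; apply: memvZ.
move=> y Wy; rewrite linearB /= (parseval FF Wy) linear_sum /=; apply/eqP.
rewrite subr_eq0; apply/eqP; apply: eq_bigr => e _.
by rewrite linearZ /= mulrC (euclidean_sym EQ e y).
Qed.

End Frames.

(** * Lie brackets on a whole vector space *)

Record lie_bracket (R : realType) (V : vectType R) (br : V -> V -> V) : Prop :=
  LieBracket {
    lbr_linr : forall x, linear (br x);
    lbr_linl : forall y, linear (br^~ y);
    lbr_alt : forall x, br x x = 0;
    lbr_leibniz : forall x y z, br x (br y z) = br (br x y) z + br y (br x z) }.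

Section Bracket.
Variables (R : realType) (V : vectType R) (br : V -> V -> V).
Hypothesis Lbr : lie_bracket br.

HB.instance Definition _ x :=
  GRing.isLinear.Build R V V *:%R (br x) (lbr_linr Lbr x).

Lemma lbrDl x y z : br (x + y) z = br x z + br y z.
Proof. by have := lbr_linl Lbr z 1 x y; rewrite !scale1r. Qed.

Lemma lbr_anti x y : br x y = - br y x.
Proof.
apply/eqP; rewrite -addr_eq0; apply/eqP.
have := lbr_alt Lbr (x + y).
by rewrite lbrDl !linearD /= !(lbr_alt Lbr) add0r addr0.
Qed.

Lemma lbrZl a x y : br (a *: x) y = a *: br x y.
Proof. by rewrite lbr_anti linearZ /= -scalerN -lbr_anti. Qed.

Lemma lbr_suml I r (P : pred I) (f : I -> V) z :
  br (\sum_(i <- r | P i) f i) z = \sum_(i <- r | P i) br (f i) z.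
Proof.
rewrite lbr_anti linear_sum /= -sumrN.
by apply: eq_bigr => i _; rewrite -lbr_anti.
Qed.

Lemma lbr_linear_comp x y : linear (fun z => br x (br y z)).
Proof. by move=> a u v; rewrite !linearP. Qed.

End Bracket.

(** * Levi-Civita connection and Ricci form of a metric Lie algebra *)

Section RicciFormula.
Variables (R : realType) (V : vectType R) (br : V -> V -> V) (ip : V -> V -> R).
Hypotheses (Lbr : lie_bracket br) (Eip : euclidean ip).
Variables (U : {vspace V}) (F : seq V).
Hypotheses (FU : frame ip U F) (brU : {in U &, forall x y, br x y \in U}).

HB.instance Definition _ x :=
  GRing.isLinear.Build R V V *:%R (br x) (lbr_linr Lbr x).
HB.instance Definition _ x :=
  GRing.isLinear.Build R V R *%R (ip x) (euclidean_lin Eip x).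

Let ipC := euclidean_sym Eip.
Let brN := lbr_anti Lbr.

(* Koszul's formula, solved for [koszul x y] through the frame. *)
Definition koszul x y : V :=
  2^-1 *: (br x y + \sum_(e <- F) (ip (br e x) y + ip (br e y) x) *: e).

Lemma koszulE x y z : z \in U ->
  ip (koszul x y) z = 2^-1 * (ip (br x y) z + ip (br z x) y + ip (br z y) x).
Proof.
move=> Uz; rewrite /koszul euclZl // euclDl // -addrA; congr (_ * (_ + _)).
rewrite eucl_suml //.
have E u v : ip (br z u) v = \sum_(e <- F) ip e z * ip (br e u) v.
  rewrite (ipC (br z u)) brN linearN /=.
  rewrite (linear_frame (lbr_linr Lbr u) FU Uz) linear_sum -sumrN /=.
  apply: eq_bigr => e _; rewrite linearZ /= -mulrN; congr (_ * _).
  by rewrite -linearN /= -brN ipC.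
rewrite (E x y) (E y x) -big_split /=; apply: eq_bigr => e _.
by rewrite euclZl // mulrC mulrDr.
Qed.

Lemma koszul_closed : {in U &, forall x y, koszul x y \in U}.
Proof.
move=> x y Ux Uy; apply/memvZ/memvD; first exact: brU.
by rewrite big_seq; apply: memv_suml => e /(proj1 FU) Ue; apply: memvZ.
Qed.

Lemma koszul_linr x : linear (koszul x).
Proof.
move=> a u v; rewrite /koszul linearP /=.
rewrite scalerA mulrC -scalerA -scalerDr; congr (_ *: _).
rewrite scalerDr addrACA; congr (_ + _).
rewrite scaler_sumr -big_split /=; apply: eq_bigr => e _.
rewrite linearP /= linearP /= euclDl // euclZl // scalerA -scalerDl.
by congr (_ *: _); ring.
Qed.

Lemma koszul_torsion x y : koszul x y - koszul y x = br x y.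
Proof.
rewrite /koszul -scalerBr opprD addrACA.
rewrite -[X in _ + X]sumrB [X in _ + X]big1 ?addr0; last first.
  by move=> e _; rewrite -scalerBl addrC addrC (addrC (ip _ y)) subrr scale0r.
rewrite [br y x]brN opprK -mulr2n -scaler_nat scalerA mulVf ?scale1r //.
by rewrite pnatr_eq0.
Qed.

Lemma koszul_linl y : linear (koszul^~ y).
Proof.
move=> a u v.
have E x : koszul x y = koszul y x - br y x.
  by rewrite -(koszul_torsion y x) opprB addrCA subrr addr0.
rewrite !E koszul_linr linearP /= scalerBr opprD; rewrite addrACA.
by [].
Qed.

Lemma koszul_metric : {in U & &, forall x y z,
  ip (koszul z x) y + ip x (koszul z y) = 0}.
Proof.
move=> x y z Ux Uy Uz; rewrite (ipC x) !koszulE //.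
rewrite [br y x]brN [br x z]brN [br y z]brN.
rewrite ![ip (- _) _]ipC !linearN /= ![ip _ (br _ _)]ipC.
by ring.
Qed.

Lemma koszul_levi_civita : levi_civita br U ip koszul.
Proof.
split; [exact: koszul_closed| |by move=> *; exact: koszul_torsion|].
  move=> a x y z _ _ _; split; [exact: koszul_linl | exact: koszul_linr].
exact: koszul_metric.
Qed.

Variable h : V.
Hypothesis Uh : h \in U.
(** [h] is the mean curvature vector: it represents the linear form z -> tr(ad z). *)
Hypothesis hE : {in U, forall z, ip h z = \sum_(e <- F) ip (br z e) e}.

Let sum2C (f : V -> V -> R) :
  \sum_(e <- F) \sum_(e' <- F) f e e' = \sum_(e <- F) \sum_(e' <- F) f e' e.
Proof. by rewrite exchange_big. Qed.

(** A double sum only sees the symmetric part of its summand, so a symmetric factor times an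
    antisymmetric one contributes nothing. *)
Let sum2_sym (f g : V -> V -> R) :
  (forall e e', f e e' + f e' e = g e e' + g e' e) ->
  \sum_(e <- F) \sum_(e' <- F) f e e' = \sum_(e <- F) \sum_(e' <- F) g e e'.
Proof.
move=> fg; have two (k : V -> V -> R) :
    2 * (\sum_(e <- F) \sum_(e' <- F) k e e') =
    \sum_(e <- F) \sum_(e' <- F) (k e e' + k e' e).
  under [RHS]eq_bigr do rewrite big_split /=.
  by rewrite big_split /= -(sum2C k) mulr_natl mulr2n.
apply: (@mulfI R 2); first by rewrite pnatr_eq0.
by rewrite !two; apply: eq_bigr => e _; apply: eq_bigr => e' _.
Qed.

Lemma ip_derived_mean x y : x \in U -> y \in U -> ip h (br x y) = 0.
Proof.
move=> Ux Uy; rewrite hE ?brU //.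
have E e : ip (br (br x y) e) e = ip e (br x (br y e)) - ip e (br y (br x e)).
  by rewrite (lbr_leibniz Lbr x) linearD /= addrK ipC.
under eq_bigr do rewrite E.
rewrite sumrB; apply/eqP; rewrite subr_eq0; apply/eqP.
apply: (trace_comm Eip FU); try exact: lbr_linr.
  by move=> z; exact: brU.
by move=> z; exact: brU.
Qed.

(** The trace of z -> R(z, x) y splits into three contractions. The one of D_e (D_x y) only involves
    [h]; in the one of D_x (D_e y), metric compatibility moves D_x to the other side; the one of
    D_[e, x] y is read off Koszul's formula. *)
Lemma ricci_koszul : {in U &, forall x y, ricci br U koszul x y =
  4^-1 * (\sum_(e <- F) \sum_(e' <- F) ip (br e e') x * ip (br e e') y)
  - 2^-1 * (\sum_(e <- F) ip (br x e) (br y e))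
  - 2^-1 * (\sum_(e <- F) ip (br y (br x e)) e)
  - 2^-1 * (ip (br h x) y + ip (br h y) x)}.
Proof.
move=> x y Ux Uy; have FUe e : e \in F -> e \in U by move/(proj1 FU).
pose D := koszul.
rewrite /ricci (trace_on_frame Eip FU); first last.
- move=> z Uz; rewrite /curvature.
  have kU u v : u \in U -> v \in U -> koszul u v \in U by exact: koszul_closed.
  by rewrite !memvB ?kU ?brU.
- move=> a u v; rewrite /curvature.
  have -> : br (a *: u + v) x = a *: br u x + br v x by exact: lbr_linl.
  rewrite !koszul_linl koszul_linr !scalerBr !opprD.
  by rewrite (addrACA (a *: koszul u _)) [LHS]addrACA.
(* Contracted over the frame, Koszul's formula leaves only tr(ad (D x y)), up to sign;
   [ip_derived_mean] then removes the bracket term of D x y. *)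
have T1 : \sum_(e <- F) ip e (D e (D x y)) =
    - (2^-1 * (ip (br h x) y + ip (br h y) x)).
  have UD : D x y \in U by apply: koszul_closed.
  have <- : ip (D x y) h = 2^-1 * (ip (br h x) y + ip (br h y) x).
    by rewrite koszulE // (ipC (br x y)) ip_derived_mean // add0r.
  rewrite ipC hE // -sumrN; apply: eq_big_seq => e /FUe Ue.
  rewrite ipC koszulE // (lbr_alt Lbr) (brN (D x y)).
  rewrite (ipC 0) linear0 addr0 (ipC (- _)) linearN /= opprK (ipC e).
  by field.
have T2 : \sum_(e <- F) ip e (D x (D e y)) =
    - \sum_(e <- F) \sum_(e' <- F) (ip (D x e) e' * ip (D e y) e').
  rewrite -sumrN; apply: eq_big_seq => e /FUe Ue.
  have UDe : D e y \in U by apply: koszul_closed.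
  have /eqP := koszul_metric Ue UDe Ux; rewrite addrC addr_eq0 => /eqP ->.
  rewrite (parseval Eip FU) ?koszul_closed //; congr (- _).
  by apply: eq_bigr => e' _; rewrite [ip e' (D x e)]ipC [ip e' (D e y)]ipC.
have T3 : \sum_(e <- F) ip e (D (br e x) y) = \sum_(e <- F) 2^-1 *
    (ip (br y (br x e)) e + ip (br (br x e) e) y + ip (br x e) (br y e)).
  apply: eq_big_seq => e /FUe Ue.
  have ipN u v : ip (- u) v = - ip u v by rewrite ipC linearN /= ipC.
  have E1 : br (br e x) y = br y (br x e) by rewrite brN (brN e x) linearN opprK.
  have E2 : br e (br e x) = br (br x e) e by rewrite (brN e x) linearN /= -brN.
  rewrite ipC koszulE // E1 E2 (brN e x) (brN e y) linearN /= ipN opprK.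
  by rewrite (ipC (br y e)).
have T4 : \sum_(e <- F) \sum_(e' <- F) (ip (D x e) e' * ip (D e y) e') =
    \sum_(e <- F) (2^-1 * ip (br (br x e) e) y +
     4^-1 * \sum_(e' <- F) ip (br e e') x * ip (br e e') y).
  pose u e e' := ip (br x e) e'; pose X e e' := ip (br e e') x.
  pose v e e' := ip (br y e) e'; pose Y e e' := ip (br e e') y.
  have XN e e' : X e' e = - X e e' by rewrite /X brN ipC linearN /= ipC.
  have YN e e' : Y e' e = - Y e e' by rewrite /Y brN ipC linearN /= ipC.
  (* The product of the two Koszul expressions is symmetrized in (e, e'); what survives is u * Y and
     X * Y. *)
  transitivity (\sum_(e <- F) \sum_(e' <- F)
      (2^-1 * (u e e' * Y e' e) + 4^-1 * (X e e' * Y e e'))).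
    transitivity (\sum_(e <- F) \sum_(e' <- F) (4^-1 *
      ((u e e' - u e' e + X e' e) * (- v e e' - v e' e + Y e' e)))); last first.
      by apply: sum2_sym => e e'; rewrite (XN e e') (YN e e'); field.
    apply: eq_big_seq => e /FUe Ue; apply: eq_big_seq => e' /FUe Ue'.
    have ipN w z : ip (- w) z = - ip w z by rewrite ipC linearN /= ipC.
    by rewrite !koszulE // (brN e' x) (brN e y) !ipN /u /v /X /Y (brN e' y) ipN;
      field.
  apply: eq_big_seq => e /FUe Ue.
  rewrite big_split /= -!mulr_sumr; congr (_ * _ + _).
  have Uxe : br x e \in U by apply: brU.
  rewrite [RHS]ipC (linear_frame (lbr_linl Lbr e) FU Uxe) linear_sum /=.
  by apply: eq_bigr => e' _; rewrite linearZ /= /u /Y (ipC e') (ipC y).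
rewrite /curvature.
under eq_bigr => e _ do rewrite !linearB /=.
rewrite !sumrB T1 T2 opprK T4 T3 -!mulr_sumr !big_split /= -!mulr_sumr.
by field.
Qed.

End RicciFormula.

(** [vspace_of] turns the predicate into a subspace, so that inclusion of spans applies. *)
Lemma span_ind (K : fieldType) (V : vectType K) (X : seq V) (P : V -> Prop) :
  P 0 -> (forall a x y, P x -> P y -> P (a *: x + y)) ->
  {in X, forall v, P v} -> {in <<X>>%VS, forall x, P x}.
Proof.
move=> P0 PD PX x xX; apply/mem_vspace_of => //; move: x xX; apply/subvP.
by apply/span_subvP => v /PX Pv; apply/mem_vspace_of.
Qed.

(** * Extension of a frame by an orthogonal complement *)

Section Complement.
Variables (R : realType) (V : vectType R) (Q : V -> V -> R).
Hypothesis EQ : euclidean Q.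

HB.instance Definition _ x :=
  GRing.isLinear.Build R V R *%R (Q x) (euclidean_lin EQ x).

Lemma frame_extend (W U : {vspace V}) (F : seq V) : frame Q W F -> (W <= U)%VS ->
  exists2 F', frame Q U (F ++ F') & {in W & F', forall x e, Q x e = 0}.
Proof.
move=> FF sWU; pose p x := x - \sum_(e <- F) Q e x *: e.
pose C := <<[seq p x | x <- vbasis U]>>%VS.
have WC : {in W & C, forall x y, Q x y = 0}.
  move=> x y Wx; move: y; apply: span_ind => [|a y z Cy Cz|_ /mapP[y _ ->]].
  - by rewrite linear0.
  - by rewrite linearP /= Cy Cz mulr0 addr0.
  - by have [_ ->] := frame_proj EQ FF y.
have [F' FC] := frame_ex EQ C; exists F'; last by move=> x e Wx /(proj1 FC); apply: WC.
suff -> : U = (W + C)%VS by apply: frame_cat.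
apply/eqP; rewrite eqEsubv subv_add sWU /=; apply/andP; split; last first.
  apply/span_subvP => _ /mapP[x /vbasis_mem Ux ->]; apply: memvB => //.
  by apply: (subvP sWU); have [] := frame_proj EQ FF x.
rewrite -{1}(span_basis (vbasisP U)); apply/span_subvP => x xU.
have -> : x = \sum_(e <- F) Q e x *: e + p x by rewrite addrC subrK.
apply: memv_add; first by have [] := frame_proj EQ FF x.
by apply: memv_span; apply: map_f.
Qed.

End Complement.

(** * Einstein metric on the solvable part of a parabolic subalgebra *)

Section Parabolic.
Variables (R : realType) (V : vectType R) (br : V -> V -> V) (Q : V -> V -> R).
Hypotheses (Lbr : lie_bracket br) (EQ : euclidean Q).
Variable st : V -> V.
Hypotheses (st_lin : linear st) (stK : involutive st).
Hypothesis st_br : forall x y, st (br x y) = br (st y) (st x).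
Hypothesis Q_st : forall x y, Q (st x) (st y) = Q x y.
Hypothesis Q_br : forall x y z, Q (br x y) z = Q y (br (st x) z).
Variable tau : V -> V.
Hypotheses (tau_lin : linear tau) (tauK : involutive tau).
Hypothesis tau_br : forall x y, tau (br x y) = br (tau x) (tau y).
Hypothesis Q_tau : forall x y, Q (tau x) (tau y) = Q x y.
Variable g : {vspace V}.
Hypothesis g_br : {in g &, forall x y, br x y \in g}.
Hypothesis g_st : {in g, forall x, st x \in g}.
Hypothesis g_tau : {in g, forall x, tau x \in g}.
Hypothesis g_killing : {in g &, forall x y, killing_form br g x y = Q x (st y)}.
Variable aa : {vspace V}.
Hypotheses (aa_g : (aa <= g)%VS) (aa_st : {in aa, forall A, st A = A}).
Hypothesis aa_tau : {in aa, forall A, tau A = A}.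
Hypothesis aa_abel : {in aa &, forall A B, br A B = 0}.
Variables (L : seq V) (w : V -> V -> R).
Hypotheses (L_g : {subset L <= g}) (L_neq0 : 0 \notin L).
Hypothesis L_weight : {in L & aa, forall v A, br A v = w v A *: v}.
Hypothesis L_tau : {in L, forall v, tau v = v \/ tau v = - v}.
(** The weight vectors and their transposes fill everything outside the centralizer of [aa]. *)
Hypothesis L_complete : {in g, forall x,
  {in L, forall v, Q v x = 0 /\ Q (st v) x = 0} -> {in aa, forall A, br A x = 0}}.
(** Maximality of [aa] among the elements fixed by both [st] and [tau]; it is used for the mean
    curvature vector. *)
Hypothesis L_complete_sym : {in g, forall x, st x = x -> tau x = x ->
  {in L, forall v, Q v x = 0} -> {in aa, forall A, Q A x = 0} -> x = 0}.
Variables (b : {vspace V}) (Z : V).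
Hypotheses (b_aa : (b <= aa)%VS) (Zb : Z \in b).
Hypothesis wZ_ge0 : {in L, forall v, 0 <= w v Z}.
(** With [mem_b], this makes [b] the part of [aa] killed by every weight that vanishes at [Z]. *)
Hypothesis wb0 : {in L, forall v, w v Z = 0 -> {in b, forall A, w v A = 0}}.
Hypothesis mem_b : {in aa, forall A,
  {in L, forall v, w v Z = 0 -> w v A = 0} -> A \in b}.

HB.instance Definition _ x :=
  GRing.isLinear.Build R V V *:%R (br x) (lbr_linr Lbr x).
HB.instance Definition _ x :=
  GRing.isLinear.Build R V R *%R (Q x) (euclidean_lin EQ x).
HB.instance Definition _ := GRing.isLinear.Build R V V *:%R st st_lin.
HB.instance Definition _ := GRing.isLinear.Build R V V *:%R tau tau_lin.

Let QC := euclidean_sym EQ.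
Let brN := lbr_anti Lbr.

Definition nilrad : {vspace V} := <<[seq v <- L | (0 < w v Z)%R]>>%VS.
Let nn := nilrad.

Let Zaa : Z \in aa. Proof. exact: (subvP b_aa). Qed.

Let Q_brA A x y : A \in aa -> Q (br A x) y = Q x (br A y).
Proof. by move=> aA; rewrite Q_br aa_st. Qed.

Let eig_orth A x y s t : A \in aa -> br A x = s *: x -> br A y = t *: y -> s != t ->
  Q x y = 0.
Proof.
move=> aA Ax Ay st0; have := Q_brA x y aA; rewrite Ax Ay linearZ /= euclZl //.
move/eqP; rewrite -subr_eq0 -mulrBl mulf_eq0 subr_eq0 (negPf st0) /=.
by move/eqP.
Qed.

Let eig_st A x s : A \in aa -> br A x = s *: x -> br A (st x) = - s *: st x.
Proof.
move=> aA Ax; rewrite brN -{1}(aa_st aA) -st_br Ax linearZ /=.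
by rewrite scaleNr.
Qed.

Let L_eig v : v \in L -> br Z v = w v Z *: v.
Proof. by move=> Lv; apply: L_weight. Qed.

(** The residue of x after projection on the span still has eigenvalue t > 0. It is therefore
    orthogonal to L and to the transposes of L, whose eigenvalues are at most 0, so [L_complete]
    makes t times the residue vanish. *)
Lemma eigen_mem x t : x \in g -> 0 < t -> br Z x = t *: x ->
  x \in <<[seq v <- L | w v Z == t]>>%VS.
Proof.
move=> gx t0 Zx; set W := <<_>>%VS.
have [F FW] := frame_ex EQ W; have [Wp px] := frame_proj EQ FW x.
set p := \sum_(e <- F) _ in Wp px; set y := x - p in px.
have gp : p \in g.
  move: p Wp {px y}; apply/subvP/span_subvP => v; rewrite mem_filter => /andP[_].
  exact: L_g.
have gy : y \in g by apply: memvB.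
have Zp : br Z p = t *: p.
  move: p Wp {px y gp gy}.
  apply: span_ind => [|a u v Zu Zv|v]; first by rewrite linear0 scaler0.
    by rewrite linearP /= Zu Zv scalerDr !scalerA mulrC.
  by rewrite mem_filter => /andP[/eqP <- Lv]; apply: L_eig.
have Zy : br Z y = t *: y by rewrite linearB /= Zx Zp scalerBr.
suff y0 : y = 0 by rewrite -(subrK p x) -/y y0 add0r.
have := L_complete gy; apply/contraPeq => y0 /(_ _)/(_ _ Zaa) H.
have : {in L, forall v : V, Q v y = 0 /\ Q (st v) y = 0}.
  move=> v Lv; split; last first.
    apply: (eig_orth Zaa (eig_st Zaa (L_eig Lv)) Zy).
    by rewrite lt_eqF // (le_lt_trans _ t0) // oppr_le0 wZ_ge0.
  have [wt|wt] := eqVneq (w v Z) t; last exact: (eig_orth Zaa (L_eig Lv) Zy).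
  by apply: px; apply: memv_span; rewrite mem_filter wt eqxx.
move/H/eqP; rewrite Zy scaler_eq0 (negPf y0) orbF gt_eqF //.
Qed.

Let eigen_nn x t : x \in g -> 0 < t -> br Z x = t *: x -> x \in nn.
Proof.
move=> gx t0 Zx; move: x gx Zx (eigen_mem gx t0 Zx) => x _ _; apply/subvP.
by apply: sub_span => v; rewrite !mem_filter => /andP[/eqP -> ->]; rewrite t0.
Qed.

Let nn_ind (P : V -> Prop) :
  P 0 -> (forall a x y, P x -> P y -> P (a *: x + y)) ->
  (forall v t, v \in L -> v \in nn -> br Z v = t *: v -> 0 < t -> P v) ->
  {in nn, forall x, P x}.
Proof.
move=> P0 PD PL; apply: span_ind => // v vL.
have nv : v \in nn by apply: memv_span.
by move: vL; rewrite mem_filter => /andP[v0 Lv]; apply: PL (L_eig Lv) v0.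
Qed.

Let nn_g : {subset nn <= g}.
Proof. by apply: nn_ind => [|a x y gx gy|v t /L_g]; rewrite ?mem0v ?memvD ?memvZ. Qed.

Let nn_br : {in nn &, forall x y, br x y \in nn}.
Proof.
move=> x y nx; move: y; apply: nn_ind => [|a y z nxy nxz|v t Lv _ Zv t0].
- by rewrite linear0 mem0v.
- by rewrite linearP memvD ?memvZ.
move: x nx; apply: nn_ind => [|a y z nyv nzv|u s Lu _ Zu s0].
- by rewrite brN linear0 oppr0 mem0v.
- by rewrite (lbr_linl Lbr) memvD ?memvZ.
apply: (@eigen_nn _ (s + t)); rewrite ?g_br ?L_g ?addr_gt0 //.
rewrite (lbr_leibniz Lbr) Zu Zv linearZ /= scalerDl; congr (_ + _).
by rewrite lbrZl.
Qed.

Let aa_nn : {in aa & nn, forall A x, br A x \in nn}.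
Proof.
move=> A x aA; move: x; apply: nn_ind => [|a y z nxy nxz|v t Lv nv _ _].
- by rewrite linear0 mem0v.
- by rewrite linearP memvD ?memvZ.
by rewrite L_weight // memvZ.
Qed.

Let cent_nn x : x \in g -> br Z x = 0 -> {in nn, forall y, br x y \in nn}.
Proof.
move=> gx Zx; apply: nn_ind => [|a y z nxy nxz|v t Lv _ Zv t0].
- by rewrite linear0 mem0v.
- by rewrite linearP memvD ?memvZ.
apply: (@eigen_nn _ t) => //; first by apply: g_br => //; apply: L_g.
by rewrite (lbr_leibniz Lbr) Zx Zv linearZ /= brN linear0 oppr0 add0r.
Qed.

Let nn_aa : {in aa & nn, forall A x, Q A x = 0}.
Proof.
move=> A x aA; move: x; apply: nn_ind => [|a y z nxy nxz|v t Lv _ Zv t0].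
- by rewrite linear0.
- by rewrite linearP /= nxy nxz mulr0 addr0.
apply: (eig_orth Zaa _ Zv (s := 0)); first by rewrite scale0r aa_abel.
by rewrite lt_eqF.
Qed.

Let nn_st : {in nn &, forall x y, Q x (st y) = 0}.
Proof.
move=> x y nx; move: y; apply: nn_ind => [|a y z nxy nxz|v t Lv _ Zv t0].
- by rewrite !linear0.
- by rewrite !linearP /= nxy nxz mulr0 addr0.
move: x nx; apply: nn_ind => [|a y z nxy nxz|u s Lu _ Zu s0].
- by rewrite QC linear0.
- by rewrite QC linearP /= !(QC (st v)) nxy nxz mulr0 addr0.
apply: (eig_orth Zaa Zu (eig_st Zaa Zv)).
by rewrite gt_eqF // (lt_trans _ s0) // oppr_lt0.
Qed.

(* Such an x lies in the Levi factor of the parabolic subalgebra. *)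
Let levi_b x : x \in g -> {in nn, forall y, Q y x = 0 /\ Q (st y) x = 0} ->
  {in b, forall A, br A x = 0}.
Proof.
move=> gx nx A bA; have aA := subvP b_aa _ bA.
have gy : br A x \in g by apply: g_br => //; apply: (subvP aa_g).
have y0 : {in L, forall v, Q v (br A x) = 0 /\ Q (st v) (br A x) = 0}.
  move=> v Lv; rewrite -!Q_brA // (eig_st aA (L_weight Lv aA)) L_weight //.
  rewrite !euclZl //; have := wZ_ge0 Lv; rewrite le_eqVlt => /predU1P[v0|v0].
    by rewrite (wb0 Lv (esym v0)) // oppr0 !mul0r.
  have /nx[-> ->] : v \in nn by apply: memv_span; rewrite mem_filter v0.
  by rewrite !mulr0.
apply: (eucl_eq0 EQ); rewrite Q_brA // (L_complete gy y0) //.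
by rewrite linear0.
Qed.

Variable F : seq V.
Hypothesis FF : frame Q nn F.

Let Fnn e : e \in F -> e \in nn. Proof. exact: (proj1 FF). Qed.

Definition nil_trace x := \sum_(e <- F) Q e (br x e).
Let T := nil_trace.

(** By [Q_mean] this vector represents y -> tr(ad y) on nn for [Q]; the mean curvature vector for
    the metric is half of it. *)
Definition nil_mean := \sum_(e <- F) br e (st e).
Let Hn := nil_mean.

Let Q_mean y : Q Hn y = T y.
Proof.
rewrite /Hn /nil_mean eucl_suml //; apply: eq_bigr => e _.
rewrite Q_br brN linearN /= -{1}(stK y) -st_br Q_st brN linearN /= opprK.
by rewrite -Q_br QC.
Qed.

(** Since f shifts the eigenvalues of ad A by s, s tr(f) is the trace of the commutator of ad A and
    f, which is zero. *)
Let trace_shift A s (f : V -> V) : A \in aa -> s != 0 -> linear f ->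
  {in nn, forall x, f x \in nn} ->
  {in nn, forall x, br A (f x) = f (br A x) + s *: f x} ->
  \sum_(e <- F) Q e (f e) = 0.
Proof.
move=> aA s0 f_lin f_nn Af; apply/eqP.
have := trace_comm EQ FF (lbr_linr Lbr A) f_lin (fun x => aa_nn aA) f_nn.
under eq_big_seq => e /Fnn ne.
  rewrite Af // linearD linearZ /=.
  over.
rewrite big_split -mulr_sumr /= => /eqP; rewrite addrC -subr_eq0 addrK.
by rewrite mulf_eq0 (negPf s0).
Qed.

Let T_bracket x y : {in nn, forall z, br x z \in nn} ->
  {in nn, forall z, br y z \in nn} -> T (br x y) = 0.
Proof.
move=> nx ny; rewrite /T /nil_trace; apply/eqP.
under eq_bigr => e _.
  have -> : br (br x y) e = br x (br y e) - br y (br x e).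
    by rewrite (lbr_leibniz Lbr x) addrK.
  rewrite linearB /=; over.
rewrite sumrB subr_eq0; apply/eqP.
by apply: (trace_comm EQ FF); first [exact: lbr_linr | done].
Qed.

Let T_weight A x s : A \in aa -> s != 0 -> {in nn, forall z, br x z \in nn} ->
  br A x = s *: x -> T x = 0.
Proof.
move=> aA s0 nx Ax; apply: (trace_shift aA s0 (lbr_linr Lbr x) nx) => y ny.
by rewrite (lbr_leibniz Lbr) Ax lbrZl // addrC.
Qed.

Let nn_tau : {in nn, forall x, tau x \in nn}.
Proof.
apply: nn_ind => [|a x y nx ny|v t Lv nv _ _]; first by rewrite linear0 mem0v.
  by rewrite linearP memvD ?memvZ.
by have [->|->] := L_tau Lv; rewrite ?memvN.
Qed.

(** On nn, ad (tau x) is the conjugate of ad x by tau. *)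
Let T_tau x : {in nn, forall z, br x z \in nn} -> T (tau x) = T x.
Proof.
move=> nx; rewrite /T /nil_trace.
have f_lin : linear (fun z => br x (tau z)) by move=> a u v; rewrite !linearP.
have f_nn : {in nn, forall z, br x (tau z) \in nn}.
  by move=> z nz; apply/nx/nn_tau.
have := trace_comm EQ FF tau_lin f_lin nn_tau f_nn.
under eq_bigr do rewrite tau_br tauK.
by move=> ->; apply: eq_bigr => e _; rewrite tauK.
Qed.

Let mean_g : Hn \in g.
Proof.
rewrite /Hn /nil_mean big_seq; apply: memv_suml => e /Fnn/nn_g ge.
by apply: g_br => //; apply: g_st.
Qed.

Let mean_st : st Hn = Hn.
Proof.
by rewrite /Hn /nil_mean linear_sum /=; apply: eq_bigr => e _; rewrite st_br stK.
Qed.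

Let L_nn v : v \in L -> 0 < w v Z -> v \in nn.
Proof. by move=> Lv v0; apply: memv_span; rewrite mem_filter v0. Qed.

Let L_act v : v \in L -> {in nn, forall z, br v z \in nn}.
Proof.
move=> Lv; have := wZ_ge0 Lv; rewrite le_eqVlt => /predU1P[v0|/(L_nn Lv) nv].
  by apply: cent_nn; rewrite ?L_g // L_eig // -v0 scale0r.
by move=> z nz; apply: nn_br.
Qed.

Let T_L v : v \in L -> (exists2 A, A \in aa & w v A != 0) -> T v = 0.
Proof.
by move=> Lv [A aA v0]; apply: (T_weight aA v0 (L_act Lv)); apply: L_weight.
Qed.

Hypothesis w_neq0 : {in L, forall v, exists2 A, A \in aa & w v A != 0}.

(** Let y be the component of Hn orthogonal to [aa]. Vectors of nonzero weight act on nn with trace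
    zero, so y is orthogonal to L. Being symmetric, y is also orthogonal to the transposes of L, so
    it commutes with Z. Invariance of the trace form under tau gives tau y = y, and [L_complete_sym]
    concludes. *)
Let mean_aa : Hn \in aa.
Proof.
have [Fa FaE] := frame_ex EQ aa; have [ap py] := frame_proj EQ FaE Hn.
set p := \sum_(e <- Fa) _ in ap py; set y := Hn - p in py.
have gy : y \in g by rewrite memvB // (subvP aa_g).
have sty : st y = y by rewrite linearB /= mean_st aa_st.
have Ly : {in L, forall v, Q v y = 0}.
  move=> v Lv; rewrite linearB /= QC Q_mean (T_L Lv (w_neq0 Lv)) sub0r.
  have [A aA v0] := w_neq0 Lv; apply/eqP; rewrite oppr_eq0; apply/eqP.
  by apply: (eig_orth aA (L_weight Lv aA) (t := 0)); rewrite ?scale0r ?aa_abel.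
have Zy : br Z y = 0.
  apply: L_complete => // v Lv; split; first exact: Ly.
  by rewrite -sty Q_st Ly.
have ny : {in nn, forall z, br y z \in nn} by apply: cent_nn.
suff tauy : tau y = y.
  have /eqP := L_complete_sym gy sty tauy Ly py.
  by rewrite subr_eq0 => /eqP ->.
apply/eqP; rewrite eq_sym -subr_eq0; apply/eqP; apply: (eucl_eq0 EQ).
set u := y - tau y.
have uE : u = Hn - tau Hn.
  by rewrite /u /y linearB /= (aa_tau ap) opprB addrA subrK.
have gu : u \in g by rewrite memvB // g_tau.
have Zu : br Z u = 0.
  rewrite linearB /= -{2}(aa_tau Zaa) -tau_br Zy linear0 subr0.
  by [].
(* The norm Q u u equals T u - T (tau u), which vanishes by [T_tau]. *)
rewrite {1}uE QC linearB /= !(QC u) Q_mean -{2}(tauK u) Q_tau Q_mean T_tau ?subrr //.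
exact: cent_nn.
Qed.

(** For v of weight 0 at Z, Q([Hn, v], v) is minus the trace on nn of ad [st v, v], the commutator
    of two operators preserving nn. It is zero, so the weight of v vanishes at Hn. *)
Let mean_b : Hn \in b.
Proof.
apply: mem_b => // v Lv v0.
have Zv : br Z v = 0 by rewrite L_eig // v0 scale0r.
have Zsv : br Z (st v) = 0 by rewrite (eig_st Zaa (L_eig Lv)) v0 oppr0 scale0r.
have : Q (br Hn v) v = 0.
  rewrite brN QC linearN /= QC Q_br Q_mean T_bracket ?oppr0 //.
    by apply: cent_nn; rewrite ?g_st ?L_g.
  exact: L_act.
rewrite L_weight // euclZl // => /eqP; rewrite mulf_eq0 => /orP[/eqP //|/eqP].
by move/(eucl_eq0 EQ) => v_eq0; move: L_neq0; rewrite -v_eq0 Lv.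
Qed.

Let st_frame : frame Q <<map st F>>%VS (map st F).
Proof.
split=> [x|]; first exact: memv_span.
apply: span_ind => [|a x y Ex Ey|_ /mapP[e Fe ->]].
- by rewrite big1 // => e _; rewrite linear0 scale0r.
- rewrite {1}Ex {1}Ey scaler_sumr -big_split /=; apply: eq_bigr => e _.
  by rewrite linearP /= scalerDl scalerA.
rewrite big_map {1}((proj2 FF) e (Fnn Fe)) linear_sum /=.
by apply: eq_bigr => e' _; rewrite linearZ /= Q_st.
Qed.

(** [F0] frames the orthogonal complement of nn + st nn, the Levi factor. *)
Let g_frame : exists2 F0, frame Q g ((F ++ map st F) ++ F0) &
  {in F0, forall f, {in nn, forall y, Q y f = 0 /\ Q (st y) f = 0}}.
Proof.
have stF x : x \in nn -> st x \in <<map st F>>%VS.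
  move=> nx; rewrite ((proj2 FF) x nx) linear_sum big_seq; apply: memv_suml => e Fe.
  by rewrite linearZ memvZ ?memv_span ?map_f.
have FFs : frame Q (nn + <<map st F>>) (F ++ map st F).
  apply: frame_cat => // x y nx; move: y.
  apply: span_ind => [|a y z Qy Qz|_ /mapP[e /Fnn ne ->]]; first by rewrite linear0.
    by rewrite linearP /= Qy Qz mulr0 addr0.
  exact: nn_st.
have sg : (nn + <<map st F>> <= g)%VS.
  rewrite subv_add; apply/andP; split; first by apply/subvP => x; apply: nn_g.
  by apply/span_subvP => _ /mapP[e /Fnn/nn_g ge ->]; apply: g_st.
have [F0 gF WF0] := frame_extend EQ FFs sg; exists F0 => // f Ff y ny.
split; apply: WF0 => //; first exact: (subvP (addvSl _ _)).
by apply: (subvP (addvSr _ _)); apply: stF.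
Qed.

(** In the sums over nn and st nn, [S1] gathers the products [x, e], [y, e], and [Pn] the
    nn-components of [x, st e] and [y, st e]. *)
Let S1 x y := \sum_(e <- F) Q (br x e) (br y e).
Let Pn x y := \sum_(e <- F) \sum_(e' <- F) Q e' (br x (st e)) * Q e' (br y (st e)).

Let killing_frame Fg x y : frame Q g Fg -> x \in g -> y \in g ->
  Q x y = \sum_(e <- Fg) Q (br x e) (br y e).
Proof.
move=> FgE gx gy; rewrite -(Q_st x) QC -g_killing ?g_st //.
rewrite /killing_form (trace_on_frame EQ FgE); first last.
- by move=> z gz; rewrite !g_br ?g_st.
- exact: lbr_linear_comp.
by apply: eq_bigr => e _; rewrite -Q_br QC.
Qed.

(** Q x y is the trace over g of the adjoint of ad x composed with ad y. The piece nn contributes S1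
    and the Levi piece S0. The piece st nn contributes Pn + S1 + S0, according to whether [x, st e]
    is tested against nn, st nn or the Levi part. The second identity expands -tr(ad [st x, y]) on
    nn as a difference of two such sums. *)
Lemma killing_nilrad : exists S0 : V -> V -> R, {in nn &, forall x y,
  Q x y = 2 * S1 x y + 2 * S0 x y + Pn x y /\ Q (br Hn x) y = Pn x y + S0 x y}.
Proof.
have [F0 FgE F0n] := g_frame.
pose S0 x y := \sum_(e <- F0) Q (br x e) (br y e).
exists S0 => x y nx ny; have [gx gy] := (nn_g nx, nn_g ny).
have F0g f : f \in F0 -> f \in g.
  by move=> Ff; apply: (proj1 FgE); rewrite mem_cat Ff orbT.
have F0_nn f z : f \in F0 -> z \in nn -> br z f \in nn.
  move=> Ff nz; rewrite brN memvN; apply: cent_nn => //; first exact: F0g.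
  by apply: levi_b => //; [exact: F0g | exact: F0n].
(* [F0] itself need not be stable under st: the sum over it is isolated by comparing Parseval's
   identity on g before and after st, which exchanges the other two pieces. *)
have F0_st u v : u \in g -> v \in g ->
    \sum_(f <- F0) Q (st f) u * Q (st f) v = \sum_(f <- F0) Q f u * Q f v.
  move=> gu gv; have /eqP := Q_st u v.
  rewrite (parseval EQ FgE) ?g_st // (parseval EQ FgE gu) !big_cat /= !big_map.
  have E s0 : \sum_(f <- s0) Q f (st u) * Q f (st v) =
      \sum_(f <- s0) Q (st f) u * Q (st f) v.
    by apply: eq_bigr => f _; rewrite -(Q_st f) -(Q_st f (st v)) !stK.
  have E' : \sum_(f <- F) Q (st f) (st u) * Q (st f) (st v) =
      \sum_(f <- F) Q f u * Q f v by apply: eq_bigr => f _; rewrite !Q_st.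
  rewrite !E E' (addrC (\sum_(f <- F) Q f u * _)) => /eqP.
  exact: addrI.
have br_st z e f : Q f (br z (st e)) = - Q (st f) (br (st z) e).
  by rewrite -{1}(stK f) -{1}(stK z) -st_br Q_st brN linearN.
have S0E : \sum_(e <- F) \sum_(f <- F0) Q f (br x (st e)) * Q f (br y (st e))
    = S0 x y.
  under eq_big_seq => e Fe.
    under eq_bigr do rewrite !br_st mulrNN.
    have ge := nn_g (Fnn Fe); rewrite (F0_st _ _ (g_br (g_st gx) ge) (g_br (g_st gy) ge)).
    over.
  rewrite exchange_big /=; apply: eq_big_seq => f Ff.
  rewrite (parseval EQ FF (F0_nn f x Ff nx)); apply: eq_bigr => e _.
  have E z : Q f (br (st z) e) = Q e (br z f) by rewrite -Q_br QC.
  by rewrite !E.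
have S1E : \sum_(e <- F) \sum_(f <- F) Q (st f) (br x (st e)) *
    Q (st f) (br y (st e)) = S1 x y.
  rewrite exchange_big /=; apply: eq_big_seq => f Ff.
  rewrite (parseval EQ FF (nn_br nx (Fnn Ff))); apply: eq_bigr => e _.
  have E z : Q (st f) (br z (st e)) = - Q e (br z f).
    by rewrite br_st stK -Q_br QC.
  by rewrite !E mulrNN.
have SmE : \sum_(e <- F) Q (br x (st e)) (br y (st e)) = Pn x y + S1 x y + S0 x y.
  rewrite -S0E -S1E -!big_split /=; apply: eq_big_seq => e /Fnn/nn_g ge.
  by rewrite (parseval EQ FgE) ?g_br ?g_st // !big_cat /= big_map.
split.
  rewrite (killing_frame FgE gx gy) !big_cat big_map /= SmE -/(S1 x y) -/(S0 x y).
  by ring.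
have -> : Q (br Hn x) y = - T (br (st x) y).
  by rewrite brN QC linearN /= QC Q_br Q_mean.
have TE : T (br (st x) y) = S1 x y - \sum_(e <- F) Q (br x (st e)) (br y (st e)).
  rewrite -sumrB; apply: eq_bigr => e _.
  have -> : br (br (st x) y) e = br (st x) (br y e) - br y (br (st x) e).
    by rewrite (lbr_leibniz Lbr (st x)) addrK.
  rewrite linearB /= -Q_br; congr (_ - _).
  rewrite QC Q_br.
  rewrite -[LHS]Q_st !st_br !stK brN (brN (st e)) QC linearN /= QC linearN /= opprK.
  by rewrite QC.
by rewrite TE SmE; ring.
Qed.

(** b centralizes the Levi part, and nn and st nn contribute equally. *)
Lemma killing_torus : {in b &, forall A B,
  Q A B = 2 * \sum_(e <- F) Q (br A e) (br B e)}.
Proof.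
move=> A B bA bB; have [aA aB] := (subvP b_aa A bA, subvP b_aa B bB).
have [F0 FgE F0n] := g_frame.
have F0_0 : \sum_(f <- F0) Q (br A f) (br B f) = 0.
  rewrite big_seq big1 // => f Ff.
  have -> : br A f = 0; last by rewrite QC linear0.
  apply: (levi_b _ (F0n f Ff)) => //.
  by apply: (proj1 FgE); rewrite mem_cat Ff orbT.
rewrite (killing_frame FgE) ?(subvP aa_g) // !big_cat big_map /= F0_0 addr0.
rewrite mulr_natl mulr2n; congr (_ + _); apply: eq_bigr => e _.
rewrite -[LHS]Q_st !st_br !stK (aa_st aA) (aa_st aB) brN (brN e B).
by rewrite QC linearN /= QC linearN opprK.
Qed.

Let nn_trace0 (f : V -> V -> V) : (forall e, linear (f^~ e)) ->
  (forall v t, v \in L -> v \in nn -> br Z v = t *: v -> 0 < t ->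
    \sum_(e <- F) Q e (f v e) = 0) ->
  {in nn, forall x, \sum_(e <- F) Q e (f x e) = 0}.
Proof.
move=> f_lin fL; apply: nn_ind => // [|a y z Ty Tz].
  apply: big1 => e _; have := f_lin e (-1) 0 0.
  by rewrite scaler0 addr0 scaleN1r addNr => ->; rewrite linear0.
transitivity (a * \sum_(e <- F) Q e (f y e) + \sum_(e <- F) Q e (f z e)).
  by rewrite mulr_sumr -big_split /=; apply: eq_bigr => e _; rewrite f_lin linearP.
by rewrite Ty Tz mulr0 addr0.
Qed.

Let trace0_nn x : x \in nn -> T x = 0.
Proof.
move: x; apply: nn_trace0 => [e|v t Lv nv Zv t0]; first exact: lbr_linl.
apply: (T_weight Zaa _ _ Zv); first by rewrite gt_eqF.
by move=> z; apply: nn_br.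
Qed.

Let trace0_aa_nn A x : A \in aa -> x \in nn ->
  \sum_(e <- F) Q e (br A (br x e)) = 0.
Proof.
move=> aA; move: x; apply: nn_trace0 => [e|v t Lv nv Zv t0].
  by move=> a y z; rewrite (lbr_linl Lbr) linearP.
apply: (trace_shift Zaa (lt0r_neq0 t0) (lbr_linear_comp Lbr A v)) => y ny.
  by rewrite aa_nn ?nn_br.
rewrite (lbr_leibniz Lbr Z A) (aa_abel Zaa aA) (lbr_leibniz Lbr Z v) Zv.
by rewrite brN linear0 oppr0 add0r linearD lbrZl // linearZ /= addrC.
Qed.

Let trace0_nn_nn x y : x \in nn -> y \in nn ->
  \sum_(e <- F) Q e (br y (br x e)) = 0.
Proof.
move=> nx; move: y; apply: nn_trace0 => [e|u s Lu nu Zu s0].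
  by move=> a y z; rewrite (lbr_linl Lbr).
move: x nx; apply: nn_trace0 => [e|v t Lv nv Zv t0].
  by move=> a y z; rewrite (lbr_linl Lbr) linearP.
apply: (trace_shift Zaa (lt0r_neq0 (addr_gt0 s0 t0)) (lbr_linear_comp Lbr u v)).
  by move=> y ny; rewrite !nn_br.
move=> y ny; rewrite (lbr_leibniz Lbr Z u) Zu (lbr_leibniz Lbr Z v) Zv.
rewrite (lbrZl Lbr s) (lbrZl Lbr t) linearD linearZ /= [in RHS]scalerDl addrA.
by rewrite addrC.
Qed.

(** The Ricci formula needs a product on the whole space. Adding to [Q] its pullback by the
    projection onto b doubles it on b and leaves it unchanged on nn, which is orthogonal to b. *)
Let metric_ex : exists2 ip0 : V -> V -> R, euclidean ip0 &
  {in b & nn, forall A x, {in b & nn, forall B y,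
     ip0 (A + x) (B + y) = 2 * Q A B + Q x y}}.
Proof.
have [Fb FbE] := frame_ex EQ b.
pose p x := \sum_(e <- Fb) Q e x *: e.
have p_lin : linear p.
  move=> a x y; rewrite /p scaler_sumr -big_split /=; apply: eq_bigr => e _.
  by rewrite linearP scalerDl scalerA.
have pb : {in b, forall A, p A = A} by move=> A bA; apply/esym/(proj2 FbE).
have pn : {in nn, forall x, p x = 0}.
  move=> x nx; rewrite /p big_seq big1 // => e /(proj1 FbE) be.
  by rewrite nn_aa ?scale0r // (subvP b_aa).
exists (fun x y => Q x y + Q (p x) (p y)).
  split=> [x a y z|x y|x x0].
  - by rewrite p_lin !linearP /=; ring.
  - by rewrite QC (QC (p x)).
  - apply: ltr_wpDr; last exact: (euclidean_pos EQ x0).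
    have [->|px] := eqVneq (p x) 0; first by rewrite linear0.
    exact/ltW/(euclidean_pos EQ px).
move=> A x bA nx B y bB ny.
have pD B' y' : B' \in b -> y' \in nn -> p (B' + y') = B'.
  by move=> bB' ny'; have := p_lin 1 B' y'; rewrite !scale1r (pb _ bB') (pn _ ny') addr0.
rewrite !pD // euclDl // !linearD /= (nn_aa (subvP b_aa _ bA) ny).
by rewrite (QC x) (nn_aa (subvP b_aa _ bB) nx); ring.
Qed.

Let U := (b + nn)%VS.

Let U_br : {in b & nn, forall A x, {in b & nn, forall B y,
  br (A + x) (B + y) = br A y - br B x + br x y /\ br (A + x) (B + y) \in nn}}.
Proof.
move=> A x bA nx B y bB ny.
have [aA aB] := (subvP b_aa A bA, subvP b_aa B bB).
suff E : br (A + x) (B + y) = br A y - br B x + br x y.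
  split=> //; rewrite E; apply: memvD; last exact: nn_br.
  by apply: memvB; apply: aa_nn.
by rewrite (lbrDl Lbr) !linearD /= (aa_abel aA aB) add0r (brN x B) addrA.
Qed.

(** Substituting the sums [M1] to [M5] in [ricci_koszul], the sums over the frame of b cancel, and
    what remains is matched with the two Killing form identities. *)
Lemma einstein_nilrad : exists2 ip0 : V -> V -> R, euclidean ip0 /\
  {in b & nn, forall A x, {in b & nn, forall B y,
     ip0 (A + x) (B + y) = 2 * Q A B + Q x y}} & einstein br U ip0.
Proof.
have [ip0 Eip ipE] := metric_ex; exists ip0 => //.
have ipC := euclidean_sym Eip.
have ip00 z : ip0 0 z = 0 by rewrite -(scale0r 0) euclZl // mul0r.
have ip_bn A x : A \in b -> x \in nn -> ip0 A x = 0.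
  move=> bA nx; rewrite -(addr0 A) -(add0r x) ipE ?mem0v //.
  by rewrite (QC 0) !linear0 mulr0 addr0.
have ip_n x A y : x \in nn -> A \in b -> y \in nn -> ip0 x (A + y) = Q x y.
  by move=> nx bA ny; rewrite -(add0r x) ipE ?mem0v // QC linear0 mulr0 !add0r.
have ip_nn x y : x \in nn -> y \in nn -> ip0 x y = Q x y.
  by move=> nx ny; rewrite -[y in LHS]add0r ip_n ?mem0v.
have Fip : frame ip0 nn F.
  split=> [e|x nx]; first exact: Fnn.
  rewrite [LHS]((proj2 FF) x nx); apply: eq_big_seq => e /Fnn ne.
  by rewrite ip_nn.
have [Fb FbE] := frame_ex Eip b; have Fbb e : e \in Fb -> e \in b by move/(proj1 FbE).
have FU : frame ip0 U (Fb ++ F) by apply: frame_cat.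
have brU : {in U &, forall x y, br x y \in U}.
  move=> _ _ /memv_addP[A bA [x nx ->]] /memv_addP[B bB [y ny ->]].
  by apply: (subvP (addvSr _ _)); have [] := U_br bA nx bB ny.
have br_bn e y : e \in b -> y \in nn -> br e y \in nn.
  by move=> be ny; apply: aa_nn => //; apply: (subvP b_aa).
(* The factor 1/2 compensates the factor 2 of the metric on b. *)
pose h := 2^-1 *: Hn.
have bh : h \in b by apply/memvZ/mean_b.
have Uh : h \in U by apply: (subvP (addvSl _ _)).
have hE : {in U, forall z, ip0 h z = \sum_(e <- Fb ++ F) ip0 (br z e) e}.
  move=> _ /memv_addP[A bA [x nx ->]].
  rewrite -{1}[h]addr0 ipE ?mem0v // QC linearZ /= QC Q_mean (QC 0) linear0 addr0.
  rewrite mulVKf ?pnatr_eq0 // big_cat /= big_seq big1 => [|e /Fbb be].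
    rewrite add0r -[LHS]addr0 -{1}(trace0_nn nx) -big_split /=.
    apply: eq_big_seq => e /Fnn ne; have [E nE] := U_br bA nx (mem0v b) ne.
    move: E nE; rewrite add0r (brN 0) linear0 oppr0 subr0 => E nE.
    by rewrite ip_nn // E -linearD QC.
  have [E nE] := U_br bA nx be (mem0v nn); move: nE; rewrite addr0 => nE.
  by rewrite ipC ip_bn.
exists (koszul br ip0 (Fb ++ F)); first exact: koszul_levi_civita.
(* The Ricci form will be -NAB - S1/2 - S0/2 - Pn/4. Since Q A B = 2 NAB and Q x y = 2 S1 + 2 S0 +
   Pn, this is -1/4 of 2 Q A B + Q x y. *)
exists (- 4^-1) => _ _ /memv_addP[A bA [x nx ->]] /memv_addP[B bB [y ny ->]].
have Ux : A + x \in U by apply: memv_add.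
have Uy : B + y \in U by apply: memv_add.
have [S0 /(_ x y nx ny)[Qxy Hxy]] := killing_nilrad.
have QAB := killing_torus bA bB.
rewrite (ricci_koszul Lbr Eip FU brU Uh hE Ux Uy).
have brb C z e : C \in b -> z \in nn -> e \in b ->
    br (C + z) e = br z e /\ br (C + z) e \in nn.
  move=> bC nz be; have [E nE] := U_br bC nz be (mem0v nn).
  move: E nE; rewrite addr0 linear0 sub0r linear0 addr0 => -> nE.
  by rewrite -brN; split=> //; rewrite brN.
have brn C z e : C \in b -> z \in nn -> e \in nn ->
    br (C + z) e = br C e + br z e /\ br (C + z) e \in nn.
  move=> bC nz ne; have [E nE] := U_br bC nz (mem0v b) ne.
  move: E nE; rewrite add0r (brN 0) linear0 oppr0 subr0 => -> nE.
  by split.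
have M1 : \sum_(e <- Fb ++ F) \sum_(e' <- Fb ++ F)
    ip0 (br e e') (A + x) * ip0 (br e e') (B + y) =
    2 * \sum_(e <- Fb) Q (br e x) (br e y) + Pn x y.
  have bbn e : e \in Fb -> \sum_(e' <- Fb ++ F)
      ip0 (br e e') (A + x) * ip0 (br e e') (B + y) = Q (br e x) (br e y).
    move=> /Fbb be; rewrite big_cat /= big_seq big1 ?add0r => [|e' /Fbb be'].
      rewrite (parseval EQ FF) ?br_bn //; apply: eq_big_seq => e' /Fnn ne'.
      by rewrite !ip_n ?br_bn // !Q_brA // (subvP b_aa).
    by rewrite (aa_abel (subvP b_aa _ be) (subvP b_aa _ be')) ip00 mul0r.
  rewrite big_cat /= (eq_big_seq _ bbn).
  under [X in _ + X]eq_big_seq => e Fe do rewrite big_cat /=.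
  rewrite big_split /= addrA mulr_natl mulr2n; congr (_ + _ + _).
    rewrite exchange_big /=; apply: eq_big_seq => e /Fbb be.
    rewrite (parseval EQ FF) ?br_bn //; apply: eq_big_seq => e' /Fnn ne'.
    rewrite brN !ip_n ?memvN ?br_bn // !(QC (- _)) !linearN /= mulrNN !(QC _ (br e e')).
    by rewrite !Q_brA // (subvP b_aa).
  apply: eq_big_seq => e /Fnn ne; apply: eq_big_seq => e' /Fnn ne'.
  rewrite !ip_n ?nn_br // !Q_br.
  have E z : Q e' (br (st e) z) = - Q e' (br z (st e)) by rewrite brN linearN.
  by rewrite !E mulrNN.
pose NAB := \sum_(e <- F) Q (br A e) (br B e).
have M2 : \sum_(e <- Fb ++ F) ip0 (br (A + x) e) (br (B + y) e) =
    \sum_(e <- Fb) Q (br e x) (br e y) + NAB + S1 x y.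
  rewrite big_cat /= -addrA; congr (_ + _).
    apply: eq_big_seq => e /Fbb be.
    have [Ex nEx] := brb A x e bA nx be; have [Ey nEy] := brb B y e bB ny be.
    by rewrite ip_nn // Ex Ey (brN x) (brN y) QC linearN /= QC linearN opprK.
  have c1 : \sum_(e <- F) Q (br A e) (br y e) = 0.
    rewrite -[RHS](trace0_aa_nn (subvP b_aa _ bA) ny).
    by apply: eq_bigr => e _; rewrite Q_brA // (subvP b_aa).
  have c2 : \sum_(e <- F) Q (br x e) (br B e) = 0.
    rewrite -[RHS](trace0_aa_nn (subvP b_aa _ bB) nx).
    by apply: eq_bigr => e _; rewrite QC Q_brA // (subvP b_aa).
  transitivity (NAB + \sum_(e <- F) Q (br A e) (br y e) +
      (\sum_(e <- F) Q (br x e) (br B e) + S1 x y)); last by rewrite c1 c2 addr0 add0r.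
  rewrite -!big_split /=; apply: eq_big_seq => e /Fnn ne.
  have [Ex nEx] := brn A x e bA nx ne; have [Ey nEy] := brn B y e bB ny ne.
  by rewrite ip_nn // Ex Ey (euclDl EQ) !linearD.
have M3 : \sum_(e <- Fb ++ F) ip0 (br (B + y) (br (A + x) e)) e = NAB.
  rewrite big_cat /= big_seq big1 ?add0r => [|e /Fbb be]; last first.
    have [_ nE] := brb A x e bA nx be; have [_ nE'] := brn B y _ bB ny nE.
    by rewrite ipC ip_bn.
  have c1 := trace0_aa_nn (subvP b_aa _ bB) nx.
  have c2 : \sum_(e <- F) Q e (br y (br A e)) = 0.
    rewrite -[RHS](trace0_aa_nn (subvP b_aa _ bA) ny).
    apply: (trace_comm EQ FF); try exact: lbr_linr.
      by move=> z nz; apply: nn_br.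
    by move=> z nz; apply: br_bn.
  have c3 := trace0_nn_nn nx ny.
  transitivity (NAB + \sum_(e <- F) Q e (br B (br x e)) +
      (\sum_(e <- F) Q e (br y (br A e)) + \sum_(e <- F) Q e (br y (br x e)))).
    rewrite -!big_split /=; apply: eq_big_seq => e /Fnn ne.
    have [Ex nEx] := brn A x e bA nx ne; have [Ey nEy] := brn B y _ bB ny nEx.
    rewrite ip_nn // Ey Ex QC !linearD /=; congr (_ + _ + _).
    by rewrite -Q_brA ?(subvP b_aa) // QC.
  by rewrite c1 c2 c3 !addr0.
have M4 : ip0 (br h (A + x)) (B + y) = 2^-1 * (Pn x y + S0 x y).
  rewrite linearD /= (aa_abel (subvP b_aa _ bh) (subvP b_aa _ bA)) add0r.
  by rewrite ip_n ?br_bn // lbrZl // euclZl // Hxy.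
have M5 : ip0 (br h (B + y)) (A + x) = 2^-1 * (Pn x y + S0 x y).
  rewrite linearD /= (aa_abel (subvP b_aa _ bh) (subvP b_aa _ bB)) add0r.
  rewrite ip_n ?br_bn // lbrZl // euclZl // -Hxy QC.
  by rewrite Q_brA // (subvP b_aa _ mean_b).
by rewrite M1 M2 M3 M4 M5 ipE // Qxy QAB -/NAB; field.
Qed.

Let nn_ge t := <<[seq v <- L | (t <= w v Z)%R]>>%VS.

Let nn_ge_br s t : 0 < s -> 0 <= t ->
  {in nn_ge s & nn_ge t, forall x y, br x y \in nn_ge (s + t)}.
Proof.
move=> s0 t0 x y nx; move: y; apply: span_ind => [|a y z Hy Hz|v].
- by rewrite linear0 mem0v.
- by rewrite linearP memvD ?memvZ.
rewrite mem_filter => /andP[tv Lv].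
move: x nx; apply: span_ind => [|a y z Hy Hz|u].
- by rewrite brN linear0 oppr0 mem0v.
- by rewrite (lbr_linl Lbr) memvD ?memvZ.
rewrite mem_filter => /andP[su Lu].
have : br u v \in <<[seq v' <- L | (w v' Z == w u Z + w v Z)%R]>>%VS.
  apply: eigen_mem; first by rewrite g_br ?L_g.
    by apply: ltr_wpDr; [exact: le_trans tv | exact: lt_le_trans su].
  rewrite (lbr_leibniz Lbr) !L_eig // lbrZl // linearZ /= scalerDl.
  by [].
apply/subvP/sub_span => v'; rewrite !mem_filter => /andP[/eqP -> ->].
by rewrite lerD.
Qed.

Let derived_sub (W W' : {vspace V}) :
  {in W &, forall x y, br x y \in W'} -> (derived br W <= W')%VS.
Proof.
move=> WW'; apply/span_subvP => _ /allpairsP[[x y] [/= xW yW ->]].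
by apply: WW'; apply: vbasis_mem.
Qed.

(** The positive values of the weights at Z are at least some d > 0 and bounded above. The first
    derived algebra lies in nn, and each further derivation raises the least value by at least d. *)
Lemma solvable_nilrad : solvable_lie br U.
Proof.
have [d d0 dL] : exists2 d, 0 < d & {in L, forall v, 0 < w v Z -> d <= w v Z}.
  elim: (L) => [|v L' [d d0 IH]]; first by exists 1.
  exists (if 0 < w v Z then Num.min d (w v Z) else d); first by case: ifP; rewrite ?lt_min ?d0.
  move=> u; rewrite inE => /predU1P[->|/IH dE] u0; first by rewrite u0 ge_min lexx orbT.
  by case: ifP => _; rewrite ?ge_min dE.
have [D DL] : exists D, {in L, forall v, w v Z < D}.
  elim: (L) => [|v L' [D IH]]; first by exists 0.
  exists (Num.max D (w v Z + 1)) => u; rewrite inE lt_max => /predU1P[->|/IH ->] //.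
  by rewrite ltrDl ltr01 orbT.
have nnE : (nn <= nn_ge d)%VS.
  by apply/sub_span => v; rewrite !mem_filter => /andP[v0 Lv]; rewrite dL.
have step k : (iter k.+1 (derived br) U <= nn_ge (d *+ k.+1))%VS.
  elim: k => [|k IHk] /=.
    apply: derived_sub => _ _ /memv_addP[A bA [x nx ->]] /memv_addP[B bB [y ny ->]].
    by apply: (subvP nnE); have [] := U_br bA nx bB ny.
  apply: derived_sub => x y Wx Wy; rewrite mulrS.
  have {}Wx := subvP IHk x Wx; have {}Wy := subvP IHk y Wy.
  apply: nn_ge_br => //; first by rewrite mulrn_wge0 // ltW.
  apply: subvP Wx; apply/sub_span => v; rewrite !mem_filter => /andP[+ ->].
  by rewrite andbT; apply: le_trans; rewrite mulrS lerDl mulrn_wge0 // ltW.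
pose k := Num.bound `|D / d|; exists k.+1; apply/eqP; rewrite -subv0.
apply: subv_trans (step k) _; apply/span_subvP => v.
rewrite mem_filter => /andP[dv /DL vD]; suff : w v Z < w v Z by rewrite ltxx.
apply: lt_le_trans vD (le_trans _ dv).
have : D / d < k%:R by apply: le_lt_trans (ler_norm _) (archi_boundP _).
rewrite ltr_pdivrMr // => /ltW/le_trans; apply.
by rewrite mulr_natl [d *+ k.+1]mulrSr lerDl ltW.
Qed.

(** Every clause only tests vectors of U, so the product of [einstein_nilrad] can be replaced by any
    form that agrees with it there. *)
Lemma einstein_solvmanifold_nilrad (ip : V -> V -> R) :
  {in b & nn, forall A x, {in b & nn, forall B y,
     ip (A + x) (B + y) = 2 * Q A B + Q x y}} ->
  einstein_solvmanifold br U ip.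
Proof.
move=> ipE; have [ip0 [Eip ip0E] [D [DU Dbil Dtor Dmet] [c Dc]]] := einstein_nilrad.
have ipU : {in U &, forall x y, ip x y = ip0 x y}.
  move=> _ _ /memv_addP[A bA [x nx ->]] /memv_addP[B bB [y ny ->]].
  by rewrite ipE ?ip0E.
split; [split| exact: solvable_nilrad |split|].
- move=> _ _ /memv_addP[A bA [x nx ->]] /memv_addP[B bB [y ny ->]].
  by apply: (subvP (addvSr _ _)); have [] := U_br bA nx bB ny.
- by move=> a x y z _ _ _; rewrite (lbr_linl Lbr) linearP.
- by move=> x _; apply: lbr_alt.
- move=> x y z _ _ _; rewrite (lbr_leibniz Lbr x) (brN z (br x y)) (brN z x).
  by rewrite linearN /= -addrA addrA addrK subrr.
- move=> a x y z Ux Uy Uz; rewrite !ipU ?memvD ?memvZ //.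
  have ip0C := euclidean_sym Eip.
  by rewrite !(ip0C z) (euclDl Eip) (euclZl Eip).
- by move=> x y Ux Uy; rewrite !ipU // (euclidean_sym Eip).
- by move=> x Ux x0; rewrite ipU // (euclidean_pos Eip).
exists D; last by exists c => x y Ux Uy; rewrite Dc // ipU.
by split=> // x y z Ux Uy Uz; rewrite !ipU ?DU // Dmet.
Qed.

End Parabolic.

(** * Matrices over a field with involution: so(n, H) and traces of its adjoint action *)

Section Sesquilinear.
Variables (K : fieldType) (cj : {rmorphism K -> K}).
Hypothesis cjK : involutive cj.

Definition cjm k l (A : 'M[K]_(k, l)) := map_mx cj A.
Definition dag k l (A : 'M[K]_(k, l)) : 'M[K]_(l, k) := (cjm A)^T.

Lemma cjmD k l (A B : 'M[K]_(k, l)) : cjm (A + B) = cjm A + cjm B.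
Proof. exact: map_mxD. Qed.
Lemma cjmN k l (A : 'M[K]_(k, l)) : cjm (- A) = - cjm A.
Proof. exact: map_mxN. Qed.
Lemma cjmB k l (A B : 'M[K]_(k, l)) : cjm (A - B) = cjm A - cjm B.
Proof. exact: map_mxB. Qed.
Lemma cjmZ k l z (A : 'M[K]_(k, l)) : cjm (z *: A) = cj z *: cjm A.
Proof. exact: map_mxZ. Qed.
Lemma cjmM k l p (A : 'M[K]_(k, l)) (B : 'M[K]_(l, p)) :
  cjm (A *m B) = cjm A *m cjm B.
Proof. exact: map_mxM. Qed.
Lemma cjmK k l : involutive (@cjm k l).
Proof. by move=> A; apply/matrixP=> i j; rewrite !mxE cjK. Qed.
Lemma cjm_tr k l (A : 'M[K]_(k, l)) : cjm A^T = (cjm A)^T.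
Proof. by rewrite /cjm map_trmx. Qed.

Lemma dagM k l p (A : 'M[K]_(k, l)) (B : 'M[K]_(l, p)) :
  dag (A *m B) = dag B *m dag A.
Proof. by rewrite /dag cjmM trmx_mul. Qed.
Lemma dagK k l (A : 'M[K]_(k, l)) : dag (dag A) = A.
Proof. by rewrite /dag cjm_tr trmxK cjmK. Qed.
Lemma dagD k l (A B : 'M[K]_(k, l)) : dag (A + B) = dag A + dag B.
Proof. by rewrite /dag cjmD linearD. Qed.
Lemma dagN k l (A : 'M[K]_(k, l)) : dag (- A) = - dag A.
Proof. by rewrite /dag cjmN linearN. Qed.
Lemma dagB k l (A B : 'M[K]_(k, l)) : dag (A - B) = dag A - dag B.
Proof. by rewrite dagD dagN. Qed.
Lemma dagZ k l z (A : 'M[K]_(k, l)) : dag (z *: A) = cj z *: dag A.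
Proof. by rewrite /dag cjmZ linearZ. Qed.
Lemma dag_tr k l (A : 'M[K]_(k, l)) : dag A^T = cjm A.
Proof. by rewrite /dag cjm_tr trmxK. Qed.
Lemma tr_dag k l (A : 'M[K]_(k, l)) : (dag A)^T = cjm A.
Proof. exact: trmxK. Qed.

Lemma mxtr_cjm N (A : 'M[K]_N) : \tr (cjm A) = cj (\tr A).
Proof. by rewrite /mxtrace rmorph_sum; apply: eq_bigr => i _; rewrite mxE. Qed.
Lemma mxtr_dag N (A : 'M[K]_N) : \tr (dag A) = cj (\tr A).
Proof. by rewrite -mxtrace_tr tr_dag mxtr_cjm. Qed.

Definition comm_mx_ N (A B : 'M[K]_N) := A *m B - B *m A.
Local Notation cm := comm_mx_.

Lemma cm_leibniz N (x y z : 'M[K]_N) : cm x (cm y z) = cm (cm x y) z + cm y (cm x z).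
Proof.
rewrite /cm !mulmxBr !mulmxBl !mulmxA.
move: (x *m y *m z) (x *m z *m y) (y *m z *m x) (z *m y *m x) (y *m x *m z)
  (z *m x *m y) => a b c d e f.
by apply/matrixP => i j; rewrite !mxE; ring.
Qed.

Lemma cmDr N (x y z : 'M[K]_N) : cm x (y + z) = cm x y + cm x z.
Proof. by rewrite /cm mulmxDr mulmxDl opprD addrACA. Qed.
Lemma cmZr N c (x y : 'M[K]_N) : cm x (c *: y) = c *: cm x y.
Proof. by rewrite /cm -scalemxAr -scalemxAl scalerBr. Qed.
Lemma cmNr N (x y : 'M[K]_N) : cm x (- y) = - cm x y.
Proof. by rewrite -scaleN1r cmZr scaleN1r. Qed.
Lemma cmC N (x y : 'M[K]_N) : cm x y = - cm y x.
Proof. by rewrite /cm opprB. Qed.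

Lemma cm_dag N (x y : 'M[K]_N) : dag (cm x y) = cm (dag y) (dag x).
Proof. by rewrite /cm dagB !dagM. Qed.

Lemma mxtr_cm N (x y z : 'M[K]_N) :
  \tr (cm x y *m dag z) = \tr (y *m dag (cm (dag x) z)).
Proof.
rewrite cm_dag dagK /cm mulmxBl mulmxBr !raddfB /= -mulmxA mxtrace_mulC.
by rewrite -!mulmxA.
Qed.

Variable n : nat.
Local Notation M := 'M[K]_(n + n).
Local Notation cV := 'cV[K]_(n + n).
Implicit Types (A B X : M) (u v w : cV).

Definition block_J : M := block_mx 0 1%:M (- 1%:M) 0.
Local Notation J := block_J.

Lemma tr_block_J : J^T = - J.
Proof.
rewrite /J tr_block_mx opp_block_mx [(- 1%:M)^T]linearN /= !trmx0 !trmx1.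
by rewrite oppr0 opprK.
Qed.

Lemma block_J_sq : J *m J = - 1%:M.
Proof.
rewrite /J mulmx_block !(mul0mx, mulmx0) !(mulNmx, mulmxN) !mulmx1.
by rewrite !(addr0, add0r) [in RHS]scalar_mx_block opp_block_mx oppr0.
Qed.

Lemma cjm_J : cjm J = J.
Proof. by rewrite /J /cjm map_block_mx !map_mx0 map_mxN map_mx1. Qed.

Let JTJ : J^T *m J = 1%:M. Proof. by rewrite tr_block_J mulNmx block_J_sq opprK. Qed.

(** Conjugation of A by the quaternionic structure v -> J conj(v); its fixed points are the
    quaternionic matrices. *)
Definition rho A : M := J *m cjm A *m J^T.

Lemma rhoM A B : rho (A *m B) = rho A *m rho B.
Proof. by rewrite /rho cjmM !mulmxA -(mulmxA _ J^T J) JTJ mulmx1. Qed.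
Lemma rho_tr A : rho A^T = (rho A)^T.
Proof. by rewrite /rho !trmx_mul trmxK cjm_tr mulmxA. Qed.
Lemma rhoD A B : rho (A + B) = rho A + rho B.
Proof. by rewrite /rho cjmD mulmxDr mulmxDl. Qed.
Lemma rhoZ c A : rho (c *: A) = cj c *: rho A.
Proof. by rewrite /rho cjmZ -scalemxAr -scalemxAl. Qed.
Lemma rhoN A : rho (- A) = - rho A.
Proof. by rewrite /rho cjmN mulmxN mulNmx. Qed.
Lemma rhoB A B : rho (A - B) = rho A - rho B.
Proof. by rewrite rhoD rhoN. Qed.
Lemma rho0 : rho 0 = 0.
Proof. by rewrite /rho /cjm map_mx0 mulmx0 mul0mx. Qed.
Lemma rhoK : involutive rho.
Proof.
move=> A; rewrite /rho !cjmM cjmK cjm_tr cjm_J !mulmxA.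
rewrite block_J_sq -mulmxA -trmx_mul block_J_sq [(- 1%:M)^T]linearN /= trmx1.
by rewrite mulmxN mulNmx mulNmx mulmx1 mul1mx opprK.
Qed.
Lemma rho_cjm A : rho (cjm A) = cjm (rho A).
Proof. by rewrite /rho !cjmM cjmK cjm_tr cjm_J. Qed.
Lemma rho_dag A : rho (dag A) = dag (rho A).
Proof. by rewrite /dag rho_tr rho_cjm. Qed.
Lemma mxtr_rho A : \tr (rho A) = cj (\tr A).
Proof. by rewrite /rho mxtrace_mulC mulmxA JTJ mul1mx mxtr_cjm. Qed.
Lemma rho_block (X Y Z W : 'M[K]_n) : rho (block_mx X Y Z W) =
    block_mx (cjm W) (- cjm Z) (- cjm Y) (cjm X).
Proof.
rewrite /rho /cjm map_block_mx; move: (map_mx _ _) (map_mx _ _) (map_mx _ _) (map_mx _ _).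
move=> {}X {}Y {}Z {}W; rewrite tr_block_J /J opp_block_mx !mulmx_block !oppr0 opprK.
rewrite !(mul0mx, mulmx0) !(mulNmx, mulmxN) !(mul1mx, mulmx1) !(addr0, add0r).
by rewrite opprK.
Qed.

(* so(n, H) as the fixed points of rho among the skew-symmetric matrices. *)
Definition so_star A : Prop := A^T = - A /\ rho A = A.

Lemma so_star_block A : so_star A <->
  exists X Y : 'M[K]_n, [/\ A = block_mx X Y (- cjm Y) (cjm X), X = - X^T
    & Y = (cjm Y)^T].
Proof.
split=> [|[X [Y [-> hX hY]]]]; last first.
  rewrite /so_star rho_block cjmN !cjmK opprK; split=> //.
  have hXT : X^T = - X by rewrite [in RHS]hX opprK.
  have hYT : Y^T = cjm Y by rewrite {1}hY trmxK.
  by rewrite tr_block_mx opp_block_mx opprK linearN /= -hY hYT -cjm_tr hXT cjmN.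
have -> : A = block_mx (ulsubmx A) (ursubmx A) (dlsubmx A) (drsubmx A).
  by rewrite submxK.
move: (ulsubmx A) (ursubmx A) (dlsubmx A) (drsubmx A) => X Y Z W [].
rewrite rho_block tr_block_mx opp_block_mx => /eq_block_mx[hX hZ hY hW].
move=> /eq_block_mx[XW YZ ZY WX]; exists X, Y.
split; first by rewrite ZY WX.
  by rewrite hX opprK.
by rewrite -[cjm Y]opprK ZY linearN /= hZ opprK.
Qed.

Lemma so_star_cm A B : so_star A -> so_star B -> so_star (cm A B).
Proof.
move=> [AT rA] [BT rB]; rewrite /so_star /cm; split; last by rewrite rhoB !rhoM rA rB.
by rewrite linearB /= !trmx_mul AT BT !mulNmx !mulmxN !opprK opprB.
Qed.

Lemma so_star_dag A : so_star A -> so_star (dag A).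
Proof.
move=> [AT rA]; split; last by rewrite rho_dag rA.
by rewrite tr_dag /dag -cjm_tr AT cjmN opprK.
Qed.

Lemma so_star_tr0 A : 2 != 0 :> K -> so_star A -> \tr A = 0.
Proof.
move=> K2 [AT _]; have /eqP := mxtrace_tr A; rewrite AT linearN /= eq_sym -subr_eq0.
by rewrite opprK -mulr2n -mulr_natl mulf_eq0 (negPf K2) => /eqP.
Qed.

(** Average of A under the commuting involutions A -> -A^T and rho: the projection onto so(n, H). *)
Definition so_proj A : M := 4^-1 *: (A - A^T + rho A - (rho A)^T).

Lemma so_projP A : so_star (so_proj A).
Proof.
split; rewrite /so_proj.
  rewrite linearZ /= -scalerN; congr (_ *: _).
  rewrite !linearB /= linearD linearB /= !trmxK.
  by move: A^T (rho A)^T => a b; apply/matrixP => i j; rewrite !mxE; ring.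
rewrite rhoZ !rhoD !rhoN !rho_tr rhoK fmorphV rmorph_nat; congr (_ *: _).
by move: A^T (rho A)^T (rho A) => a b c; apply/matrixP => i j; rewrite !mxE; ring.
Qed.

Lemma so_proj_id A : 4 != 0 :> K -> so_star A -> so_proj A = A.
Proof.
move=> K4 [AT rA]; rewrite /so_proj rA AT.
by apply/matrixP => i j; rewrite !mxE; field.
Qed.

Lemma so_projD A B : so_proj (A + B) = so_proj A + so_proj B.
Proof.
rewrite /so_proj -scalerDr rhoD; congr (_ *: _); rewrite !linearD /=.
move: A^T B^T (rho A) (rho B) (rho A)^T (rho B)^T => a b c d e f.
by apply/matrixP => i j; rewrite !mxE; ring.
Qed.

Lemma so_proj0 : so_proj 0 = 0.
Proof. by rewrite /so_proj rho0 trmx0 !subr0 addr0 scaler0. Qed.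

Lemma so_projZ c A : cj c = c -> so_proj (c *: A) = c *: so_proj A.
Proof.
move=> cc; rewrite /so_proj rhoZ cc [(c *: A)^T]linearZ [(c *: rho A)^T]linearZ /=.
by rewrite -scalerBr -scalerDr -scalerBr !scalerA mulrC.
Qed.

Lemma so_proj_split ii A (u := 4^-1 *: (A - A^T)) (v := 4^-1 *: (rho A - (rho A)^T)) :
  cj ii = - ii -> so_proj A = u + v /\ so_proj (ii *: A) = ii *: (u - v).
Proof.
move=> cii; split; first by rewrite /so_proj /u /v -scalerDr addrA.
rewrite /so_proj /u /v rhoZ cii -scalerBr scalerA mulrC -scalerA; congr (_ *: _).
rewrite [(ii *: A)^T]linearZ [(- ii *: rho A)^T]linearZ /=.
by move: A^T (rho A)^T (rho A) => a b c; apply/matrixP => i j; rewrite !mxE; ring.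
Qed.

(** The rho-half of [so_proj] is conjugate-linear, so its contribution q changes sign relative to
    the other one when ii is inserted. It cancels between the real part of the first entry and the
    imaginary part of the second. *)
Lemma cm_so_proj_delta ii A B i j (z := cm A (cm B (delta_mx i j - delta_mx j i)) i j) :
  cj ii = - ii -> exists q,
    cm A (cm B (so_proj (delta_mx i j))) i j = 4^-1 * z + q /\
    cm A (cm B (so_proj (ii *: delta_mx i j))) i j = ii * (4^-1 * z - q).
Proof.
move=> cii; have [-> ->] := so_proj_split (delta_mx i j) cii.
rewrite trmx_delta; set v := _ *: (rho _ - _); exists (cm A (cm B v) i j).
pose f (w : M) := cm A (cm B w); rewrite /z -!/(f _).
have fD (u w : M) : f (u + w) = f u + f w by rewrite /f (cmDr B) (cmDr A).
have fZ c (w : M) : f (c *: w) = c *: f w by rewrite /f (cmZr _ B) (cmZr _ A).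
have fN (w : M) : f (- w) = - f w by rewrite /f (cmNr B) (cmNr A).
rewrite (fZ ii) !(fD (4^-1 *: _)) fN (fZ 4^-1); move: (f (_ - _)) (f v) => p q.
by split; rewrite !mxE; ring.
Qed.

(** Self-adjointness of [so_proj] for the real part of the trace form; a number plus its conjugate
    stands for twice its real part. *)
Lemma mxtr_so_proj A B : 4 != 0 :> K -> let t X Y := \tr (X *m dag Y) in
  t (so_proj A) B + cj (t (so_proj A) B) = t A (so_proj B) + cj (t A (so_proj B)).
Proof.
move=> K4 t.
have tT X Y : t X^T Y = t X Y^T.
  by rewrite /t dag_tr -mxtrace_tr trmx_mul !trmxK mxtrace_mulC.
have tR X Y : t (rho X) Y = cj (t X (rho Y)).
  by rewrite /t -rho_dag -mxtr_rho rhoM rhoK.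
have El p1 p2 p3 p4 q : t (4^-1 *: (p1 - p2 + p3 - p4)) q =
    4^-1 * (t p1 q - t p2 q + t p3 q - t p4 q).
  by rewrite /t -scalemxAl !(mulmxDl, mulNmx) linearZ /= !mxtraceD !(raddfN (@mxtrace _ _)).
have Er p1 p2 p3 p4 q : t q (4^-1 *: (p1 - p2 + p3 - p4)) =
    4^-1 * (t q p1 - t q p2 + t q p3 - t q p4).
  rewrite /t dagZ !(dagD, dagN) -scalemxAr !(mulmxDr, mulmxN) linearZ /=.
  by rewrite !mxtraceD !(raddfN (@mxtrace _ _)) fmorphV rmorph_nat.
rewrite /so_proj El Er !tT !tR -!rho_tr.
rewrite !(rmorphM, rmorphB, rmorphD) !cjK fmorphV rmorph_nat.
by ring.
Qed.

Lemma sum_mul_delta A B :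
  \sum_i \sum_j (A *m delta_mx i j *m B) i j = \tr A * \tr B.
Proof.
rewrite /mxtrace mulr_suml; apply: eq_bigr => i _; rewrite mulr_sumr.
apply: eq_bigr => j _; rewrite -(mul_delta_mx (0 : 'I_1)) mulmxA -mulmxA.
by rewrite -colE -rowE mxE big_ord1 !mxE.
Qed.

Lemma sum_mul_delta_tr A B :
  \sum_i \sum_j (A *m delta_mx j i *m B) i j = \tr (A *m B^T).
Proof.
rewrite /mxtrace; apply: eq_bigr => i _; rewrite mxE.
apply: eq_bigr => j _; rewrite -(mul_delta_mx (0 : 'I_1)) mulmxA -mulmxA.
by rewrite -colE -rowE mxE big_ord1 !mxE.
Qed.

(* Twice the trace of ad A ad B on the skew-symmetric matrices: the pairs are ordered. *)
Lemma sum_cm_delta A B : A^T = - A -> B^T = - B -> \tr A = 0 -> \tr B = 0 ->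
  \sum_i \sum_j cm A (cm B (delta_mx i j - delta_mx j i)) i j =
  (2 * (n + n)%:R - 4) * \tr (A *m B).
Proof.
move=> AT BT A0 B0.
(* ad A ad B is a sum of maps u -> P u S, whose traces are given by [sum_mul_delta] and
   [sum_mul_delta_tr]. *)
pose f (u : M) := A *m B *m u *m 1%:M - A *m u *m B - B *m u *m A + 1%:M *m u *m (B *m A).
have fE (u : M) : cm A (cm B u) = f u.
  rewrite /f /cm !(mulmxBr, mulmxBl) mulmx1 mul1mx !mulmxA.
  by move: (A *m B *m u) => a; apply/matrixP => i j; rewrite !mxE; ring.
pose S A B (h : 'I_(n + n) -> 'I_(n + n) -> M) :=
  \sum_i \sum_j (A *m h i j *m B) i j.
have Sf h : \sum_i \sum_j f (h i j) i j =
    S (A *m B) 1%:M h - S A B h - S B A h + S 1%:M (B *m A) h.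
  rewrite /S -!sumrB -big_split; apply: eq_bigr => i _ /=.
  rewrite -!sumrB -big_split; apply: eq_bigr => j _ /=; rewrite /f.
  move: (_ *m 1%:M) (A *m _ *m B) (B *m _ *m A) (1%:M *m _ *m _) => a b c d.
  by rewrite !mxE.
have -> : \sum_i \sum_j cm A (cm B (delta_mx i j - delta_mx j i)) i j =
    \sum_i \sum_j f (delta_mx i j) i j - \sum_i \sum_j f (delta_mx j i) i j.
  rewrite -sumrB; apply: eq_bigr => i _; rewrite -sumrB; apply: eq_bigr => j _.
  rewrite -!fE; have -> : cm A (cm B (delta_mx i j - delta_mx j i)) =
    cm A (cm B (delta_mx i j)) - cm A (cm B (delta_mx j i)).
    rewrite !fE /f !(mulmxBr, mulmxBl).
    move: (_ *m 1%:M) (A *m _ *m B) (B *m _ *m A) (1%:M *m _ *m _) => a b c d.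
    by apply/matrixP => k l; rewrite !mxE; ring.
  by move: (cm _ _) (cm _ _) => a b; rewrite !mxE.
rewrite !Sf /S !sum_mul_delta !sum_mul_delta_tr A0 B0 !mul0r !subr0 trmx1.
rewrite trmx_mul AT BT !(mulmx1, mul1mx, mulmxN, mulNmx).
rewrite !(raddfN (@mxtrace _ _)) /= !opprK.
by rewrite mxtrace1 (mxtrace_mulC B A); ring.
Qed.

End Sesquilinear.

(** * Wedges of vectors and the involution theta *)

Section Wedges.
Variables (K : fieldType) (cj : {rmorphism K -> K}) (n : nat).
Hypothesis cjK : involutive cj.
Local Notation M := 'M[K]_(n + n).
Local Notation cV := 'cV[K]_(n + n).
Implicit Types (A B X H : M) (u v w : cV) (a b c e : K).
Local Notation cjm := (cjm cj).
Local Notation dag := (dag cj).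
Local Notation rho := (rho cj).
Local Notation J := (@block_J K n).
Local Notation cm := comm_mx_.

Definition wedge u w : M := u *m w^T - w *m u^T.
Definition dot u w : K := (u^T *m w) 0 0.
(** The quaternionic structure on column vectors; [rho] of a wedge is the wedge of the images. *)
Definition kap u : cV := J *m cjm u.
Definition rsym X : M := X + rho X.

Lemma wedgeC u w : wedge u w = - wedge w u.
Proof. by rewrite /wedge opprB. Qed.

Lemma wedge_tr u w : (wedge u w)^T = - wedge u w.
Proof. by rewrite /wedge linearB /= !trmx_mul !trmxK opprB. Qed.

Lemma wedgeDl u v w : wedge (u + v) w = wedge u w + wedge v w.
Proof. by rewrite /wedge mulmxDl linearD /= mulmxDr opprD addrACA. Qed.
Lemma wedgeZl a u w : wedge (a *: u) w = a *: wedge u w.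
Proof. by rewrite /wedge linearZ /= -scalemxAl -scalemxAr scalerBr. Qed.
Lemma wedgeDr u v w : wedge w (u + v) = wedge w u + wedge w v.
Proof. by rewrite wedgeC wedgeDl opprD -!wedgeC. Qed.
Lemma wedgeZr a u w : wedge w (a *: u) = a *: wedge w u.
Proof. by rewrite wedgeC wedgeZl -scalerN -wedgeC. Qed.
Lemma wedgeNl u w : wedge (- u) w = - wedge u w.
Proof. by rewrite -scaleN1r wedgeZl scaleN1r. Qed.
Lemma wedgeNr u w : wedge w (- u) = - wedge w u.
Proof. by rewrite -scaleN1r wedgeZr scaleN1r. Qed.

Lemma wedge_expand a b u v w z : wedge (u + a *: v) (w + b *: z) =
  wedge u w + b *: wedge u z + a *: wedge v w + (a * b) *: wedge v z.
Proof. by rewrite wedgeDl !wedgeDr !wedgeZl !wedgeZr scalerA !addrA. Qed.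

Lemma mul_outer u w v : u *m w^T *m v = dot w v *: u.
Proof. by rewrite -mulmxA [w^T *m v]mx11_scalar -scalemx1 -scalemxAr mulmx1. Qed.

Lemma wedge_mul u w v : wedge u w *m v = dot w v *: u - dot u v *: w.
Proof. by rewrite /wedge mulmxBl !mul_outer. Qed.

Lemma dotC u w : dot u w = dot w u.
Proof. by rewrite /dot -[u^T *m w]trmxK trmx_mul trmxK mxE. Qed.
Lemma dotDr u v w : dot u (v + w) = dot u v + dot u w.
Proof. by rewrite /dot mulmxDr mxE. Qed.
Lemma dotZr a u v : dot u (a *: v) = a * dot u v.
Proof. by rewrite /dot -scalemxAr mxE. Qed.

Lemma rho_wedge u w : rho (wedge u w) = wedge (kap u) (kap w).
Proof.
rewrite /wedge rhoB /rho /kap !cjmM !cjm_tr !trmx_mul !mulmxA.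
by [].
Qed.

Lemma rho_rsym X : rho (rsym X) = rsym X.
Proof. by rewrite /rsym rhoD rhoK // addrC. Qed.

Lemma so_star_rsym c u w : so_star cj (rsym (c *: wedge u w)).
Proof.
split; last exact: rho_rsym.
by rewrite /rsym linearD /= -rho_tr linearZ /= wedge_tr scalerN rhoN opprD.
Qed.

Lemma rsym_wedge c u w : cj c = c ->
  rsym (c *: wedge u w) = c *: (wedge u w + wedge (kap u) (kap w)).
Proof. by move=> cc; rewrite /rsym rhoZ cc rho_wedge -scalerDr. Qed.

(** A skew-symmetric H acts on wedges as a derivation, so eigenvalues add. *)
Lemma cm_wedge H a b u w : H^T = - H -> H *m u = a *: u -> H *m w = b *: w ->
  cm H (wedge u w) = (a + b) *: wedge u w.
Proof.
move=> HT Hu Hw; have uH : u^T *m H = - (a *: u^T).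
  by rewrite -[H]opprK -HT mulmxN -trmx_mul Hu linearZ.
have wH : w^T *m H = - (b *: w^T).
  by rewrite -[H]opprK -HT mulmxN -trmx_mul Hw linearZ.
rewrite /cm /wedge mulmxBr mulmxBl !mulmxA Hu Hw -!mulmxA uH wH !mulmxN.
rewrite -!scalemxAl -!scalemxAr.
by move: (u *m w^T) (w *m u^T) => p q; apply/matrixP => i j; rewrite !mxE; ring.
Qed.

Lemma cm_rsym H a X : rho H = H -> cj a = a -> cm H X = a *: X ->
  cm H (rsym X) = a *: rsym X.
Proof.
move=> rH ca HX; rewrite /rsym scalerDr -{2}ca -rhoZ -HX /cm rhoB !rhoM rH.
by rewrite mulmxDr mulmxDl opprD addrACA.
Qed.

(* For a suitable L, a vector of the basis of n is flagged iff theta maps it to its opposite. *)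
Definition theta (L : M) A : M := L *m cjm A *m cjm L.

(** What makes [theta] an involutive automorphism that commutes with transposition, [dag] and [rho];
    [eps] is the sign by which conjugation acts on L. *)
Record theta_frame (L : M) (eps : K) : Prop := ThetaFrame {
  tf_tr : L^T = L;
  tf_cj : cjm L = eps *: L;
  tf_sq : L *m L = eps%:M;
  tf_rho : rho L = L;
  tf_eps : eps * eps = 1;
  tf_cj_eps : cj eps = eps }.

Section Theta.
Variables (L : M) (eps : K).
Hypothesis TL : theta_frame L eps.
Local Notation th := (theta L).

Let LcL : L *m cjm L = 1%:M.
Proof. by rewrite (tf_cj TL) -scalemxAr (tf_sq TL) scale_scalar_mx (tf_eps TL). Qed.
Let cLL : cjm L *m L = 1%:M.
Proof. by rewrite (tf_cj TL) -scalemxAl (tf_sq TL) scale_scalar_mx (tf_eps TL). Qed.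

Lemma thetaD A B : th (A + B) = th A + th B.
Proof. by rewrite /theta cjmD mulmxDr mulmxDl. Qed.
Lemma thetaZ c A : th (c *: A) = cj c *: th A.
Proof. by rewrite /theta cjmZ -scalemxAr -scalemxAl. Qed.
Lemma thetaN A : th (- A) = - th A.
Proof. by rewrite /theta cjmN mulmxN mulNmx. Qed.
Lemma thetaB A B : th (A - B) = th A - th B.
Proof. by rewrite thetaD thetaN. Qed.
Lemma thetaM A B : th (A *m B) = th A *m th B.
Proof. by rewrite /theta cjmM !mulmxA -(mulmxA _ (cjm L) L) cLL mulmx1. Qed.
Lemma theta_cm A B : th (cm A B) = cm (th A) (th B).
Proof. by rewrite /cm thetaB !thetaM. Qed.
Lemma thetaK : involutive th.
Proof.
move=> A; rewrite /theta !cjmM !cjmK // !mulmxA LcL mul1mx.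
by rewrite -mulmxA LcL mulmx1.
Qed.
Lemma theta_tr A : th A^T = (th A)^T.
Proof.
rewrite /theta !trmx_mul -!cjm_tr (tf_tr TL) (tf_cj TL) -scalemxAl -scalemxAr.
by rewrite mulmxA.
Qed.
Lemma theta_dag A : th (dag A) = dag (th A).
Proof.
rewrite /theta /dag !cjmM !trmx_mul !cjmK // cjm_tr cjmK // (tf_tr TL) !mulmxA.
by rewrite -cjm_tr (tf_tr TL).
Qed.
Lemma theta_rho A : th (rho A) = rho (th A).
Proof. by rewrite /theta !rhoM // (rho_cjm cjK) (rho_cjm cjK) (tf_rho TL). Qed.
Lemma mxtr_theta A : \tr (th A) = cj (\tr A).
Proof. by rewrite /theta mxtrace_mulC mulmxA cLL mul1mx mxtr_cjm. Qed.
Lemma so_star_theta A : so_star cj A -> so_star cj (th A).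
Proof. by move=> [AT rA]; split; rewrite -?theta_tr -?theta_rho ?AT ?rA ?thetaN. Qed.

(** If the map v -> L conj(v) multiplies u and w by scalars, theta multiplies their wedge by a
    scalar. The conjugate of c is what separates real from imaginary coefficients, hence the flags
    within one root space. *)
Lemma theta_wedge c a b u w : L *m cjm u = a *: u -> L *m cjm w = b *: w ->
  th (c *: wedge u w) = (eps * cj c * a * b) *: wedge u w.
Proof.
move=> Lu Lw; have E p q a' b' : L *m cjm p = a' *: p -> L *m cjm q = b' *: q ->
    th (p *m q^T) = (eps * a' * b') *: (p *m q^T).
  move=> Lp Lq; rewrite /theta cjmM mulmxA Lp (tf_cj TL) -scalemxAr -mulmxA.
  rewrite cjm_tr -{1}(tf_tr TL) -trmx_mul Lq linearZ /= -scalemxAl -scalemxAr.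
  by rewrite !scalerA; congr (_ *: _); ring.
rewrite thetaZ /wedge thetaB (E _ _ _ _ _ Lu Lw) (E _ _ _ _ _ Lw Lu).
by move: (u *m _) (w *m _) => p q; apply/matrixP => i j; rewrite !mxE; ring.
Qed.

Lemma theta_rsym t X : cj t = t -> th X = t *: X -> th (rsym X) = t *: rsym X.
Proof. by move=> ct tX; rewrite /rsym thetaD theta_rho tX rhoZ ct scalerDr. Qed.

End Theta.

End Wedges.
Ltac decide_neq := repeat match goal with
  | |- context [?a == ?b :> nat] => rewrite (_ : (a == b) = false); last lia
  end.

(** * Common eigenvectors of the H_j and a diagonal sign matrix *)

Section EigenVectors.
Variables (K : fieldType) (cj : {rmorphism K -> K}) (n : nat).
Hypothesis cjK : involutive cj.
Variables (ii s : K).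
Hypotheses (ii2 : ii * ii = -1) (cj_ii : cj ii = - ii).
Hypotheses (s2 : 2 * (s * s) = 1) (cj_s : cj s = s).
Local Notation M := 'M[K]_(n + n).
Local Notation cV := 'cV[K]_(n + n).
Implicit Types (A B X H : M) (u v w : cV) (a b c e : K) (r p q i j k : nat).
Local Notation cjm := (cjm cj).
Local Notation dag := (dag cj).
Local Notation rho := (rho cj).
Local Notation J := (@block_J K n).
Local Notation kap := (kap cj).

(* The r-th vector of the canonical basis, numbered from 1 as in the paper. *)
Definition ev r : cV := \col_a (a.+1 == r)%:R.

Lemma cjm_ev r : cjm (ev r) = ev r.
Proof. by apply/matrixP=> a b; rewrite !mxE rmorph_nat. Qed.

Lemma mul_ev k (A : 'M_(k, n + n)) r (lt_r : (r < n + n)%N) x : (A *m ev r.+1) x 0 = A x (Ordinal lt_r).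
Proof.
rewrite mxE (bigD1 (Ordinal lt_r)) //= big1 ?addr0 => [|b /negPf br].
  by rewrite mxE eqxx mulr1.
by rewrite mxE eqSS (_ : (b == r :> nat) = false) ?mulr0.
Qed.

Lemma mx_ev_eq A B :
  (forall r, (0 < r <= n + n)%N -> A *m ev r = B *m ev r) -> A = B.
Proof.
move=> AB; apply/matrixP => a [r lt_r].
by rewrite -!(mul_ev _ lt_r) AB.
Qed.

Lemma dot_ev p q : (0 < p <= n + n)%N -> dot (ev p) (ev q) = (p == q)%:R.
Proof.
by case: p => // p lt_p; rewrite dotC /dot (mul_ev _ lt_p) !mxE.
Qed.

Lemma J_ev_hi r : (0 < r <= n)%N -> J *m ev (n + r) = ev r.
Proof.
move=> r0; have -> : ev (n + r) = col_mx 0 (\col_a (a.+1 == r)%:R).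
  apply/matrixP => a b; rewrite !mxE; case: (splitP a) => k ak; rewrite !mxE ak.
    by rewrite (_ : (_ == _) = false) //; have := ltn_ord k; lia.
  by rewrite -addnS eqn_add2l.
rewrite /J mul_block_col mulmx0 mul1mx mul0mx mulmx0 !addr0 add0r.
apply/matrixP => a b; rewrite !mxE; case: (splitP a) => k ak; rewrite !mxE ak //.
by rewrite (_ : (_ == _) = false) //; lia.
Qed.

Lemma J_ev_lo r : (0 < r <= n)%N -> J *m ev r = - ev (n + r).
Proof.
by move=> r0; rewrite -(J_ev_hi r0) mulmxA block_J_sq mulNmx mul1mx.
Qed.

(** For e = 1 or -1, [av e j] and [bv e j] are the eigenvectors of H_j for the eigenvalue e s in the
    two coordinate blocks; [kap] exchanges them up to sign. *)
Definition av e j : cV := ev (2 * j - 1) + (- (ii * e)) *: ev (2 * j).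
Definition bv e j : cV := ev (n + 2 * j - 1) + (ii * e) *: ev (n + 2 * j).

Lemma cjm_av e j : cj e = e -> cjm (av e j) = ev (2 * j - 1) + (ii * e) *: ev (2 * j).
Proof.
by move=> ce; rewrite /av cjmD cjmZ !cjm_ev rmorphN rmorphM ce cj_ii mulNr opprK.
Qed.

Lemma cjm_bv e j : cj e = e ->
  cjm (bv e j) = ev (n + 2 * j - 1) + (- (ii * e)) *: ev (n + 2 * j).
Proof. by move=> ce; rewrite /bv cjmD cjmZ !cjm_ev rmorphM ce cj_ii mulNr. Qed.

Lemma kap_av e j : cj e = e -> (0 < j)%N -> (2 * j <= n)%N ->
  kap (av e j) = - bv e j.
Proof.
move=> ce j0 jn; rewrite /kap cjm_av // mulmxDr -scalemxAr !J_ev_lo; try lia.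
by rewrite scalerN -opprD addnBA //; lia.
Qed.

Lemma kap_bv e j : cj e = e -> (0 < j)%N -> (2 * j <= n)%N ->
  kap (bv e j) = av e j.
Proof.
move=> ce j0 jn; rewrite /kap cjm_bv // mulmxDr -scalemxAr.
have -> : (n + 2 * j - 1 = n + (2 * j - 1))%N by lia.
by rewrite !J_ev_hi //; lia.
Qed.

Lemma kap_ev_lo r : (0 < r <= n)%N -> kap (ev r) = - ev (n + r).
Proof. by move=> r0; rewrite /kap cjm_ev J_ev_lo. Qed.

Lemma kap_ev_hi r : (0 < r <= n)%N -> kap (ev (n + r)) = ev r.
Proof. by move=> r0; rewrite /kap cjm_ev J_ev_hi. Qed.

Definition Hm j : M := (ii * s) *:
  (wedge (ev (2 * j - 1)) (ev (2 * j)) - wedge (ev (n + 2 * j - 1)) (ev (n + 2 * j))).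

Lemma Hm_tr j : (Hm j)^T = - Hm j.
Proof. by rewrite /Hm linearZ linearB /= !wedge_tr -opprD scalerN. Qed.

Lemma cjm_wedge u w : cjm (wedge u w) = wedge (cjm u) (cjm w).
Proof. by rewrite /wedge cjmB !cjmM !cjm_tr. Qed.

Lemma Hm_cjm j : cjm (Hm j) = - Hm j.
Proof.
by rewrite /Hm cjmZ cjmB !cjm_wedge !cjm_ev rmorphM cj_ii cj_s mulNr scaleNr.
Qed.

Lemma Hm_dag j : dag (Hm j) = Hm j.
Proof. by rewrite /dag Hm_cjm linearN /= Hm_tr opprK. Qed.

Lemma Hm_rho j : (0 < j)%N -> (2 * j <= n)%N -> rho (Hm j) = Hm j.
Proof.
move=> j0 jn; have E : (n + 2 * j - 1 = n + (2 * j - 1))%N by lia.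
have [r1 r2] : (0 < 2 * j - 1 <= n)%N /\ (0 < 2 * j <= n)%N by lia.
rewrite /Hm rhoZ rhoB !(rho_wedge cj) E (kap_ev_lo r1) (kap_ev_lo r2).
rewrite (kap_ev_hi r1) (kap_ev_hi r2) wedgeNl wedgeNr opprK rmorphM cj_ii cj_s mulNr.
by rewrite scaleNr -scalerN [- (_ - _)]opprB.
Qed.

Lemma so_star_Hm j : (0 < j)%N -> (2 * j <= n)%N -> so_star cj (Hm j).
Proof. by move=> j0 jn; split; [exact: Hm_tr | exact: Hm_rho]. Qed.

Lemma Hm_av e i j : e * e = 1 -> (0 < i)%N -> (0 < j)%N -> (2 * i <= n)%N ->
  (2 * j <= n)%N -> Hm i *m av e j = ((i == j)%:R * e * s) *: av e j.
Proof.
move=> e2 i0 j0 iN jN.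
rewrite /Hm -scalemxAl mulmxBl !wedge_mul /av !dotDr !dotZr !dot_ev; try lia.
decide_neq.
rewrite (_ : (2 * i == 2 * j)%N = (i == j)); last lia.
rewrite (_ : (2 * i - 1 == 2 * j - 1)%N = (i == j)); last lia.
rewrite !mulr0 !addr0 !scale0r !subr0 !add0r.
case: eqP => [->|_]; last by rewrite mulr0 !scale0r subr0 scaler0 !mul0r scale0r.
rewrite mulr1 !mul1r scale1r scalerBr scalerDr !scalerA.
have -> : ii * s * - (ii * e) = - (ii * ii) * (e * s) by ring.
have -> : e * s * - (ii * e) = (e * e) * - (ii * s) by ring.
by rewrite ii2 e2 opprK !mul1r scaleNr.
Qed.

Lemma Hm_bv e i j : e * e = 1 -> (0 < i)%N -> (0 < j)%N -> (2 * i <= n)%N ->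
  (2 * j <= n)%N -> Hm i *m bv e j = ((i == j)%:R * e * s) *: bv e j.
Proof.
move=> e2 i0 j0 iN jN.
rewrite /Hm -scalemxAl mulmxBl !wedge_mul /bv !dotDr !dotZr !dot_ev; try lia.
decide_neq.
rewrite (_ : (n + 2 * i == n + 2 * j)%N = (i == j)); last lia.
rewrite (_ : (n + 2 * i - 1 == n + 2 * j - 1)%N = (i == j)); last lia.
rewrite !mulr0 !addr0 !scale0r !subr0 !add0r.
case: eqP => [->|_]; last by rewrite mulr0 !scale0r subr0 oppr0 scaler0 !mul0r scale0r.
rewrite mulr1 !mul1r scale1r opprB scalerBr scalerDr !scalerA.
have -> : ii * s * (ii * e) = (ii * ii) * (e * s) by ring.
have -> : e * s * (ii * e) = (e * e) * (ii * s) by ring.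
by rewrite ii2 e2 mulN1r mul1r scaleNr opprK addrC.
Qed.

Lemma Hm_ev_odd i r : (0 < i)%N -> (2 * i < n)%N -> (r == n) || (r == n + n)%N ->
  Hm i *m ev r = 0.
Proof.
move=> i0 iN rN.
rewrite /Hm -scalemxAl mulmxBl !wedge_mul !dot_ev; try lia.
rewrite (_ : (2 * i == r)%N = false); last by case/orP: rN => /eqP ->; lia.
rewrite (_ : (2 * i - 1 == r)%N = false); last by case/orP: rN => /eqP ->; lia.
rewrite (_ : (n + 2 * i == r)%N = false); last by case/orP: rN => /eqP ->; lia.
rewrite (_ : (n + 2 * i - 1 == r)%N = false); last by case/orP: rN => /eqP ->; lia.
by rewrite !scale0r !subr0 scaler0.
Qed.

(* The diagonal sign matrix: + on odd rows and - on even rows of both blocks. *)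
Definition sgn_ev r : K := (-1) ^+ (if (r <= n)%N then r.-1 else (r - n).-1).
Definition Dm : M := \matrix_(a, b) ((a == b)%:R * sgn_ev a.+1).

Lemma sgn_ev_sq r : sgn_ev r * sgn_ev r = 1.
Proof. by rewrite /sgn_ev -expr2 sqrr_sign. Qed.

Lemma Dm_ev r : Dm *m ev r = sgn_ev r *: ev r.
Proof.
apply/matrixP => a b; rewrite !mxE (bigD1 a) //= big1 => [|c /negPf ca].
  by rewrite !mxE eqxx mul1r addr0; case: eqP => [->|_]; rewrite ?mulr0.
by rewrite !mxE eq_sym ca !mul0r.
Qed.

Lemma Dm_tr : Dm^T = Dm.
Proof. by apply/matrixP => a b; rewrite !mxE eq_sym; case: eqP => [->|_]; rewrite ?mul0r. Qed.

Lemma Dm_cjm : cjm Dm = Dm.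
Proof. by apply/matrixP => a b; rewrite !mxE rmorphM rmorph_nat rmorph_sign. Qed.

Lemma Dm_sq : Dm *m Dm = 1%:M.
Proof.
apply: mx_ev_eq => r _; rewrite -mulmxA Dm_ev -scalemxAr Dm_ev scalerA sgn_ev_sq.
by rewrite scale1r mul1mx.
Qed.

Lemma sgn_evD r : (0 < r <= n)%N -> sgn_ev (n + r) = sgn_ev r.
Proof.
move=> /andP[r0 rn]; rewrite /sgn_ev rn addKn.
by have -> : (n + r <= n)%N = false by lia.
Qed.

Lemma Dm_rho : rho Dm = Dm.
Proof.
have DJ : Dm *m J = J *m Dm.
  apply: mx_ev_eq => r r0; rewrite -!mulmxA Dm_ev -scalemxAr.
  have [rn|nr] := leqP r n.
    have r1 : (0 < r <= n)%N by lia.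
    by rewrite J_ev_lo // mulmxN Dm_ev scalerN sgn_evD.
  have [k k1 ->] : exists2 k, (0 < k <= n)%N & r = (n + k)%N.
    by exists (r - n)%N; lia.
  by rewrite J_ev_hi // Dm_ev sgn_evD.
by rewrite /rho Dm_cjm -DJ -mulmxA tr_block_J mulmxN block_J_sq opprK mulmx1.
Qed.

Lemma Dm_av e j : cj e = e -> (0 < j)%N -> (2 * j <= n)%N -> Dm *m cjm (av e j) = av e j.
Proof.
move=> ce j0 jn; rewrite cjm_av // mulmxDr -scalemxAr !Dm_ev /sgn_ev jn.
have -> : (2 * j - 1 <= n)%N = true by lia.
rewrite (_ : (2 * j - 1).-1 = (2 * (j - 1))%N); last lia.
rewrite (_ : (2 * j).-1 = (2 * (j - 1)).+1); last lia.
by rewrite exprS exprM sqrrN expr1n expr1n mulr1 scale1r scaleN1r scalerN -scaleNr.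
Qed.

Lemma Dm_bv e j : cj e = e -> (0 < j)%N -> (2 * j <= n)%N -> Dm *m cjm (bv e j) = bv e j.
Proof.
move=> ce j0 jn; rewrite cjm_bv // mulmxDr -scalemxAr !Dm_ev /sgn_ev.
have -> : (n + 2 * j <= n)%N = false by lia.
have -> : (n + 2 * j - 1 <= n)%N = false by lia.
rewrite (_ : (n + 2 * j - 1 - n).-1 = (2 * (j - 1))%N); last lia.
rewrite (_ : (n + 2 * j - n).-1 = (2 * (j - 1)).+1); last lia.
by rewrite exprS exprM sqrrN expr1n expr1n mulr1 scale1r scaleN1r scalerN scaleNr opprK.
Qed.

Lemma Dm_ev_odd r : odd n -> (r == n) || (r == n + n)%N -> Dm *m cjm (ev r) = ev r.
Proof.
move=> on rN; rewrite cjm_ev Dm_ev /sgn_ev.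
have -> : (if (r <= n)%N then r.-1 else (r - n).-1) = n.-1.
  by case/orP: rN => /eqP ->; [rewrite leqnn | rewrite addKn ifN //; lia].
by rewrite -signr_odd (_ : odd n.-1 = false) ?scale1r //; case: (n) on => //= k /negPf.
Qed.

End EigenVectors.

(** * The matrix L of theta, and Hermitian elements orthogonal to a and n *)

Section SymmetricPart.
Variables (K : fieldType) (cj : {rmorphism K -> K}) (n : nat).
Hypothesis cjK : involutive cj.
Variables (ii s : K).
Hypotheses (ii2 : ii * ii = -1) (cj_ii : cj ii = - ii).
Hypotheses (s2 : 2 * (s * s) = 1) (cj_s : cj s = s) (K2 : 2 != 0 :> K).
Local Notation M := 'M[K]_(n + n).
Local Notation cV := 'cV[K]_(n + n).
Implicit Types (A B X H : M) (u v w : cV) (a b c e : K) (r p q i j k : nat).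
Local Notation cjm := (cjm cj).
Local Notation dag := (dag cj).
Local Notation rho := (rho cj).
Local Notation J := (@block_J K n).
Local Notation ev := (@ev K n).
Local Notation av := (@av K n ii).
Local Notation bv := (@bv K n ii).
Local Notation Hm := (@Hm K n ii s).
Local Notation Dm := (@Dm K n).
Local Notation rsym := (rsym cj).

Let ii0 : ii != 0.
Proof. by apply/eqP => i0; move/eqP: ii2; rewrite i0 mul0r eq_sym oppr_eq0 oner_eq0. Qed.
Let s0 : s != 0.
Proof. by apply/eqP => s0'; move/eqP: s2; rewrite s0' mul0r mulr0 eq_sym oner_eq0. Qed.
Let cj2 : cj 2^-1 = 2^-1. Proof. by rewrite fmorphV rmorph_nat. Qed.

(** Normalized so that [av e j] and [bv e j] have eigenvalue e itself: the H_j give e s, and 2 s^2 =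
    1. *)
Definition Km : M := (2 * s) *: \sum_(j < n./2) Hm j.+1.

Let Km_eig e j v : (0 < j)%N -> (2 * j <= n)%N ->
  (forall i, (0 < i)%N -> (2 * i <= n)%N -> Hm i *m v = ((i == j)%:R * e * s) *: v) ->
  Km *m v = e *: v.
Proof.
move=> j0 jn Hv; rewrite /Km -scalemxAl mulmx_suml.
have lt_j : (j.-1 < n./2)%N by lia.
rewrite (bigD1 (Ordinal lt_j)) //= big1 ?addr0 => [|i ij].
  rewrite Hv; try lia.
  rewrite prednK // eqxx mul1r scalerA.
  have -> : 2 * s * (e * s) = 2 * (s * s) * e by ring.
  by rewrite s2 mul1r.
have lt_i := ltn_ord i; rewrite Hv; try lia.
rewrite (_ : (i.+1 == j) = false) ?mul0r ?scale0r //.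
by apply/negP => /eqP ij'; move/eqP: ij; apply; apply: val_inj; rewrite /= -ij'.
Qed.

Lemma Km_av e j : e * e = 1 -> (0 < j)%N -> (2 * j <= n)%N -> Km *m av e j = e *: av e j.
Proof. by move=> e2 j0 jn; apply: (Km_eig j0 jn) => i i0 iN; apply: Hm_av. Qed.

Lemma Km_bv e j : e * e = 1 -> (0 < j)%N -> (2 * j <= n)%N -> Km *m bv e j = e *: bv e j.
Proof. by move=> e2 j0 jn; apply: (Km_eig j0 jn) => i i0 iN; apply: Hm_bv. Qed.

Let halves (P : cV -> Prop) a u v :
  a * a = -1 -> (forall b u v, P u -> P v -> P (b *: (u + v))) ->
  P (u + a *: v) -> P (u + (- a) *: v) -> P u /\ P v.
Proof.
move=> a2 PD Pu Pv; split.
  suff -> : u = 2^-1 *: ((u + a *: v) + (u + (- a) *: v)) by apply: PD.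
  by apply/matrixP => x y; rewrite !mxE; field.
have Pv' : P (- 2^-1 *: ((u + (- a) *: v) + (u + (- a) *: v))) by apply: (PD).
suff -> : v = (- (a * 2^-1)) *: ((u + a *: v) +
    - 2^-1 *: ((u + (- a) *: v) + (u + (- a) *: v))) by apply: PD.
apply/matrixP => x y; rewrite !mxE; move: (u x y) (v x y) => p q.
transitivity (- (a * a) * q); first by rewrite a2 opprK mul1r.
by field.
Qed.

(** K^2 is the identity on all [av e j] and [bv e j]; for n even, half sums and differences of these
    give every canonical vector. *)
Lemma Km_sq : ~~ odd n -> Km *m Km = 1%:M.
Proof.
move=> en; apply: mx_ev_eq => r rn; rewrite mul1mx.
pose P v := Km *m Km *m v = v.
have PD b u v : P u -> P v -> P (b *: (u + v)).
  by rewrite /P -(scalemxAr b) mulmxDr => -> ->.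
have Pa e j : e * e = 1 -> (0 < j)%N -> (2 * j <= n)%N -> P (av e j).
  by move=> e2 j0 jn; rewrite /P -mulmxA Km_av // -(scalemxAr e) Km_av // scalerA e2 scale1r.
have Pb e j : e * e = 1 -> (0 < j)%N -> (2 * j <= n)%N -> P (bv e j).
  by move=> e2 j0 jn; rewrite /P -mulmxA Km_bv // -(scalemxAr e) Km_bv // scalerA e2 scale1r.
have N11 : (-1) * (-1) = 1 :> K by rewrite mulrNN mulr1.
have Plo j : (0 < j)%N -> (2 * j <= n)%N -> P (ev (2 * j - 1)) /\ P (ev (2 * j)).
  move=> j0 jn; apply: (@halves _ (- ii)) => //; first by rewrite mulrNN.
    by have := Pa 1 j (mulr1 1) j0 jn; rewrite /av mulr1.
  by have := Pa (-1) j N11 j0 jn; rewrite /av mulrN1.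
have Phi j : (0 < j)%N -> (2 * j <= n)%N -> P (ev (n + 2 * j - 1)) /\ P (ev (n + 2 * j)).
  move=> j0 jn; apply: (@halves _ ii) => //.
    by have := Pb 1 j (mulr1 1) j0 jn; rewrite /bv mulr1.
  by have := Pb (-1) j N11 j0 jn; rewrite /bv mulrN1.
suff [j j0 [jn]] : exists2 j, (0 < j)%N & (2 * j <= n)%N /\
    ([\/ r = (2 * j - 1)%N, r = (2 * j)%N, r = (n + 2 * j - 1)%N | r = (n + 2 * j)%N]).
  by case=> ->; [case: (Plo j j0 jn)|case: (Plo j j0 jn)|case: (Phi j j0 jn)|case: (Phi j j0 jn)].
have [rn'|nr] := leqP r n.
  exists (r.+1)./2; first lia.
  split; first lia.
  have [ro|re] := boolP (odd r); [apply: Or41 | apply: Or42]; lia.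
exists ((r - n).+1)./2; first lia.
split; first lia.
have [ro|re] := boolP (odd r); [apply: Or43 | apply: Or44]; lia.
Qed.

Lemma Km_tr : Km^T = - Km.
Proof.
rewrite /Km linearZ linear_sum /= -scalerN -sumrN; congr (_ *: _).
by apply: eq_bigr => j _; rewrite Hm_tr.
Qed.

Lemma Km_cjm : cjm Km = - Km.
Proof.
rewrite /Km cjmZ rmorphM rmorph_nat cj_s -scalerN; congr (_ *: _).
rewrite -sumrN (big_morph _ (@cjmD _ cj _ _) (map_mx0 _ _ _)).
by apply: eq_bigr => j _; rewrite Hm_cjm.
Qed.

Lemma Km_rho : rho Km = Km.
Proof.
rewrite /Km rhoZ rmorphM rmorph_nat cj_s; congr (_ *: _).
rewrite (big_morph _ (@rhoD _ cj _) (rho0 _ _)).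
by apply: eq_bigr => j _; apply: Hm_rho => //; have := ltn_ord j; lia.
Qed.

(** D has opposite signs on the two coordinates wedged in each term of H_j. *)
Lemma Dm_Km : Dm *m Km = - (Km *m Dm).
Proof.
have DH j : (0 < j)%N -> (2 * j <= n)%N -> Dm *m Hm j = - (Hm j *m Dm).
  move=> j0 jn.
  have Dw p q : sgn_ev K n p * sgn_ev K n q = -1 ->
      Dm *m wedge (ev p) (ev q) = - (wedge (ev p) (ev q) *m Dm).
    move=> pq.
    have evD r : (ev r)^T *m Dm = sgn_ev K n r *: (ev r)^T.
      by rewrite -{1}(Dm_tr K n) -trmx_mul Dm_ev linearZ.
    rewrite /wedge mulmxBr mulmxBl !mulmxA !Dm_ev -!(mulmxA _ _ Dm) !evD.
    rewrite -!scalemxAl -!scalemxAr.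
    have E : sgn_ev K n p = - sgn_ev K n q.
      by rewrite -[LHS]mulr1 -(sgn_ev_sq K n q) mulrA pq mulN1r.
    by rewrite E !scaleNr opprD !opprK addrC.
  have sg r : (0 < r)%N -> (r < n)%N -> odd r -> sgn_ev K n r * sgn_ev K n r.+1 = -1.
    move=> r0 rn ro; rewrite /sgn_ev rn ltnW //= -{2}(prednK r0) exprS mulrCA.
    by rewrite -expr2 sqrr_sign mulr1.
  have s1 : sgn_ev K n (2 * j - 1) * sgn_ev K n (2 * j) = -1.
    have /sg : (0 < 2 * j - 1)%N by lia.
    by rewrite (_ : (2 * j - 1).+1 = (2 * j)%N); [apply; lia | lia].
  have s2' : sgn_ev K n (n + 2 * j - 1) * sgn_ev K n (n + 2 * j) = -1.
    by rewrite -addnBA ?sgn_evD; try lia; exact: s1.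
  by rewrite /Hm -scalemxAr -scalemxAl mulmxBr mulmxBl !Dw // -scalerN -opprD.
rewrite /Km -scalemxAr -scalemxAl -scalerN mulmx_sumr mulmx_suml -sumrN; congr (_ *: _).
by apply: eq_bigr => j _; apply: DH => //; have := ltn_ord j; lia.
Qed.

(* For n even the flags also depend on the sign in omega_j +- omega_k, seen by K. *)
Definition Lm : M := if odd n then Dm else Km *m Dm.
(** The conjugate of L is eps L: D is real and K purely imaginary. *)
Definition eps : K := if odd n then 1 else -1.

Lemma theta_frame_Lm : theta_frame cj Lm eps.
Proof.
rewrite /Lm /eps; case: ifP => on; split.
- exact: Dm_tr.
- by rewrite Dm_cjm scale1r.
- exact: Dm_sq.
- exact: Dm_rho.
- exact: mulr1.
- exact: rmorph1.
- by rewrite trmx_mul Dm_tr Km_tr mulmxN Dm_Km opprK.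
- by rewrite cjmM Km_cjm Dm_cjm mulNmx scaleN1r.
- rewrite -mulmxA (mulmxA Dm) Dm_Km mulNmx -(mulmxA Km) Dm_sq mulmx1 mulmxN.
  by rewrite Km_sq ?on // raddfN.
- by rewrite rhoM Km_rho Dm_rho.
- by rewrite mulrNN mulr1.
- exact: rmorphN1.
Qed.

Let sgK e : K := if odd n then 1 else e.

Lemma Lm_av e j : e * e = 1 -> cj e = e -> (0 < j)%N -> (2 * j <= n)%N ->
  Lm *m cjm (av e j) = sgK e *: av e j.
Proof.
move=> e2 ce j0 jn; rewrite /Lm /sgK; case: ifP => _; first by rewrite Dm_av ?scale1r.
by rewrite -mulmxA Dm_av // Km_av.
Qed.

Lemma Lm_bv e j : e * e = 1 -> cj e = e -> (0 < j)%N -> (2 * j <= n)%N ->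
  Lm *m cjm (bv e j) = sgK e *: bv e j.
Proof.
move=> e2 ce j0 jn; rewrite /Lm /sgK; case: ifP => _; first by rewrite Dm_bv ?scale1r.
by rewrite -mulmxA Dm_bv // Km_bv.
Qed.

Lemma Lm_ev r : odd n -> (r == n) || (r == n + n)%N -> Lm *m cjm (ev r) = 1 *: ev r.
Proof. by move=> on rN; rewrite /Lm on Dm_ev_odd // scale1r. Qed.

(** Gives H_j the shape of the root vectors, so that its invariance under theta and the commutation
    of the H_j come from the wedge lemmas. *)
Lemma Hm_rsym j : (0 < j)%N -> (2 * j <= n)%N ->
  Hm j = rsym ((s * 2^-1) *: wedge (av 1 j) (av (-1) j)).
Proof.
move=> j0 jn; rewrite rsym_wedge ?rmorphM ?cj_s ?cj2 //.
rewrite !(kap_av cj_ii) ?rmorphN ?rmorph1 // wedgeNl wedgeNr opprK.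
rewrite /av /bv !wedge_expand /Hm !(wedgeC (ev (2 * j)) (ev (2 * j - 1))).
rewrite !(wedgeC (ev (n + 2 * j)) (ev (n + 2 * j - 1))).
have w0 u : wedge u u = 0 :> M by rewrite /wedge subrr.
rewrite !w0 !scaler0 !addr0 !add0r; move: (wedge _ _) (wedge _ _) => P Q.
by apply/matrixP => x y; rewrite !mxE; field.
Qed.

Lemma theta_rsym_wedge c a b t u w : Lm *m cjm u = a *: u -> Lm *m cjm w = b *: w ->
  eps * cj c * a * b = t * c -> cj t = t ->
  theta cj Lm (rsym (c *: wedge u w)) = t *: rsym (c *: wedge u w).
Proof.
move=> Lu Lw Et ct; apply: (theta_rsym cjK theta_frame_Lm ct).
by rewrite (theta_wedge theta_frame_Lm _ Lu Lw) Et scalerA.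
Qed.

Lemma theta_Hm j : (0 < j)%N -> (2 * j <= n)%N -> theta cj Lm (Hm j) = Hm j.
Proof.
move=> j0 jn; rewrite Hm_rsym // -[RHS]scale1r.
apply: (theta_rsym_wedge (a := sgK 1) (b := sgK (-1))); rewrite ?rmorph1 //.
- by apply: Lm_av; rewrite ?mulr1 ?rmorph1.
- by apply: Lm_av; rewrite ?mulrNN ?mulr1 ?rmorphN ?rmorph1.
rewrite rmorphM cj_s cj2 /eps /sgK; case: ifP => _; ring.
Qed.

Lemma cm_Hm_rsym i c a b u w : (0 < i)%N -> (2 * i <= n)%N ->
  Hm i *m u = (a * s) *: u -> Hm i *m w = (b * s) *: w -> cj a = a -> cj b = b ->
  comm_mx_ (Hm i) (rsym (c *: wedge u w)) = (s * (a + b)) *: rsym (c *: wedge u w).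
Proof.
move=> i0 iN Hu Hw ca cb; apply: cm_rsym; first exact: Hm_rho.
  by rewrite rmorphM rmorphD ca cb cj_s.
have E : comm_mx_ (Hm i) (wedge u w) = (a * s + b * s) *: wedge u w.
  by apply: cm_wedge Hu Hw; apply: Hm_tr.
rewrite /comm_mx_ -(scalemxAr c) -(scalemxAl c) -scalerBr.
rewrite -/(comm_mx_ _ _) E !scalerA; congr (_ *: _); ring.
Qed.

(* A skew-symmetric Hermitian x is i times a real matrix. *)
Section Hermitian.
Variable x : M.
Hypotheses (xT : x^T = - x) (xr : rho x = x) (xd : dag x = x).

(** Vanishing of the real part, expressed over an abstract field. *)
Definition real0 (z : K) := z + cj z = 0.
Definition orth (v : M) := real0 (\tr (x *m dag v)).

Let t p q := dot (ev p) (x *m ev q).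

Let xc : cjm x = - x.
Proof. by rewrite -xT -{2}xd /dag trmxK. Qed.

Let bC u w : dot u (x *m w) = - dot w (x *m u).
Proof.
rewrite /dot -[u^T *m _]trmxK mxE trmx_mul trmxK trmx_mul xT mulmxN mulNmx mulmxA.
by rewrite mxE.
Qed.

Let cj_b u w : cj (dot u (x *m w)) = - dot (cjm u) (x *m cjm w).
Proof.
have -> : cj (dot u (x *m w)) = dot (cjm u) (cjm (x *m w)).
  by rewrite /dot -cjm_tr -cjmM [RHS]mxE.
by rewrite cjmM xc mulNmx /dot mulmxN mxE.
Qed.

(** As x is fixed by rho, the two halves of [rsym] contribute conjugate traces. *)
Lemma orth_rsym c u w : orth (rsym (c *: wedge u w)) -> real0 (c * dot u (x *m w)).
Proof.
have E : \tr (x *m dag (rsym (c *: wedge u w))) =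
    cj (- (2 * (c * dot u (x *m w)))) - 2 * (c * dot u (x *m w)).
  have E1 : \tr (x *m dag (c *: wedge u w)) = cj (- (2 * (c * dot u (x *m w)))).
    rewrite -{1}xd -dagM mxtr_dag; congr (cj _).
    rewrite -scalemxAl linearZ /= /wedge mulmxBl linearB /=.
    have tr_outer (p q : cV) : \tr (p *m q^T *m x) = dot q (x *m p).
      by rewrite mxtrace_mulC mulmxA mxtrace_mulC /mxtrace big_ord1.
    by rewrite !tr_outer (bC w u); ring.
  rewrite /rsym dagD mulmxDr linearD /= E1 -(rho_dag cjK) -{2}xr -rhoM mxtr_rho E1 cjK.
  by [].
rewrite /orth /real0 E !(rmorphB, rmorphN, rmorphM) !cjK ?rmorph_nat => H.
have {}H : - (4 * (c * dot u (x *m w) + cj c * cj (dot u (x *m w)))) = 0.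
  by rewrite -[RHS]H; ring.
have K4 : 4 != 0 :> K by rewrite (_ : 4 = 2 * 2) ?mulf_neq0 // -natrM.
by move/eqP: H; rewrite oppr_eq0 mulf_eq0 (negPf K4) => /eqP.
Qed.

Let cj_t p q : cj (t p q) = - t p q.
Proof. by rewrite cj_b !cjm_ev. Qed.

Let tC p q : t p q = - t q p.
Proof. exact: bC. Qed.

Let t_refl p : t p p = 0.
Proof.
have /eqP := tC p p; rewrite -subr_eq0 opprK -mulr2n -mulr_natl mulf_eq0.
by rewrite (negPf K2) => /eqP.
Qed.

(** The unknowns are purely imaginary, so each condition is one real linear equation; both
    coefficients for e = 1 and e = -1 give four independent equations in four unknowns. *)
Lemma real0_quad t11 t12 t21 t22 : cj t11 = - t11 -> cj t12 = - t12 ->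
  cj t21 = - t21 -> cj t22 = - t22 ->
  (forall e, e * e = 1 -> cj e = e ->
     let z := t11 + (- (ii * e)) * t12 + (- ii) * t21 + (- e) * t22 in
     real0 (2^-1 * z) /\ real0 (2^-1 * (ii * e) * z)) ->
  [/\ t11 = 0, t12 = 0, t21 = 0 & t22 = 0].
Proof.
move=> c11 c12 c21 c22 H; rewrite /real0 in H.
have [H1 H1'] := H 1 (mulr1 1) (rmorph1 cj).
have [|| H2 H2'] := H (-1); rewrite ?mulrNN ?mulr1 ?rmorphN ?rmorph1 //.
move: H1 H1' H2 H2'.
rewrite !(rmorphD, rmorphN, rmorphM, rmorph1) cj2 cj_ii c11 c12 c21 c22.
move=> H1 H1' H2 H2'.
have i2 : 2 * ii != 0 by rewrite mulf_neq0.
split; apply: (mulfI i2); rewrite mulr0.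
- by rewrite -[RHS]subr0 -{1}H1' -H2'; field.
- by rewrite -[RHS]subr0 -{1}H2 -H1; field.
- by rewrite -[RHS]oppr0 -[in RHS](addr0 0) -{1}H1 -H2; field.
- by rewrite -[RHS]oppr0 -[in RHS](addr0 0) -{1}H1' -H2'; field.
Qed.

Hypothesis orth_lo : forall e j k, e * e = 1 -> cj e = e -> (0 < j)%N -> (j < k)%N ->
  (2 * k <= n)%N -> [/\ orth (rsym (2^-1 *: wedge (av 1 j) (av e k))),
    orth (rsym ((2^-1 * (ii * e)) *: wedge (av 1 j) (av e k))),
    orth (rsym ((2^-1 * (ii * - e)) *: wedge (av 1 j) (bv e k)))
  & orth (rsym (2^-1 *: wedge (av 1 j) (bv e k)))].
Hypothesis orth_G : forall k, (0 < k)%N -> (2 * k <= n)%N ->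
  orth (rsym ((s * 2^-1) *: wedge (av 1 k) (bv 1 k))).
Hypothesis orth_H : forall k, (0 < k)%N -> (2 * k <= n)%N -> orth (Hm k).
Hypothesis orth_odd : forall k r, odd n -> (0 < k)%N -> (2 * k <= n)%N ->
  (r == n) || (r == n + n)%N ->
  orth (rsym (s *: wedge (av 1 k) (ev r))) /\
  orth (rsym ((s * ii) *: wedge (av 1 k) (ev r))).

Let dot_av e j v : dot (av e j) v = dot (ev (2 * j - 1)) v + (- (ii * e)) * dot (ev (2 * j)) v.
Proof. by rewrite !(dotC _ v) dotDr dotZr. Qed.

Let b_aa e j k : dot (av 1 j) (x *m av e k) =
  t (2 * j - 1) (2 * k - 1) + (- (ii * e)) * t (2 * j - 1) (2 * k)
  + (- ii) * t (2 * j) (2 * k - 1) + (- e) * t (2 * j) (2 * k).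
Proof.
rewrite dot_av /av mulmxDr -scalemxAr !dotDr !dotZr mulr1 -!/(t _ _).
rewrite mulrDr addrA; congr (_ + _).
by rewrite mulrA mulNr mulrN opprK mulrA ii2 mulN1r.
Qed.

Let b_ab e j k : dot (av 1 j) (x *m bv e k) =
  t (2 * j - 1) (n + 2 * k - 1) + (- (ii * - e)) * t (2 * j - 1) (n + 2 * k)
  + (- ii) * t (2 * j) (n + 2 * k - 1) + (- - e) * t (2 * j) (n + 2 * k).
Proof.
rewrite dot_av /bv mulmxDr -scalemxAr !dotDr !dotZr mulr1 -!/(t _ _).
rewrite mulrDr addrA mulrN opprK; congr (_ + _).
by rewrite mulrA mulNr mulrA ii2 mulN1r.
Qed.

Let t_lt j k : (0 < j)%N -> (j < k)%N -> (2 * k <= n)%N ->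
  [/\ t (2 * j - 1) (2 * k - 1) = 0, t (2 * j - 1) (2 * k) = 0,
     t (2 * j) (2 * k - 1) = 0 & t (2 * j) (2 * k) = 0] /\
  [/\ t (2 * j - 1) (n + 2 * k - 1) = 0, t (2 * j - 1) (n + 2 * k) = 0,
     t (2 * j) (n + 2 * k - 1) = 0 & t (2 * j) (n + 2 * k) = 0].
Proof.
move=> j0 jk kn; split.
  apply: real0_quad => // e e2 ce z; rewrite /z -b_aa.
  by have [/orth_rsym ? /orth_rsym ? _ _] := orth_lo e2 ce j0 jk kn.
apply: real0_quad => // e e2 ce z; rewrite /z -[e]opprK -b_ab opprK.
have [||_ _ /orth_rsym ? /orth_rsym ?] := @orth_lo (- e) j k _ _ j0 jk kn.
- by rewrite mulrNN.
- by rewrite rmorphN ce.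
by rewrite -{2}[e]opprK.
Qed.

Let rc u w : dot (kap cj u) (x *m kap cj w) = cj (dot u (x *m w)).
Proof.
have xJ : x *m J = - (J *m x).
  rewrite -{1}xr /rho xc -mulmxA tr_block_J (mulNmx J J) block_J_sq opprK mulmx1.
  by rewrite mulmxN.
rewrite cj_b /kap /dot trmx_mul (mulmxA x) xJ mulNmx !mulmxN !mulmxA.
by rewrite -(mulmxA _ J^T J) tr_block_J (mulNmx J J) block_J_sq opprK mulmx1 mxE.
Qed.

(** Invariance under rho determines the lower right block of x and relates entries of the upper
    right block across its diagonal. *)
Let t_hi p q : (0 < p <= n)%N -> (0 < q <= n)%N ->
  t (n + p) (n + q) = - t p q /\ t q (n + p) = - t p (n + q).
Proof.
move=> p1 q1; have := rc (ev p) (ev q); have := rc (ev p) (ev (n + q)).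
rewrite (kap_ev_lo _ p1) (kap_ev_lo _ q1) (kap_ev_hi _ q1) !cj_t.
have dNl u v : dot (- u) v = - dot u v by rewrite dotC -scaleN1r dotZr mulN1r dotC.
have dNr u v : dot u (- v) = - dot u v by rewrite dotC dNl dotC.
rewrite !dNl mulmxN dNr opprK -!/(t _ _) => H1 H2; split=> //.
by rewrite tC H1.
Qed.

Let t_G k : (0 < k)%N -> (2 * k <= n)%N -> t (2 * k - 1) (n + 2 * k) = 0.
Proof.
move=> k0 kn; have /orth_rsym := orth_G k0 kn.
have [k1 k2] : (0 < 2 * k - 1 <= n)%N /\ (0 < 2 * k <= n)%N by lia.
have E r : (0 < r <= n)%N -> t r (n + r) = 0.
  move=> r1; have [_ /eqP] := t_hi r1 r1.
  by rewrite -subr_eq0 opprK -mulr2n -mulr_natl mulf_eq0 (negPf K2) => /eqP.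
have E21 : t (2 * k) (n + (2 * k - 1)) = - t (2 * k - 1) (n + 2 * k).
  by have [] := t_hi k1 k2.
have E12 : (n + 2 * k - 1 = n + (2 * k - 1))%N by lia.
rewrite b_ab E12 (E _ k1) (E _ k2) E21 add0r mulr0 addr0 /real0.
rewrite !(rmorphD, rmorphN, rmorphM, rmorph1) cj_s cj2 cj_ii cj_t => H.
have /eqP : (2 * s * ii) * t (2 * k - 1) (n + 2 * k) = 0 by rewrite -[RHS]H; field.
by rewrite !mulf_eq0 (negPf K2) (negPf ii0) (negPf s0) => /eqP.
Qed.

Let t_H k : (0 < k)%N -> (2 * k <= n)%N -> t (2 * k - 1) (2 * k) = 0.
Proof.
move=> k0 kn; have := orth_H k0 kn; rewrite Hm_rsym // => /orth_rsym.
rewrite b_aa !t_refl (tC (2 * k) (2 * k - 1)) add0r mulr0 addr0 /real0.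
rewrite !(rmorphD, rmorphN, rmorphM, rmorph1) cj_s cj2 cj_ii cj_t => H.
have /eqP : (2 * s * ii) * t (2 * k - 1) (2 * k) = 0 by rewrite -[RHS]H; field.
by rewrite !mulf_eq0 (negPf K2) (negPf ii0) (negPf s0) => /eqP.
Qed.

Let t_odd k r : odd n -> (0 < k)%N -> (2 * k <= n)%N -> (r == n) || (r == n + n)%N ->
  t (2 * k - 1) r = 0 /\ t (2 * k) r = 0.
Proof.
move=> on k0 kn rn; have [/orth_rsym H1 /orth_rsym H2] := orth_odd on k0 kn rn.
move: H1 H2; rewrite /real0 dot_av mulr1 -!/(t _ _).
rewrite !(rmorphD, rmorphN, rmorphM, rmorph1) cj_s cj_ii !cj_t => H1 H2.
have /eqP : (2 * s * ii) * t (2 * k) r = 0 by rewrite -[RHS]oppr0 -[in RHS]H1; field.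
rewrite !mulf_eq0 (negPf K2) (negPf ii0) (negPf s0) => /eqP ->; split=> //.
have /eqP : (2 * s * ii) * t (2 * k - 1) r = 0 by rewrite -[RHS]H2; field.
by rewrite !mulf_eq0 (negPf K2) (negPf ii0) (negPf s0) => /eqP.
Qed.

Let t_small r q : (0 < r)%N -> (r < q)%N -> (q <= n)%N ->
  t r q = 0 /\ t r (n + q) = 0.
Proof.
move=> r0 rq qn.
have half r' : (0 < r')%N -> ~~ (odd n && (r' == n)) -> (r' <= n)%N ->
    exists j, [/\ (0 < j)%N, (2 * j <= n)%N & r' = (2 * j - 1)%N \/ r' = (2 * j)%N].
  move=> r0' rn' le; exists (r'.+1)./2; split; try lia.
have [||j [j0 jn rE]] := half r r0; try lia.
have [/andP[on /eqP qE]|qn'] := boolP (odd n && (q == n)).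
  have o1 : (n == n) || (n == n + n)%N by rewrite eqxx.
  have o2 : (n + n == n)%N || (n + n == n + n)%N by rewrite eqxx orbT.
  have [T1 T2] := t_odd on j0 jn o1; have [T3 T4] := t_odd on j0 jn o2.
  rewrite qE.
  by case: rE => ->.
have q0 : (0 < q)%N by lia.
have [k [k0 kn qE]] := half q q0 qn' qn.
have [jk|kj] := ltnP j k.
  have [[a1 a2 a3 a4] [b1 b2 b3 b4]] := t_lt j0 jk kn.
  by case: rE qE => -> [] ->; rewrite ?addnBA //; lia.
have jk : j = k by lia.
have [-> ->] : r = (2 * k - 1)%N /\ q = (2 * k)%N by lia.
by rewrite t_G // t_H.
Qed.

(** Entries of x between distinct coordinate planes vanish by orthogonality to the vectors A, B, C,
    D; those within one plane by H and G; for n odd, those in the last columns of the two blocks by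
    X, Y, Z, W. Skew symmetry and rho give the other entries. *)
Lemma symmetric_eq0 : x = 0.
Proof.
have T r q : (0 < r <= n)%N -> (0 < q <= n)%N -> t r q = 0 /\ t r (n + q) = 0.
  move=> r1 q1; have [rq|qr|rq] := ltngtP r q.
  - by apply: t_small => //; lia.
  - have [E1 E2] : t q r = 0 /\ t q (n + r) = 0 by apply: t_small; lia.
    rewrite tC E1 oppr0; split=> //; have [_ E] := t_hi q1 r1.
    by rewrite E E2 oppr0.
  rewrite rq t_refl; split=> //; have [_ /eqP] := t_hi q1 q1.
  by rewrite -subr_eq0 opprK -mulr2n -mulr_natl mulf_eq0 (negPf K2) => /eqP.
have T' r q : (0 < r <= n + n)%N -> (0 < q <= n + n)%N -> t r q = 0.
  move=> r1 q1; have [rn|nr] := leqP r n; have [qn|nq] := leqP q n.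
  - by have [] := @T r q; try lia.
  - have -> : q = (n + (q - n))%N by lia.
    by have [] := @T r (q - n)%N; try lia.
  - have -> : r = (n + (r - n))%N by lia.
    by rewrite tC; have [|| _ ->] := @T q (r - n)%N; rewrite ?oppr0; try lia.
  have -> : q = (n + (q - n))%N by lia.
  have -> : r = (n + (r - n))%N by lia.
  have [||-> _] := @t_hi (r - n)%N (q - n)%N; try lia.
  by have [|| -> _] := @T (r - n)%N (q - n)%N; rewrite ?oppr0; try lia.
apply: mx_ev_eq => q q1; rewrite mul0mx; apply/matrixP => -[r lt_r] z.
have -> : (x *m ev q) (Ordinal lt_r) z = t r.+1 q.
  by rewrite /t dotC /dot (mul_ev _ lt_r) [RHS]mxE (ord1 z).
by rewrite T' // mxE.
Qed.

End Hermitian.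

End SymmetricPart.

(** * The real trace form on complex matrices *)

Section RealTrace.
Variable R : realType.
Local Notation C := R[i].
Local Notation cj := (@conjc R : {rmorphism C -> C}).
Local Notation dag := (dag cj).
Implicit Types (a : R) (z : C).

Lemma Re_realM a z : complex.Re (a%:C%C * z) = a * complex.Re z.
Proof. by case: z => x y; rewrite /= mul0r subr0. Qed.

Lemma Re_conjc z : complex.Re (conjc z) = complex.Re z.
Proof. by case: z. Qed.

Lemma eq_Re_addc z w : z + conjc z = w + conjc w -> complex.Re z = complex.Re w.
Proof. by case: z w => a b [c d] /= [E _]; lra. Qed.

Definition rtr N (A B : gl R N) : R := complex.Re (\tr (A *m dag B)).

Lemma dagE k l (A : 'M[C]_(k, l)) i j : dag A i j = conjc (A j i).
Proof. by rewrite !mxE. Qed.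

Lemma rtr_euclidean N : euclidean (@rtr N).
Proof.
split=> [A a B D|A B|A A0]; rewrite /rtr.
- have -> : a *: B + D = a%:C%C *: (B : 'M_N) + D :> 'M_N by [].
  have -> : \tr (A *m dag (a%:C%C *: (B : 'M_N) + D)) =
      a%:C%C * \tr (A *m dag B) + \tr (A *m dag D).
    have cr : cj a%:C%C = a%:C%C := conjc_real a.
    by rewrite dagD dagZ cr mulmxDr -scalemxAr linearD linearZ.
  by rewrite raddfD /= Re_realM.
- by rewrite -(Re_conjc (\tr (B *m _))) -(mxtr_dag cj) dagM dagK //; apply: conjcK.
have -> : complex.Re (\tr (A *m dag A)) =
    \sum_i \sum_j ((complex.Re (A i j)) ^+ 2 + (complex.Im (A i j)) ^+ 2).
  rewrite /mxtrace raddf_sum; apply: eq_bigr => i _ /=.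
  rewrite mxE raddf_sum; apply: eq_bigr => j _ /=.
  by rewrite dagE; case: (A i j) => x y /=; ring.
have ge0 i j : 0 <= complex.Re (A i j) ^+ 2 + complex.Im (A i j) ^+ 2.
  by rewrite addr_ge0 ?sqr_ge0.
rewrite lt_neqAle sumr_ge0 ?andbT => [|i _]; last exact: sumr_ge0.
apply: contra A0 => /eqP/esym/psumr_eq0P E; apply/eqP/matrixP => i j; rewrite !mxE.
have /psumr_eq0P E' := E (fun i _ => sumr_ge0 _ (fun j _ => ge0 i j)) i isT.
have /eqP := E' (fun j _ => ge0 i j) j isT; rewrite paddr_eq0 ?sqr_ge0 //.
by rewrite !sqrf_eq0; case: (A i j) => x y /= /andP[/eqP -> /eqP ->].
Qed.

Lemma rtr_delta N (c : C) i j (A : gl R N) :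
  rtr (c *: delta_mx i j : 'M_N) A = complex.Re (c * conjc (A i j)).
Proof.
rewrite /rtr -scalemxAl linearZ /= /mxtrace (bigD1 i) //= big1 ?addr0 => [|k ki].
  rewrite mxE (bigD1 j) //= big1 ?addr0 => [|l lj]; first by rewrite dagE mxE !eqxx mul1r.
  by rewrite mxE (negPf lj) andbF mul0r.
by rewrite mxE big1 // => l _; rewrite mxE (negPf ki) mul0r.
Qed.

End RealTrace.

Lemma sum_map2 (T : finType) (X : Type) (V : nmodType) (f g : T -> X) (F : X -> V) :
  \sum_(e <- map f (enum T) ++ map g (enum T)) F e = \sum_t (F (f t) + F (g t)).
Proof. by rewrite big_cat /= 2!big_map !big_enum -big_split. Qed.

(** * A frame of so(n, H) and its Killing form *)

Section SoStarAlgebra.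
Variables (R : realType) (n : nat).
Local Notation C := R[i].
Local Notation cj := (@conjc R : {rmorphism C -> C}).
Local Notation M := 'M[C]_(n + n).
Local Notation G := (gl R (n + n)).
Local Notation dag := (dag cj).
Local Notation rho := (rho cj).
Local Notation so_proj := (so_proj cj).
Local Notation cm := (@comm_mx_ C (n + n)).
Implicit Types (x y z : G) (A B : M) (a : R).

Let cK : involutive cj. Proof. exact: conjcK. Qed.
Let C2 : 2 != 0 :> C. Proof. by rewrite pnatr_eq0. Qed.
Let C4 : 4 != 0 :> C. Proof. by rewrite pnatr_eq0. Qed.

Lemma commutator_lie : lie_bracket (@commutator R n).
Proof.
split=> [x|y a u v|x|x y z].
- exact: commutator_linear.
- have commN p q : commutator p q = - commutator q p :> G by exact: cmC.
  by rewrite !(commN _ y) commutator_linear opprD -scalerN.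
- exact: subrr.
- exact: cm_leibniz.
Qed.

Lemma so_nHP A : reflect (so_star cj A) ((A : G) \in so_nH R n).
Proof.
apply: (iffP idP) => [/mem_so_nH hA|hA]; first exact/(so_star_block cK).
exact/mem_so_nH/(so_star_block cK).
Qed.

Lemma rtr_commutator x y z :
  rtr (commutator x y) z = rtr y (commutator (dag x) z).
Proof. by rewrite /rtr; congr complex.Re; apply: mxtr_cm. Qed.

Lemma so_nH_br : {in so_nH R n &, forall x y, commutator x y \in so_nH R n}.
Proof. by move=> x y /so_nHP hx /so_nHP hy; apply/so_nHP; apply: so_star_cm. Qed.

Lemma so_nH_dag : {in so_nH R n, forall x, (dag x : G) \in so_nH R n}.
Proof. by move=> x /so_nHP hx; apply/so_nHP; apply: so_star_dag. Qed.

Lemma so_proj_so A : (so_proj A : G) \in so_nH R n.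
Proof. by apply/so_nHP; apply: so_projP. Qed.

Lemma so_nH_proj_id x : x \in so_nH R n -> so_proj x = x.
Proof. by move=> /so_nHP; apply: so_proj_id. Qed.

Lemma so_proj_sym A B : rtr (so_proj A : G) (B : G) = rtr (A : G) (so_proj B : G).
Proof.
exact: eq_Re_addc (mxtr_so_proj cK A B C4).
Qed.

(** Projections of the orthonormal real basis E_ij, i E_ij of gl(2n, C): a redundant Parseval frame
    of so(n, H). *)
Definition so_frame : seq G :=
  [seq so_proj (delta_mx ij.1 ij.2) | ij <- enum {: 'I_(n + n) * 'I_(n + n)}] ++
  [seq so_proj ('i%C *: delta_mx ij.1 ij.2) | ij <- enum {: 'I_(n + n) * 'I_(n + n)}].

Lemma sum_so_frame (V : nmodType) (F : G -> V) : \sum_(e <- so_frame) F e =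
  \sum_i \sum_j (F (so_proj (delta_mx i j)) + F (so_proj ('i%C *: delta_mx i j))).
Proof.
by rewrite pair_bigA; apply: sum_map2.
Qed.

Let rtr_so_proj1 i j x : x \in so_nH R n ->
  rtr (so_proj (delta_mx i j) : G) x = complex.Re (x i j).
Proof.
move=> gx; rewrite so_proj_sym so_nH_proj_id // -[delta_mx i j]scale1r rtr_delta.
by rewrite mul1r Re_conjc.
Qed.

Let rtr_so_proji i j x : x \in so_nH R n ->
  rtr (so_proj ('i%C *: delta_mx i j) : G) x = complex.Im (x i j).
Proof.
move=> gx; rewrite so_proj_sym so_nH_proj_id // rtr_delta; case: (x i j) => u v /=.
by rewrite mul0r mul1r sub0r opprK.
Qed.

Lemma so_frameP : frame (@rtr R (n + n)) (so_nH R n) so_frame.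
Proof.
split=> [x|x gx].
  by rewrite mem_cat => /orP[/mapP[u _ ->]|/mapP[u _ ->]]; apply: so_proj_so.
rewrite sum_so_frame.
have proj0 : so_proj (0 : M) = 0 by exact: so_proj0.
rewrite -[LHS](so_nH_proj_id gx) {1}(matrix_sum_delta (x : M)).
rewrite (big_morph _ (@so_projD _ cj _) proj0).
have E i j : so_proj (x i j *: delta_mx i j) =
    complex.Re (x i j) *: (so_proj (delta_mx i j) : G) +
    complex.Im (x i j) *: (so_proj ('i%C *: delta_mx i j) : G) :> G.
  have cr (a : R) : cj a%:C%C = a%:C%C by exact: conjc_real.
  rewrite {1}(complexE (x i j)) scalerDl mulrC -scalerA so_projD.
  by rewrite (so_projZ _ (cr _)) (so_projZ _ (cr _)).
have sumE (f : 'I_(n + n) -> G) : (\sum_ij f ij : G) = (\sum_ij (f ij : M)) :> M by [].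
rewrite sumE; apply: eq_bigr => i _; rewrite (big_morph _ (@so_projD _ cj _) proj0).
rewrite sumE; apply: eq_bigr => j _; rewrite E.
exact: (f_equal2 (fun a b => a *: _ + b *: _) (esym (rtr_so_proj1 i j gx))
  (esym (rtr_so_proji i j gx))).
Qed.

(** By [cm_so_proj_delta] the real trace along [so_frame] is half the real part of the complex sum
    [sum_cm_delta], whence (4n - 4)/2 = 2n - 2. *)
Lemma killing_so_nH : (0 < n)%N -> {in so_nH R n &, forall x y,
  killing_form (@commutator R n) (so_nH R n) x y =
  (2 * n - 2)%:R * complex.Re (\tr ((x : M) *m y))}.
Proof.
move=> n0 x y gx gy; pose f (z : M) : M := cm x (cm y z).
rewrite /killing_form (trace_on_frame (@rtr_euclidean R _) so_frameP); first last.
- by move=> z gz; apply: so_nH_br => //; apply: so_nH_br.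
- exact: (lbr_linear_comp commutator_lie).
have fso z : z \in so_nH R n -> (f z : G) \in so_nH R n.
  by move=> gz; apply: so_nH_br => //; apply: so_nH_br.
have ci : cj 'i%C = - 'i%C by apply/eqP; rewrite eq_complex /= oppr0 !eqxx.
have term i j : complex.Re (f (so_proj (delta_mx i j)) i j) +
    complex.Im (f (so_proj ('i%C *: delta_mx i j)) i j) =
    2^-1 * complex.Re (f (delta_mx i j - delta_mx j i) i j).
  have [q [E1 E2]] := cm_so_proj_delta x y i j ci.
  apply: etrans (f_equal2 (fun u v => complex.Re u + complex.Im v) E1 E2) _.
  have -> : 4^-1 = (4^-1 : R)%:C%C :> C by rewrite fmorphV rmorph_nat.
  by rewrite -/(f _); move: (f _ i j) q {E1 E2} => [a1 a2] [b1 b2] /=; field.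
transitivity (\sum_i \sum_j (2^-1 * complex.Re (f (delta_mx i j - delta_mx j i) i j))).
  pose F (e : G) : R := rtr e (f e : G).
  have E0 : \sum_(e <- so_frame) rtr e (commutator x (commutator y e)) =
      \sum_(e <- so_frame) F e by [].
  rewrite E0 sum_so_frame; apply: eq_bigr => i _; apply: eq_bigr => j _.
  rewrite -[RHS]term.
  have E1 : F (so_proj (delta_mx i j)) = complex.Re (f (so_proj (delta_mx i j)) i j).
    by apply: rtr_so_proj1; apply: fso; apply: so_proj_so.
  have E2 : F (so_proj ('i%C *: delta_mx i j)) =
      complex.Im (f (so_proj ('i%C *: delta_mx i j)) i j).
    by apply: rtr_so_proji; apply: fso; apply: so_proj_so.
  exact: (f_equal2 (fun a b : R => a + b) E1 E2).
have [[xT rx] [yT ry]] := (so_nHP _ gx, so_nHP _ gy).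
have := sum_cm_delta xT yT (so_star_tr0 C2 (conj xT rx)) (so_star_tr0 C2 (conj yT ry)).
have -> : 2 * (n + n)%:R - 4 = ((2 * (n + n)%:R - 4 : R))%:C%C :> C.
  by rewrite rmorphB rmorphM !rmorph_nat.
move=> /(congr1 (@complex.Re R)); rewrite Re_realM => E.
have -> : (2 * n - 2)%:R = 2^-1 * (2 * (n + n)%:R - 4) :> R.
  by rewrite natrB ?natrM ?natrD; [field | lia].
rewrite -mulrA -E raddf_sum mulr_sumr; apply: eq_bigr => i _.
by rewrite raddf_sum mulr_sumr.
Qed.

Lemma B_sigmaE : (0 < n)%N -> {in so_nH R n &, forall x y,
  B_sigma x y = (2 * n - 2)%:R * rtr x y}.
Proof.
move=> n0 x y gx gy; rewrite /B_sigma.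
have -> : cartan_involution y = - (dag y : G) by [].
have gdy := so_nH_dag gy.
rewrite killing_so_nH ?memvN //.
have -> : (x : M) *m (- (dag y : G) : M) = - ((x : M) *m dag y) by exact: mulmxN.
by rewrite /rtr linearN /= raddfN mulrN opprK.
Qed.

End SoStarAlgebra.

(** * The basis vectors as symmetrized wedges *)

Lemma wedge_ev (K : fieldType) n p q : wedge (@ev K n p) (@ev K n q) =
  \matrix_(a, b) (((a.+1 == p) && (b.+1 == q))%:R - ((a.+1 == q) && (b.+1 == p))%:R).
Proof.
by apply/matrixP => a b; rewrite !mxE !big_ord1 !mxE -!natrM !mulnb.
Qed.

Section BasisVectors.
Variables (K : fieldType) (cj : {rmorphism K -> K}) (n : nat).
Hypothesis cjK : involutive cj.
Variables (ii s : K).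
Hypotheses (ii2 : ii * ii = -1) (cj_ii : cj ii = - ii) (cj_s : cj s = s).
Hypothesis K2 : 2 != 0 :> K.
Implicit Types (e : K) (r j k : nat).
Local Notation W p q := (wedge (@ev K n p) (@ev K n q)).
Local Notation ev := (@ev K n).
Local Notation av := (@av K n ii).
Local Notation bv := (@bv K n ii).
Local Notation rsym := (rsym cj).
(** [F] stands for the elementary skew-symmetric matrices, so that the right-hand sides below take
    the shape of the bodies of the basis vectors. *)
Variable F : nat -> nat -> 'M[K]_(n + n).
Hypothesis FE : forall p q, W p q = F p q.

Let cj2 : cj 2^-1 = 2^-1. Proof. by rewrite fmorphV rmorph_nat. Qed.

Let rsym_aa c j k e : cj e = e -> (0 < j)%N -> (2 * j <= n)%N -> (0 < k)%N ->
  (2 * k <= n)%N -> rsym (c *: wedge (av 1 j) (av e k)) =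
  c *: wedge (av 1 j) (av e k) + cj c *: wedge (bv 1 j) (bv e k).
Proof.
move=> ce j0 jn k0 kn; rewrite /rsym rhoZ rho_wedge !(kap_av cj_ii) ?rmorph1 //.
by rewrite wedgeNl wedgeNr opprK.
Qed.

Let rsym_ab c j k e : cj e = e -> (0 < j)%N -> (2 * j <= n)%N -> (0 < k)%N ->
  (2 * k <= n)%N -> rsym (c *: wedge (av 1 j) (bv e k)) =
  c *: wedge (av 1 j) (bv e k) + cj c *: wedge (av e k) (bv 1 j).
Proof.
move=> ce j0 jn k0 kn; rewrite /rsym rhoZ rho_wedge (kap_av cj_ii) ?rmorph1 //.
by rewrite (kap_bv cj_ii) // wedgeNl -wedgeC.
Qed.

Let waa a e j k : a * e = e -> wedge (av a j) (av e k) =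
  W (2 * j - 1) (2 * k - 1) + (- (ii * e)) *: W (2 * j - 1) (2 * k)
  + (- (ii * a)) *: W (2 * j) (2 * k - 1) + (- e) *: W (2 * j) (2 * k).
Proof.
move=> ae; rewrite /av wedge_expand; have -> : - (ii * a) * - (ii * e) = - e => //.
by rewrite mulrNN mulrACA ii2 ae mulN1r.
Qed.

Let wbb a e j k : a * e = e -> wedge (bv a j) (bv e k) =
  W (n + 2 * j - 1) (n + 2 * k - 1) + (ii * e) *: W (n + 2 * j - 1) (n + 2 * k)
  + (ii * a) *: W (n + 2 * j) (n + 2 * k - 1) + (- e) *: W (n + 2 * j) (n + 2 * k).
Proof.
move=> ae; rewrite /bv wedge_expand; have -> : (ii * a) * (ii * e) = - e => //.
by rewrite mulrACA ii2 ae mulN1r.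
Qed.

Let wab a e f j k : a * e = f -> wedge (av a j) (bv e k) =
  W (2 * j - 1) (n + 2 * k - 1) + (ii * e) *: W (2 * j - 1) (n + 2 * k)
  + (- (ii * a)) *: W (2 * j) (n + 2 * k - 1) + f *: W (2 * j) (n + 2 * k).
Proof.
move=> ae; rewrite /av /bv wedge_expand; have -> : - (ii * a) * (ii * e) = f => //.
by rewrite mulNr mulrACA ii2 mulN1r opprK.
Qed.

Section Pair.
Variables (e : K) (j k : nat).
Hypotheses (ce : cj e = e) (e2 : e * e = 1).
Hypotheses (j0 : (0 < j)%N) (jn : (2 * j <= n)%N) (k0 : (0 < k)%N) (kn : (2 * k <= n)%N).

Lemma rsym_A : rsym (2^-1 *: wedge (av 1 j) (av e k)) = 2^-1 *:
  ((F (2*j-1) (2*k-1) - e *: F (2*j) (2*k)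
    + F (n+2*j-1) (n+2*k-1) - e *: F (n+2*j) (n+2*k))
   + ii *: (- (e *: F (2*j-1) (2*k)) - F (2*j) (2*k-1)
            + e *: F (n+2*j-1) (n+2*k) + F (n+2*j) (n+2*k-1))).
Proof.
rewrite -!FE rsym_aa // cj2 waa ?mul1r // wbb ?mul1r //.
move: (W _ _) (W _ _) (W _ _) (W _ _) (W _ _) (W _ _) (W _ _) (W _ _).
by move=> a b c d a' b' c' d'; apply/matrixP => x y; rewrite !mxE; ring.
Qed.

Let c1 : 2^-1 * (ii * e) * - (ii * e) = 2^-1.
Proof. by rewrite mulrN -mulrA mulrACA ii2 e2 mulr1 mulrN1 opprK. Qed.
Let c2 : 2^-1 * (ii * e) * - (ii * 1) = 2^-1 * e.
Proof. by rewrite mulrN -mulrA mulrACA ii2 mulr1 mulN1r mulrN opprK. Qed.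
Let c3 : 2^-1 * (ii * e) * - e = 2^-1 * - ii.
Proof. by rewrite mulrN -!mulrA e2 mulr1 mulrN. Qed.
Let d1 : 2^-1 * - (ii * e) * (ii * e) = 2^-1.
Proof. by rewrite -[RHS]c1; ring. Qed.
Let d2 : 2^-1 * - (ii * e) * (ii * 1) = 2^-1 * e.
Proof. by rewrite -[RHS]c2; ring. Qed.
Let d3 : 2^-1 * - (ii * e) * - e = 2^-1 * ii.
Proof.
have -> : 2^-1 * - (ii * e) * - e = - (2^-1 * (ii * e) * - e) by ring.
by rewrite c3 mulrN opprK.
Qed.
Let cjc : cj (2^-1 * (ii * e)) = 2^-1 * - (ii * e).
Proof. by rewrite !rmorphM cj2 cj_ii ce mulNr. Qed.
Let cjc' : cj (2^-1 * - (ii * e)) = 2^-1 * (ii * e).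
Proof. by rewrite rmorphM rmorphN rmorphM cj2 cj_ii ce mulNr opprK. Qed.

Lemma rsym_B : rsym ((2^-1 * (ii * e)) *: wedge (av 1 j) (av e k)) = 2^-1 *:
  ((F (2*j-1) (2*k) + e *: F (2*j) (2*k-1)
    + F (n+2*j-1) (n+2*k) + e *: F (n+2*j) (n+2*k-1))
   + ii *: (e *: F (2*j-1) (2*k-1) - F (2*j) (2*k)
            - e *: F (n+2*j-1) (n+2*k-1) + F (n+2*j) (n+2*k))).
Proof.
rewrite -!FE rsym_aa // cjc waa ?mul1r // wbb ?mul1r //.
move: (W _ _) (W _ _) (W _ _) (W _ _) (W _ _) (W _ _) (W _ _) (W _ _).
move=> a b c d a' b' c' d'; rewrite !scalerDr !scalerA c1 c2 c3 d1 d2 d3.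
by apply/matrixP => x y; rewrite !mxE; ring.
Qed.

Lemma rsym_C : rsym ((2^-1 * - (ii * e)) *: wedge (av 1 j) (bv e k)) = 2^-1 *:
  ((F (2*j-1) (n+2*k) - e *: F (2*j) (n+2*k-1)
    - e *: F (2*k-1) (n+2*j) + F (2*k) (n+2*j-1))
   + ii *: (- (e *: F (2*j-1) (n+2*k-1)) - F (2*j) (n+2*k)
            + e *: F (2*k-1) (n+2*j-1) + F (2*k) (n+2*j))).
Proof.
rewrite -!FE rsym_ab // cjc' (wab _ _ (mul1r e)) (wab _ _ (mulr1 e)).
have d2' : 2^-1 * - (ii * e) * - (ii * 1) = 2^-1 * - e.
  by rewrite mulrN d2 mulrN.
have d3' : 2^-1 * - (ii * e) * e = 2^-1 * - ii by rewrite -c3; ring.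
have c2' : 2^-1 * (ii * e) * (ii * 1) = 2^-1 * - e by rewrite mulrN -c2; ring.
have c3' : 2^-1 * (ii * e) * e = 2^-1 * ii by rewrite -d3; ring.
move: (W _ _) (W _ _) (W _ _) (W _ _) (W _ _) (W _ _) (W _ _) (W _ _).
move=> a b c d a' b' c' d'; 
rewrite !scalerDr !scalerA d1 d2' d3' c1 c2' c3'.
by apply/matrixP => x y; rewrite !mxE; ring.
Qed.

Lemma rsym_D : rsym (2^-1 *: wedge (av 1 j) (bv e k)) = 2^-1 *:
  ((F (2*j-1) (n+2*k-1) + F (2*k-1) (n+2*j-1)
    + e *: F (2*j) (n+2*k) + e *: F (2*k) (n+2*j))
   + ii *: (e *: F (2*j-1) (n+2*k) - F (2*j) (n+2*k-1)
            + F (2*k-1) (n+2*j) - e *: F (2*k) (n+2*j-1))).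
Proof.
rewrite -!FE rsym_ab // cj2 (wab _ _ (mul1r e)) (wab _ _ (mulr1 e)).
move: (W _ _) (W _ _) (W _ _) (W _ _) (W _ _) (W _ _) (W _ _) (W _ _).
by move=> a b c d a' b' c' d'; apply/matrixP => x y; rewrite !mxE; ring.
Qed.

End Pair.

Section Single.
Variable k : nat.
Hypotheses (k0 : (0 < k)%N) (kn : (2 * k <= n)%N).

Lemma rsym_G : rsym ((s * 2^-1) *: wedge (av 1 k) (bv 1 k)) = s *:
  ((F (2*k-1) (n+2*k-1) + F (2*k) (n+2*k))
   + ii *: (F (2*k-1) (n+2*k) - F (2*k) (n+2*k-1))).
Proof.
rewrite -!FE rsym_ab ?rmorph1 // rmorphM cj2 cj_s -scalerDr -mulr2n -scaler_nat scalerA.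
rewrite mulrC mulrCA mulfV // mulr1 (wab _ _ (mul1r 1)).
move: (W _ _) (W _ _) (W _ _) (W _ _).
by move=> a b c d; apply/matrixP => x y; rewrite !mxE; ring.
Qed.

Let wae r : wedge (av 1 k) (ev r) = W (2*k-1) r - ii *: W (2*k) r.
Proof. by rewrite /av wedgeDl wedgeZl mulr1 scaleNr. Qed.
Let wbe r : wedge (bv 1 k) (ev r) = W (n+2*k-1) r + ii *: W (n+2*k) r.
Proof. by rewrite /bv wedgeDl wedgeZl mulr1. Qed.

Let rsym_lo c : (0 < n)%N -> rsym (c *: wedge (av 1 k) (ev n)) =
  c *: (W (2*k-1) n - ii *: W (2*k) n)
  + cj c *: (W (n+2*k-1) (2*n) + ii *: W (n+2*k) (2*n)).
Proof.
move=> n0; rewrite /rsym rhoZ rho_wedge (kap_av cj_ii) ?rmorph1 // kap_ev_lo; last lia.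
have -> : (2 * n = n + n)%N by lia.
by rewrite wedgeNl wedgeNr opprK wae wbe.
Qed.

Let rsym_hi c : (0 < n)%N -> rsym (c *: wedge (av 1 k) (ev (n + n))) =
  c *: (W (2*k-1) (2*n) - ii *: W (2*k) (2*n))
  + cj c *: (W n (n+2*k-1) + ii *: W n (n+2*k)).
Proof.
move=> n0; rewrite /rsym rhoZ rho_wedge (kap_av cj_ii) ?rmorph1 // kap_ev_hi; last lia.
have -> : (2 * n = n + n)%N by lia.
rewrite wedgeNl -wedgeC wae; congr (_ + _ *: _).
by rewrite wedgeC wbe !(wedgeC (ev n)) scalerN -opprD.
Qed.

Let sii : cj (s * ii) = - (s * ii). Proof. by rewrite rmorphM cj_s cj_ii mulrN. Qed.
Let ii2' : s * ii * ii = - s. Proof. by rewrite -mulrA ii2 mulrN1. Qed.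

Lemma rsym_X : (0 < n)%N -> rsym ((s * ii) *: wedge (av 1 k) (ev n)) = s *:
  ((F (2*k) n + F (n+2*k) (2*n)) + ii *: (F (2*k-1) n - F (n+2*k-1) (2*n))).
Proof.
move=> n0; rewrite -!FE rsym_lo // sii.
move: (W _ _) (W _ _) (W _ _) (W _ _) => a b c d.
rewrite !scalerDr !scalerN !scalerA mulNr ii2'.
by apply/matrixP => x y; rewrite !mxE; ring.
Qed.

Lemma rsym_Y : (0 < n)%N -> rsym (s *: wedge (av 1 k) (ev n)) = s *:
  ((F (2*k-1) n + F (n+2*k-1) (2*n)) - ii *: (F (2*k) n - F (n+2*k) (2*n))).
Proof.
move=> n0; rewrite -!FE rsym_lo // cj_s; move: (W _ _) (W _ _) (W _ _) (W _ _).
by move=> a b c d; apply/matrixP => x y; rewrite !mxE; ring.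
Qed.

Lemma rsym_Z : (0 < n)%N -> rsym ((s * ii) *: wedge (av 1 k) (ev (n + n))) = s *:
  ((F (2*k) (2*n) + F n (n+2*k)) + ii *: (F (2*k-1) (2*n) - F n (n+2*k-1))).
Proof.
move=> n0; rewrite -!FE rsym_hi // sii.
move: (W _ _) (W _ _) (W _ _) (W _ _) => a b c d.
rewrite !scalerDr !scalerN !scalerA mulNr ii2'.
by apply/matrixP => x y; rewrite !mxE; ring.
Qed.

Lemma rsym_W : (0 < n)%N -> rsym (s *: wedge (av 1 k) (ev (n + n))) = s *:
  ((F (2*k-1) (2*n) + F n (n+2*k-1)) - ii *: (F (2*k) (2*n) - F n (n+2*k))).
Proof.
move=> n0; rewrite -!FE rsym_hi // cj_s; move: (W _ _) (W _ _) (W _ _) (W _ _).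
by move=> a b c d; apply/matrixP => x y; rewrite !mxE; ring.
Qed.

End Single.
Let dot_av e j r : (0 < r <= n + n)%N -> dot (av e j) (ev r) =
  (r == 2 * j - 1)%N%:R + (- (ii * e)) * (r == 2 * j)%N%:R.
Proof. by move=> hr; rewrite dotC /av dotDr dotZr !dot_ev. Qed.
Let dot_bv e j r : (0 < r <= n + n)%N -> dot (bv e j) (ev r) =
  (r == n + 2 * j - 1)%N%:R + (ii * e) * (r == n + 2 * j)%N%:R.
Proof. by move=> hr; rewrite dotC /bv dotDr dotZr !dot_ev. Qed.

Let nz k (c : K) : c != 0 -> (0 < k)%N -> (2 * k <= n)%N -> c *: av 1 k != 0.
Proof.
move=> c0 k0 kn; apply: contra c0 => /eqP/(congr1 (fun v : 'cV_(n + n) => dot v (ev (2 * k - 1)))).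
rewrite dotC dotZr dotC dot_av; last lia.
have -> : (2 * k - 1 == 2 * k)%N = false by lia.
rewrite eqxx mulr0 addr0 mulr1 => ->; rewrite dotC /dot mulmx0 mxE.
by [].
Qed.

(** Applied to the canonical vector of index 2k - 1, the matrix gives a nonzero multiple of
    [av 1 j]. *)
Lemma rsym_A_neq0 e j k : cj e = e -> (0 < j)%N -> (j < k)%N -> (2 * k <= n)%N ->
  rsym (2^-1 *: wedge (av 1 j) (av e k)) != 0.
Proof.
move=> ce j0 jk kn; have [jn k0] : (2 * j <= n)%N /\ (0 < k)%N by lia.
have c0 : 2^-1 != 0 :> K by rewrite invr_eq0.
apply: contra (nz c0 j0 jn) => /eqP/(congr1 (fun X : 'M_(n + n) => X *m ev (2 * k - 1))).
rewrite rsym_aa // mul0mx mulmxDl -!scalemxAl !wedge_mul !dot_av ?dot_bv; try lia.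
decide_neq.
rewrite eqxx !mulr0 !addr0 !scale0r !subr0 !scaler0 scale1r addr0 => ->.
by [].
Qed.

Lemma rsym_G_neq0 k : s != 0 -> (0 < k)%N -> (2 * k <= n)%N ->
  rsym ((s * 2^-1) *: wedge (av 1 k) (bv 1 k)) != 0.
Proof.
move=> s0 k0 kn; apply: contra (nz s0 k0 kn).
rewrite rsym_ab ?rmorph1 // rmorphM cj2 cj_s -scalerDr -mulr2n -scaler_nat scalerA.
rewrite mulrC mulrCA mulfV // mulr1 => /eqP/(congr1 (fun X : 'M_(n + n) => X *m ev (n + 2 * k - 1))).
rewrite mul0mx -scalemxAl wedge_mul !dot_av ?dot_bv; try lia.
decide_neq.
rewrite eqxx !mulr0 !addr0 !scale0r !subr0 scale1r => ->.
by [].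
Qed.

Lemma rsym_Y_neq0 k : s != 0 -> (0 < k)%N -> (2 * k < n)%N ->
  rsym (s *: wedge (av 1 k) (ev n)) != 0.
Proof.
move=> s0 k0 kn; have kn' : (2 * k <= n)%N by lia.
have dn : (0 < n <= n + n)%N by lia.
apply: contra (nz s0 k0 kn') => /eqP/(congr1 (fun X : 'M_(n + n) => X *m ev n)).
rewrite /rsym rhoZ rho_wedge (kap_av cj_ii) ?rmorph1 // kap_ev_lo; last lia.
rewrite wedgeNl wedgeNr opprK mul0mx mulmxDl -!scalemxAl !wedge_mul !dot_av ?dot_bv //.
decide_neq.
rewrite !dot_ev; try lia; have -> : (n + n == n)%N = false by lia.
rewrite eqxx !mulr0 !addr0 !scale0r !subr0 scaler0 scale1r addr0 => ->.
by [].
Qed.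

End BasisVectors.

(** * Specialization to the complex numbers *)

Section ComplexConstants.
Variable R : realType.
Local Notation C := R[i].
Local Notation cj := (@conjc R : {rmorphism C -> C}).
Local Notation ii := ('i%C : C).
Local Notation s := (((Num.sqrt 2)^-1)%:C%C : C).

Lemma conjc_invol : involutive cj. Proof. exact: conjcK. Qed.
Lemma two_neq0 : 2 != 0 :> C. Proof. by rewrite pnatr_eq0. Qed.
Lemma imag_sq : ii * ii = -1. Proof. by apply/eqP; rewrite eq_complex /= !(mul0r, mulr0, mulr1, addr0, sub0r, eqxx, oppr0). Qed.
Lemma conjc_imag : cj ii = - ii. Proof. by apply/eqP; rewrite eq_complex /= oppr0 !eqxx. Qed.
Lemma conjc_isqrt2 : cj s = s. Proof. exact: conjc_real. Qed.
Lemma isqrt2_sq : 2 * (s * s) = 1.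
Proof.
have E : 2 * ((Num.sqrt 2)^-1 * (Num.sqrt 2)^-1) = 1 :> R.
  by rewrite -invfM -expr2 sqr_sqrtr // mulfV // pnatr_eq0.
have -> : 2 = (2 : R)%:C%C :> C by rewrite rmorph_nat.
by rewrite -!rmorphM E rmorph1.
Qed.

End ComplexConstants.

Section ConcreteBasis.
Variables (R : realType) (n : nat).
Local Notation C := R[i].
Local Notation cj := (@conjc R : {rmorphism C -> C}).
Local Notation M := 'M[C]_(n + n).
Local Notation G := (gl R (n + n)).
Local Notation dag := (dag cj).
Local Notation ii := ('i%C : C).
Local Notation s := (((Num.sqrt 2)^-1)%:C%C : C).
Local Notation ev := (@ev C n).
Local Notation av := (@av C n ii).
Local Notation bv := (@bv C n ii).
Local Notation rsym := (rsym cj).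
Local Notation Hm := (@Hm C n ii s).
Implicit Types (e : C) (j k : nat) (A B x : G).

Let K2 := @two_neq0 R.
Let ii2 := @imag_sq R.
Let cji := @conjc_imag R.
Let cjs := @conjc_isqrt2 R.

Let EW p q : wedge (ev p) (ev q) = @E R n p q.
Proof. exact: wedge_ev. Qed.

Lemma vecH_Hm j : vecH R n j = Hm j.
Proof.
exact: (esym (f_equal2 (fun a b : M => (ii * s) *: (a - b)) (EW (2*j-1) (2*j))
  (EW (n+2*j-1) (n+2*j)))).
Qed.

Lemma vecA_rsym e j k : cj e = e -> (0 < j)%N -> (2 * j <= n)%N -> (0 < k)%N ->
  (2 * k <= n)%N -> vecA n e j k = rsym (2^-1 *: wedge (av 1 j) (av e k)).
Proof.
by move=> ce j0 jn k0 kn; apply: esym; apply: (rsym_A ii2 cji EW).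
Qed.

Lemma vecB_rsym e j k : e * e = 1 -> cj e = e -> (0 < j)%N -> (2 * j <= n)%N -> (0 < k)%N ->
  (2 * k <= n)%N -> vecB n e j k = rsym ((2^-1 * (ii * e)) *: wedge (av 1 j) (av e k)).
Proof.
by move=> e2 ce j0 jn k0 kn; apply: esym; apply: (rsym_B ii2 cji EW).
Qed.

Lemma vecC_rsym e j k : e * e = 1 -> cj e = e -> (0 < j)%N -> (2 * j <= n)%N -> (0 < k)%N ->
  (2 * k <= n)%N -> vecC n e j k = rsym ((2^-1 * - (ii * e)) *: wedge (av 1 j) (bv e k)).
Proof.
by move=> e2 ce j0 jn k0 kn; apply: esym; apply: (rsym_C ii2 cji EW).
Qed.

Lemma vecD_rsym e j k : cj e = e -> (0 < j)%N -> (2 * j <= n)%N -> (0 < k)%N ->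
  (2 * k <= n)%N -> vecD n e j k = rsym (2^-1 *: wedge (av 1 j) (bv e k)).
Proof.
by move=> ce j0 jn k0 kn; apply: esym; apply: (rsym_D ii2 cji EW).
Qed.

Lemma vecG_rsym k : (0 < k)%N -> (2 * k <= n)%N ->
  vecG R n k = rsym ((s * 2^-1) *: wedge (av 1 k) (bv 1 k)).
Proof.
by move=> k0 kn; apply: esym; apply: (rsym_G ii2 cji cjs K2 EW).
Qed.

Lemma vecX_rsym k : (0 < k)%N -> (2 * k <= n)%N ->
  vecX R n k = rsym ((s * ii) *: wedge (av 1 k) (ev n)).
Proof.
by move=> k0 kn; apply: esym; apply: (rsym_X ii2 cji cjs K2 EW) => //; lia.
Qed.

Lemma vecY_rsym k : (0 < k)%N -> (2 * k <= n)%N ->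
  vecY R n k = rsym (s *: wedge (av 1 k) (ev n)).
Proof.
by move=> k0 kn; apply: esym; apply: (rsym_Y cji cjs K2 EW) => //; lia.
Qed.

Lemma vecZ_rsym k : (0 < k)%N -> (2 * k <= n)%N ->
  vecZ R n k = rsym ((s * ii) *: wedge (av 1 k) (ev (n + n))).
Proof.
by move=> k0 kn; apply: esym; apply: (rsym_Z ii2 cji cjs K2 EW) => //; lia.
Qed.

Lemma vecW_rsym k : (0 < k)%N -> (2 * k <= n)%N ->
  vecW R n k = rsym (s *: wedge (av 1 k) (ev (n + n))).
Proof.
by move=> k0 kn; apply: esym; apply: (rsym_W cji cjs K2 EW) => //; lia.
Qed.

End ConcreteBasis.

(** * Weights and flags of the basis of n *)

Lemma mem_seq4 (T : eqType) (a b c d : T) :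
  [/\ a \in [:: a; b; c; d], b \in [:: a; b; c; d], c \in [:: a; b; c; d]
    & d \in [:: a; b; c; d]].
Proof. by rewrite !inE !eqxx !orbT. Qed.

Section RootVectors.
Variables (R : realType) (n : nat).
Local Notation C := R[i].
Local Notation cj := (@conjc R : {rmorphism C -> C}).
Local Notation G := (gl R (n + n)).
Local Notation dag := (dag cj).
Local Notation ii := ('i%C : C).
Local Notation s := (((Num.sqrt 2)^-1)%:C%C : C).
Local Notation ev := (@ev C n).
Local Notation av := (@av C n ii).
Local Notation bv := (@bv C n ii).
Local Notation rsym := (rsym cj).
Local Notation Hm := (@Hm C n ii s).
Local Notation Lm := (@Lm C n ii s).
Local Notation eps := (@eps C n).
Local Notation th := (theta cj Lm : G -> G).
Local Notation m := n./2.
Implicit Types (e : C) (A B x : G) (i j k : 'I_m) (v : G) (f : bool) (al : 'Hom(G, R^o)).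

Let cK := @conjc_invol R.
Let K2 := @two_neq0 R.
Let ii2 := @imag_sq R.
Let cji := @conjc_imag R.
Let cjs := @conjc_isqrt2 R.
Let s2 := @isqrt2_sq R.

Record root_vector v f al : Prop := RootVector {
  rv_so : v \in so_nH R n;
  rv_theta : th v = if f then - v else v;
  rv_weight : {in space_a R n, forall A, commutator A v = (al A : R) *: v};
  rv_root : al \in positive_roots R n }.

Lemma commutator_on_a v al :
  (forall j, commutator (vecH R n j.+1 : G) v = (al (vecH R n j.+1 : G) : R) *: v) ->
  {in space_a R n, forall A, commutator A v = (al A : R) *: v}.
Proof.
move=> H A /coord_span ->; rewrite linear_sum (lbr_suml (@commutator_lie R n)).
rewrite scaler_suml; apply: eq_bigr => j _.
rewrite linearZ (lbrZl (@commutator_lie R n)) basis_aE H scalerA.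
by [].
Qed.

Let ord_bounds (j : 'I_m) : [/\ (0 < j.+1)%N, (2 * j.+1 <= n)%N & (odd n -> (2 * j.+1 < n)%N)].
Proof. by have := ltn_ord j; split; lia. Qed.

(** The equation with [eps] compares the scalar of [theta_wedge] with the sign announced by the
    flag; the one before the action of L says that the weights of u and w add up to al. *)
Lemma root_vector_rsym (c la lb : C) (u w : 'cV[C]_(n + n)) (a b : 'I_m -> C) f al :
  (forall i : 'I_m, Hm i.+1 *m u = (a i * s) *: u) ->
  (forall i : 'I_m, Hm i.+1 *m w = (b i * s) *: w) ->
  (forall i, cj (a i) = a i) -> (forall i, cj (b i) = b i) ->
  (forall i : 'I_m, s * (a i + b i) = ((al (vecH R n i.+1 : G) : R)%:C)%C) ->
  Lm *m cjm cj u = la *: u -> Lm *m cjm cj w = lb *: w ->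
  eps * cj c * la * lb = (if f then -1 else 1) * c -> al \in positive_roots R n ->
  root_vector (rsym (c *: wedge u w)) f al.
Proof.
move=> Hu Hw ca cb Eal Lu Lw Ec pal; split=> //.
- by apply/so_nHP; apply: so_star_rsym.
- have ct : cj (if f then -1 else 1) = if f then -1 else 1.
    by case: (f); rewrite ?rmorphN rmorph1.
  have E := theta_rsym_wedge cK ii2 cji s2 cjs K2 Lu Lw Ec ct.
  apply: etrans E _; case: (f); [exact: scaleN1r | exact: scale1r].
apply: commutator_on_a => i; have [i0 iN _] := ord_bounds i.
rewrite vecH_Hm; have E := cm_Hm_rsym cji cjs c i0 iN (Hu i) (Hw i) (ca i) (cb i).
by apply: etrans E _; rewrite Eal vecH_Hm.
Qed.


Let e11 : 1 * 1 = 1 :> C. Proof. exact: mulr1. Qed.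
Let c1 : cj 1 = 1. Proof. exact: rmorph1. Qed.
Let c2 : cj 2^-1 = 2^-1. Proof. by rewrite fmorphV rmorph_nat. Qed.
Let sgn (sg : bool) : C := if sg then 1 else -1.
Let sgn2 sg : sgn sg * sgn sg = 1.
Proof. by case: sg; rewrite /sgn ?mulrNN mulr1. Qed.
Let csgn sg : cj (sgn sg) = sgn sg.
Proof. by case: sg; rewrite /sgn ?rmorphN rmorph1. Qed.

Definition pair_root (sg : bool) j k : 'Hom(G, R^o) :=
  if sg then omega R j + omega R k else omega R j - omega R k.

Let ev_omega j (i : 'I_m) :
  (omega R j (vecH R n i.+1 : G) : R) = (Num.sqrt 2)^-1 * (j == i)%:R.
Proof. exact: omegaE. Qed.

Let ev_pair_root sg j k (i : 'I_m) : (pair_root sg j k (vecH R n i.+1 : G) : R) =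
  (Num.sqrt 2)^-1 * ((i == j)%:R + (if sg then 1 else -1) * (i == k)%:R).
Proof.
rewrite /pair_root ![i == _]eq_sym.
case: sg; rewrite ?(add_lfunE, opp_lfunE) !ev_omega ?mulN1r ?mul1r ?mulrBr ?mulrDr //.
Qed.

Let toC (x y : R) : s * (x%:C + y%:C)%C = ((Num.sqrt 2)^-1 * (x + y))%:C%C.
Proof. by rewrite -rmorphD -rmorphM. Qed.

Lemma pair_root_mem sg j k : (j < k)%N -> pair_root sg j k \in positive_roots R n.
Proof.
move=> jk; have jk' : (j, k) \in ordered_pairs n by rewrite mem_filter jk mem_enum.
rewrite !mem_cat /pair_root; case: sg.
  by rewrite (map_f (fun jk => omega R jk.1 + omega R jk.2) jk').
by rewrite (map_f (fun jk => omega R jk.1 - omega R jk.2) jk') orbT.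
Qed.

Let wt j e (i : 'I_m) : C := (i == j)%:R * e.

Let wtE j e i : e * e = 1 -> Hm i.+1 *m av e j.+1 = (wt j e i * s) *: av e j.+1 /\
  Hm i.+1 *m bv e j.+1 = (wt j e i * s) *: bv e j.+1.
Proof.
have [[i0 iN _] [j0 jN _]] := (ord_bounds i, ord_bounds j).
move=> e2; split; have -> : wt j e i = (i.+1 == j.+1)%:R * e by [].
  exact: Hm_av.
exact: Hm_bv.
Qed.

Let wt_real j e : cj e = e -> forall i, cj (wt j e i) = wt j e i.
Proof. by move=> ce i; rewrite rmorphM rmorph_nat ce. Qed.

(** theta acts by eps * l 1 * l (sgn sg) on A and D, whose coefficients are real, and by the
    opposite on B and C, whose coefficients are imaginary. This scalar is 1 for n odd and minus the
    sign in omega_j +- omega_k for n even, which reproduces the flags. *)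
Lemma root_vector_pair sg j k vb : (j < k)%N -> vb \in flagged_pair R n sg j.+1 k.+1 ->
  root_vector vb.1 vb.2 (pair_root sg j k).
Proof.
move=> jk; have [[j0 jN _] [k0 kN _]] := (ord_bounds j, ord_bounds k).
have W i : s * (wt j 1 i + wt k (sgn sg) i) =
    ((pair_root sg j k (vecH R n i.+1 : G) : R)%:C)%C.
  rewrite ev_pair_root -toC /wt /sgn; congr (_ * (_ + _)).
    by rewrite mulr1 rmorph_nat.
  by case: sg; rewrite rmorphM ?rmorphN rmorph1 rmorph_nat mulrC.
have Hj i := wtE j i e11; have Hk i := wtE k i (sgn2 sg).
have La := Lm_av ii2 cji s2 K2 e11 c1 j0 jN.
have Lb := Lm_av ii2 cji s2 K2 (sgn2 sg) (csgn sg) k0 kN.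
have Lc := Lm_bv ii2 cji s2 K2 (sgn2 sg) (csgn sg) k0 kN.
have pal := pair_root_mem sg jk.
pose l e : C := if odd n then 1 else e.
have H c w f : (forall i, Hm i.+1 *m w = (wt k (sgn sg) i * s) *: w) ->
    Lm *m cjm cj w = l (sgn sg) *: w ->
    eps * cj c * l 1 * l (sgn sg) = (if f then -1 else 1) * c ->
    root_vector (rsym (c *: wedge (av 1 j.+1) w)) f (pair_root sg j k).
  move=> Hw Lw Ec; exact: (root_vector_rsym (fun i => proj1 (Hj i)) Hw
    (wt_real j c1) (wt_real k (csgn sg)) W La Lw Ec pal).
have Ha c f := H c _ f (fun i => proj1 (Hk i)) Lb.
have Hb c f := H c _ f (fun i => proj2 (Hk i)) Lc.
have simpl1 (c : C) f : cj c = c -> (if f then -1 else 1) = eps * l 1 * l (sgn sg) ->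
    eps * cj c * l 1 * l (sgn sg) = (if f then -1 else 1) * c.
  by move=> -> ->; ring.
have simpl2 (c : C) f : cj c = - c -> (if f then -1 else 1) = - (eps * l 1 * l (sgn sg)) ->
    eps * cj c * l 1 * l (sgn sg) = (if f then -1 else 1) * c.
  by move=> -> ->; ring.
have E1 : (if ~~ odd n && sg then -1 else 1) = eps * l 1 * l (sgn sg) :> C.
  rewrite /eps /l /sgn; case: (odd n) (sg) => [] [] /=; ring.
have E2 : (if odd n || ~~ sg then -1 else 1) = - (eps * l 1 * l (sgn sg)) :> C.
  rewrite /eps /l /sgn; case: (odd n) (sg) => [] [] /=; ring.
have cB : cj (2^-1 * (ii * sgn sg)) = - (2^-1 * (ii * sgn sg)).
  by rewrite !rmorphM c2 cji csgn !(mulNr, mulrN).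
have cC : cj (2^-1 * - (ii * sgn sg)) = - (2^-1 * - (ii * sgn sg)).
  by rewrite mulrN rmorphN cB.
have VA := vecA_rsym (csgn sg) j0 jN k0 kN.
have VB := vecB_rsym (sgn2 sg) (csgn sg) j0 jN k0 kN.
have VC := vecC_rsym (sgn2 sg) (csgn sg) j0 jN k0 kN.
have VD := vecD_rsym (csgn sg) j0 jN k0 kN.
rewrite !inE => /or4P[] /eqP ->.
- have := Ha _ _ (simpl1 _ _ c2 E1); rewrite -VA; exact.
- have := Ha _ _ (simpl2 _ _ cB E2); rewrite -VB; exact.
- have := Hb _ _ (simpl2 _ _ cC E2); rewrite -VC; exact.
- have := Hb _ _ (simpl1 _ _ c2 E1); rewrite -VD; exact.
Qed.

Lemma double_root_mem k : omega R k *+ 2 \in positive_roots R n.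
Proof.
rewrite !mem_cat (map_f (fun k => omega R k *+ 2)) ?mem_enum // !orbT.
by [].
Qed.

Lemma short_root_mem k : odd n -> omega R k \in positive_roots R n.
Proof. by move=> on; rewrite !mem_cat on map_f ?mem_enum // !orbT. Qed.

Lemma root_vector_G k : root_vector (vecG R n k.+1 : G) (~~ odd n) (omega R k *+ 2).
Proof.
have [k0 kN kO] := ord_bounds k.
have Hk i := wtE k i e11; have ck := wt_real k c1.
have La := Lm_av ii2 cji s2 K2 e11 c1 k0 kN.
have Lb := Lm_bv ii2 cji s2 K2 e11 c1 k0 kN.
have W i : s * (wt k 1 i + wt k 1 i) =
    (((omega R k *+ 2) (vecH R n i.+1 : G) : R)%:C)%C.
  have -> v : (omega R k *+ 2) v = (omega R k v : R) + omega R k v :> R.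
    by rewrite mulr2n add_lfunE.
  rewrite ev_omega -[_ + _ in RHS]mulrDr -toC /wt mulr1 eq_sym rmorph_nat.
  by [].
have Ec : eps * cj (s * 2^-1) * (if odd n then 1 else 1) * (if odd n then 1 else 1) =
    (if ~~ odd n then -1 else 1) * (s * 2^-1).
  by rewrite rmorphM cjs c2 /eps; case: (odd n); rewrite /=; ring.
have := root_vector_rsym (fun i => proj1 (Hk i)) (fun i => proj2 (Hk i)) ck ck W La Lb
  Ec (double_root_mem k).
rewrite -(vecG_rsym R k0 kN); exact.
Qed.

Lemma root_vector_short k vb : odd n -> vb \in behead (flagged_single R n k.+1) ->
  root_vector vb.1 vb.2 (omega R k).
Proof.
have [k0 kN kO] := ord_bounds k.
have Hk i := wtE k i e11; have ck := wt_real k c1.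
have La := Lm_av ii2 cji s2 K2 e11 c1 k0 kN.
rewrite /flagged_single => on; rewrite on -[behead _]/[:: _; _; _; _] => vbX.
have H c r f : (r == n) || (r == n + n)%N -> cj c = (if f then -1 else 1) * c ->
    root_vector (rsym (c *: wedge (av 1 k.+1) (ev r))) f (omega R k).
  move=> rn cc.
  have He i : Hm i.+1 *m ev r = (0 * s) *: ev r.
    have [i0 _ iO] := ord_bounds i.
    by rewrite (Hm_ev_odd _ _ i0 (iO on) rn) mul0r scale0r.
  have W i : s * (wt k 1 i + 0) = ((omega R k (vecH R n i.+1 : G) : R)%:C)%C.
    rewrite ev_omega -[(k == i)%:R]addr0 -toC /wt mulr1 eq_sym rmorph_nat.
    by [].
  have Ec : eps * cj c * (if odd n then 1 else 1) * 1 = (if f then -1 else 1) * c.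
    by rewrite /eps on !mulr1 mul1r.
  have c0 i : cj (0 : C) = 0 by rewrite rmorph0.
  exact: (root_vector_rsym (fun i => proj1 (Hk i)) He ck c0 W La
    (Lm_ev _ _ _ on rn) Ec (short_root_mem k on)).
have ct : cj s = (if false then -1 else 1) * s by rewrite mul1r.
have cf : cj (s * ii) = (if true then -1 else 1) * (s * ii).
  by rewrite rmorphM cjs cji mulrN mulN1r.
have rn : (n == n) || (n == n + n)%N by rewrite eqxx.
have rN : (n + n == n)%N || (n + n == n + n)%N by rewrite eqxx orbT.
move: vbX; rewrite !inE => /or4P[] /eqP ->.
- have := H _ _ true rn cf; rewrite -(vecX_rsym R k0 kN); exact.
- have := H _ _ false rn ct; rewrite -(vecY_rsym R k0 kN); exact.
- have := H _ _ true rN cf; rewrite -(vecZ_rsym R k0 kN); exact.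
- have := H _ _ false rN ct; rewrite -(vecW_rsym R k0 kN); exact.
Qed.

Lemma root_vector_single k vb : vb \in flagged_single R n k.+1 ->
  exists al, root_vector vb.1 vb.2 al.
Proof.
rewrite inE => /orP[/eqP ->|vbX]; first by exists (omega R k *+ 2); apply: root_vector_G.
exists (omega R k); apply: root_vector_short; first by move: vbX; case: ifP.
exact: vbX.
Qed.

Lemma mem_flagged_pair sg j k vb : (j < k)%N -> vb \in flagged_pair R n sg j.+1 k.+1 ->
  vb \in flagged_basis_n R n.
Proof.
move=> jk hv; rewrite mem_cat; apply/orP; left; apply/flattenP.
exists (flagged_pair R n true j.+1 k.+1 ++ flagged_pair R n false j.+1 k.+1).
  apply: (map_f (fun jk => flagged_pair R n true jk.1 jk.2 ++
    flagged_pair R n false jk.1 jk.2) (x := (j.+1, k.+1))).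
  rewrite mem_filter /= ltnS jk; apply/allpairsP; exists (j.+1, k.+1).
  by rewrite !mem_iota /= !add1n !ltnS !ltn_ord.
by rewrite mem_cat; case: sg hv => ->; rewrite ?orbT.
Qed.

Lemma mem_flagged_single k vb : vb \in flagged_single R n k.+1 ->
  vb \in flagged_basis_n R n.
Proof.
move=> hv; rewrite mem_cat; apply/orP; right; apply/flattenP.
exists (flagged_single R n k.+1) => //; apply: map_f.
by rewrite mem_iota /= add1n ltnS ltn_ord.
Qed.

Lemma root_vector_basis vb : vb \in flagged_basis_n R n ->
  exists al, root_vector vb.1 vb.2 al.
Proof.
rewrite mem_cat => /orP[] /flattenP[l /mapP[]].
  move=> [j k]; rewrite mem_filter => /andP[/= jk /allpairsP[[j' k'] /=]].
  rewrite !mem_iota => -[hj hk [Ej Ek]] -> {l}; move: j k jk Ej Ek => j k jk Ej Ek.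
  have [j1 k1] : (j.-1 < m)%N /\ (k.-1 < m)%N by lia.
  pose jo := Ordinal j1; pose ko := Ordinal k1.
  have [-> ->] : j = jo.+1 /\ k = ko.+1 by rewrite /=; lia.
  have jk' : (jo < ko)%N by rewrite /=; lia.
  have mem : vb \in flagged_pair R n true jo.+1 ko.+1 ++ flagged_pair R n false jo.+1 ko.+1 ->
    exists al, root_vector vb.1 vb.2 al; last exact: mem.
  rewrite mem_cat => /orP[] /(root_vector_pair jk') H.
    by exists (pair_root true jo ko).
  by exists (pair_root false jo ko).
move=> k; rewrite mem_iota => hk -> {l}.
have k1 : (k.-1 < m)%N by lia.
have -> : k = (Ordinal k1).+1 by rewrite /=; lia.
exact: root_vector_single.
Qed.


Let mem_pair sg (j k : nat) :
  [/\ (vecA n (sgn sg) j k : G, ~~ odd n && sg) \in flagged_pair R n sg j k,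
      (vecB n (sgn sg) j k : G, odd n || ~~ sg) \in flagged_pair R n sg j k,
      (vecC n (sgn sg) j k : G, odd n || ~~ sg) \in flagged_pair R n sg j k
    & (vecD n (sgn sg) j k : G, ~~ odd n && sg) \in flagged_pair R n sg j k].
Proof. exact: mem_seq4. Qed.

Let mem_short (k : nat) : odd n ->
  [/\ (vecX R n k : G, true) \in behead (flagged_single R n k),
      (vecY R n k : G, false) \in behead (flagged_single R n k),
      (vecZ R n k : G, true) \in behead (flagged_single R n k)
    & (vecW R n k : G, false) \in behead (flagged_single R n k)].
Proof. by move=> on; rewrite /flagged_single on; apply: mem_seq4. Qed.

Let s0 : s != 0.
Proof. by apply/eqP => E; move/eqP: s2; rewrite E mul0r mulr0 eq_sym oner_eq0. Qed.

(** Ensures that each simple root is the weight of a nonzero basis vector, so that conditions on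
    weights control the simple roots. *)
Lemma root_vector_ex al : al \in positive_roots R n ->
  exists vb, [/\ vb \in flagged_basis_n R n, vb.1 != 0 & root_vector vb.1 vb.2 al].
Proof.
have pair sg j k : (j < k)%N -> exists vb, [/\ vb \in flagged_basis_n R n, vb.1 != 0
    & root_vector vb.1 vb.2 (pair_root sg j k)].
  move=> jk; have [[j0 jN _] [k0 kN _]] := (ord_bounds j, ord_bounds k).
  have hv : (vecA n (sgn sg) j.+1 k.+1 : G, ~~ odd n && sg) \in flagged_pair R n sg j.+1 k.+1.
    exact: mem_head.
  exists (vecA n (sgn sg) j.+1 k.+1 : G, ~~ odd n && sg).
  split; [exact: mem_flagged_pair hv| |exact: root_vector_pair hv].
  rewrite /fst (vecA_rsym (csgn sg)) //; apply: rsym_A_neq0 => //.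
rewrite !mem_cat => /or4P[/mapP[[j k]]|/mapP[[j k]]|/mapP[k _ ->]|].
- by rewrite mem_filter => /andP[/= jk _] ->; apply: (pair true).
- by rewrite mem_filter => /andP[/= jk _] ->; apply: (pair false).
- have [k0 kN _] := ord_bounds k; exists (vecG R n k.+1 : G, ~~ odd n); split.
  + exact: mem_flagged_single (mem_head _ _).
  + rewrite /fst vecG_rsym //; apply: rsym_G_neq0 => //.
  + exact: root_vector_G.
case: ifP => // on /mapP[k _ ->]; have [k0 kN kO] := ord_bounds k.
have [_ hv _ _] := mem_short k.+1 on.
exists (vecY R n k.+1 : G, false); split; first exact: mem_flagged_single (mem_behead hv).
  rewrite /fst vecY_rsym //; apply: rsym_Y_neq0 => //; exact: kO.
exact: root_vector_short.
Qed.

(** Maximality of a in the Hermitian part of so(n, H); both completeness properties rest on it. *)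
Lemma hermitian_so_nH_eq0 x : x \in so_nH R n -> dag x = x ->
  {in basis_n R n, forall v, rtr v x = 0} -> {in space_a R n, forall A, rtr A x = 0} ->
  x = 0.
Proof.
move=> /so_nHP[xT xr] xd nx ax.
have real_orth v : rtr (v : G) x = 0 -> orth cj x v.
  rewrite (euclidean_sym (@rtr_euclidean R _)) /rtr /orth /real0.
  case: (\tr _) => a b /= ->.
  by apply/eqP; rewrite eq_complex /= !addr0 subrr eqxx.
have so vb : vb \in flagged_basis_n R n -> orth cj x vb.1.
  by move=> hv; apply/real_orth/nx/map_f.
have ordP (k : nat) : (0 < k)%N -> (2 * k <= n)%N -> exists k' : 'I_m, k = k'.+1.
  move=> k0 kN; have k1 : (k.-1 < m)%N by lia.
  by exists (Ordinal k1); rewrite /=; lia.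
apply: (symmetric_eq0 cK ii2 cji s2 cjs K2 xT xr xd).
- move=> e j k e2 ce j0 jk kN; have [jN k0] : (2 * j <= n)%N /\ (0 < k)%N by lia.
  have VA := vecA_rsym ce j0 jN k0 kN.
  have VB := vecB_rsym e2 ce j0 jN k0 kN.
  have VC := vecC_rsym e2 ce j0 jN k0 kN.
  have VD := vecD_rsym ce j0 jN k0 kN.
  have EC : ii * - e = - (ii * e) by rewrite mulrN.
  have [sg Ee] : exists sg, e = sgn sg.
    have : (e - 1) * (e + 1) = 0 by rewrite -subr_sqr expr2 e2 expr1n subrr.
    move/eqP; rewrite mulf_eq0 subr_eq0 addr_eq0 => /orP[]/eqP ->.
      by exists true.
    by exists false.
  have [[j' Ej] [k' Ek]] := (ordP _ j0 jN, ordP _ k0 kN).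
  have jk' : (j' < k')%N by move: jk; rewrite Ej Ek.
  have H v f : (v, f) \in flagged_pair R n sg j'.+1 k'.+1 -> orth cj x v.
    move=> hv; exact: (so (v, f) (mem_flagged_pair jk' hv)).
  have [mA mB mC mD] := mem_pair sg j'.+1 k'.+1.
  rewrite -Ee -Ej -Ek in mA mB mC mD H.
  have HA : orth cj x (vecA n e j k) := H _ _ mA.
  have HB : orth cj x (vecB n e j k) := H _ _ mB.
  have HC : orth cj x (vecC n e j k) := H _ _ mC.
  have HD : orth cj x (vecD n e j k) := H _ _ mD.
  rewrite VA in HA; rewrite VB in HB; rewrite VC in HC; rewrite VD in HD.
  rewrite EC; split; [exact: HA|exact: HB|exact: HC|exact: HD].
- move=> k k0 kN; have [k' Ek] := ordP _ k0 kN.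
  have := so (vecG R n k'.+1 : G, _) (mem_flagged_single (mem_head _ _)).
  by rewrite /fst -Ek (vecG_rsym R k0 kN); exact.
- move=> k k0 kN; have [k' Ek] := ordP _ k0 kN; rewrite -vecH_Hm Ek.
  by apply: real_orth; apply: ax; rewrite -basis_aE; apply/memv_span/mem_nth; rewrite size_tuple.
move=> k r on k0 kN rn; have [k' Ek] := ordP _ k0 kN.
have H v f : (v, f) \in behead (flagged_single R n k) -> orth cj x v.
  by rewrite Ek => hv; exact: (so (v, f) (mem_flagged_single (mem_behead hv))).
have [mX mY mZ mW] := mem_short k on.
have HX : orth cj x (vecX R n k) := H _ _ mX.
have HY : orth cj x (vecY R n k) := H _ _ mY.
have HZ : orth cj x (vecZ R n k) := H _ _ mZ.
have HW : orth cj x (vecW R n k) := H _ _ mW.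
rewrite (vecX_rsym R k0 kN) in HX; rewrite (vecY_rsym R k0 kN) in HY.
rewrite (vecZ_rsym R k0 kN) in HZ; rewrite (vecW_rsym R k0 kN) in HW.
by case/orP: rn => /eqP ->; split; [exact: HY|exact: HX|exact: HW|exact: HZ].
Qed.

End RootVectors.

(** * The real form k^theta + sqrt(-1) k^(-theta) *)

Section ComplexifiedForm.
Variables (R : realType) (V : vectType R) (br : V -> V -> V) (q : V -> V -> R).
Hypotheses (Lbr : lie_bracket br) (Eq : euclidean q).
Variable d : V -> V.
Hypotheses (d_lin : linear d) (dK : involutive d).
Hypothesis d_br : forall x y, d (br x y) = br (d y) (d x).
Hypothesis q_d : forall x y, q (d x) (d y) = q x y.
Hypothesis q_br : forall x y z, q (br x y) z = q y (br (d x) z).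
Variable th : V -> V.
Hypotheses (th_lin : linear th) (thK : involutive th).
Hypothesis th_br : forall x y, th (br x y) = br (th x) (th y).
Hypothesis q_th : forall x y, q (th x) (th y) = q x y.
Hypothesis th_d : forall x, th (d x) = d (th x).
Variables (k : {vspace V}) (kappa : R).
Hypothesis kappa_gt0 : 0 < kappa.
Hypothesis k_br : {in k &, forall x y, br x y \in k}.
Hypothesis k_d : {in k, forall x, d x \in k}.
Hypothesis k_th : {in k, forall x, th x \in k}.
Hypothesis k_killing : {in k &, forall x y, killing_form br k x y = kappa * q x (d y)}.

HB.instance Definition _ x :=
  GRing.isLinear.Build R V V *:%R (br x) (lbr_linr Lbr x).
HB.instance Definition _ x :=
  GRing.isLinear.Build R V R *%R (q x) (euclidean_lin Eq x).
HB.instance Definition _ := GRing.isLinear.Build R V V *:%R d d_lin.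
HB.instance Definition _ := GRing.isLinear.Build R V V *:%R th th_lin.

Implicit Types (x y z : V * V).
Let brC := complexified_bracket br.

(** The conjugate-linear extension of the adjoint: the scalar sqrt(-1) goes to its opposite. *)
Definition form_dag x : V * V := (d x.1, - d x.2).
Definition form_tau x : V * V := (x.1, - x.2).
Definition form_ip x y : R := kappa * (q x.1 y.1 + q x.2 y.2).

(* The real form k^th + sqrt(-1) k^(-th) of the complexification of k. *)
Definition in_form x : Prop :=
  [/\ x.1 \in k, x.2 \in k, th x.1 = x.1 & th x.2 = - x.2].
Definition real_form : {vspace V * V} := vspace_of in_form.

Let qC := euclidean_sym Eq.
Let brDl := lbrDl Lbr.
Let brZl := lbrZl Lbr.

Let pair_eq x y : x.1 = y.1 -> x.2 = y.2 -> x = y.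
Proof. by case: x y => a b [u v] /= -> ->. Qed.

Lemma mem_real_form x : x \in real_form <-> in_form x.
Proof.
apply: mem_vspace_of; first by split; rewrite ?mem0v ?linear0 ?oppr0.
move=> a {}x y [kx1 kx2 tx1 tx2] [ky1 ky2 ty1 ty2].
by split; rewrite ?memvD ?memvZ //= linearP /= ?tx1 ?tx2 ?ty1 ?ty2 // scalerN opprD.
Qed.

Let q_ext (u v : V) : (forall w, q w u = q w v) -> u = v.
Proof.
move=> E; apply/eqP; rewrite -subr_eq0; apply/eqP/(eucl_eq0 Eq).
by rewrite linearB /= E subrr.
Qed.

Let brNl (u v : V) : br (- u) v = - br u v.
Proof. by rewrite -scaleN1r brZl scaleN1r. Qed.
Let brNr (u v : V) : br u (- v) = - br u v. Proof. exact: linearN. Qed.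
Let brDr (u v w : V) : br u (v + w) = br u v + br u w. Proof. exact: linearD. Qed.
Let br0 (u : V) : br u 0 = 0. Proof. exact: linear0. Qed.
Let dN (u : V) : d (- u) = - d u. Proof. exact: linearN. Qed.
Let dD (u v : V) : d (u + v) = d u + d v. Proof. exact: linearD. Qed.
Let thN (u : V) : th (- u) = - th u. Proof. exact: linearN. Qed.
Let thD (u v : V) : th (u + v) = th u + th v. Proof. exact: linearD. Qed.
Let thZ s (u : V) : th (s *: u) = s *: th u. Proof. exact: linearZ. Qed.
Let qN (u v : V) : q u (- v) = - q u v. Proof. exact: linearN. Qed.
Let qNl (u v : V) : q (- u) v = - q u v. Proof. by rewrite qC qN qC. Qed.
Let qD (u v w : V) : q u (v + w) = q u v + q u w. Proof. exact: linearD. Qed.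
Let qZ s (u v : V) : q u (s *: v) = s * q u v. Proof. exact: linearZ. Qed.
Let q0 (u : V) : q u 0 = 0. Proof. exact: linear0. Qed.
Let q0l (u : V) : q 0 u = 0. Proof. by rewrite qC q0. Qed.

Lemma complexified_lie : lie_bracket brC.
Proof.
have linl y : linear (brC^~ y).
  move=> a u v; apply: pair_eq => /=; rewrite !brDl !brZl scalerDr ?scalerN.
    by rewrite opprD addrACA.
  by rewrite addrACA.
have anti x y : brC x y = - brC y x.
  apply: pair_eq => /=; rewrite !(lbr_anti Lbr y.1) !(lbr_anti Lbr y.2).
    by rewrite opprD !opprK.
  by rewrite opprD !opprK addrC.
split=> // [x a y z|x|x y z].
- by rewrite anti linl opprD -scalerN -!anti.
- by apply: pair_eq => /=; rewrite ?(lbr_alt Lbr) ?subrr // (lbr_anti Lbr) addNr.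
have L a b c := lbr_leibniz Lbr a b c.
apply: pair_eq => /=; rewrite !brDr !brNr !brDl !brNl.
  rewrite (L x.1 y.1 z.1) (L x.1 y.2 z.2) (L x.2 y.1 z.2) (L x.2 y.2 z.1).
  (* Pairing with an arbitrary vector turns the identity into a scalar one. *)
  by apply: q_ext => u; rewrite !(qD, qN); ring.
rewrite (L x.1 y.1 z.2) (L x.1 y.2 z.1) (L x.2 y.1 z.1) (L x.2 y.2 z.2).
by apply: q_ext => u; rewrite !(qD, qN); ring.
Qed.

Lemma form_ip_euclidean : euclidean form_ip.
Proof.
split=> [x a y z|x y|x x0]; rewrite /form_ip /=.
- by rewrite !linearP /=; ring.
- by rewrite (qC x.1) (qC x.2).
have ge0 u : 0 <= q u u.
  by have [->|/(euclidean_pos Eq)/ltW//] := eqVneq u 0; rewrite q0.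
rewrite pmulr_rgt0 // lt_neqAle addr_ge0 ?ge0 // andbT; apply: contra x0.
rewrite eq_sym paddr_eq0 // => /andP[/eqP/(eucl_eq0 Eq) E1 /eqP/(eucl_eq0 Eq) E2].
by apply/eqP/pair_eq.
Qed.

Lemma form_dag_lin : linear form_dag.
Proof. by move=> a x y; apply: pair_eq; rewrite /= linearP // opprD scalerN. Qed.

Lemma form_dagK : involutive form_dag.
Proof. by move=> x; apply: pair_eq; rewrite /= ?dN ?opprK dK. Qed.

Lemma form_dag_br x y : form_dag (brC x y) = brC (form_dag y) (form_dag x).
Proof.
apply: pair_eq; rewrite /= !dD ?dN !d_br !(brNl, brNr).
  by rewrite opprK.
by rewrite addrC opprD.
Qed.

Lemma form_ip_dag x y : form_ip (form_dag x) (form_dag y) = form_ip x y.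
Proof.
by rewrite /form_ip /= !(qN, qNl) opprK !q_d.
Qed.

Lemma form_ip_br x y z : form_ip (brC x y) z = form_ip y (brC (form_dag x) z).
Proof.
rewrite /form_ip /= !(euclDl Eq) qNl !brNl !(qD, qN) -!q_br.
ring.
Qed.

Lemma form_tau_lin : linear form_tau.
Proof. by move=> a x y; apply: pair_eq; rewrite //= opprD scalerN. Qed.

Lemma form_tauK : involutive form_tau.
Proof. by move=> x; apply: pair_eq; rewrite /= ?opprK. Qed.

Lemma form_tau_br x y : form_tau (brC x y) = brC (form_tau x) (form_tau y).
Proof.
by apply: pair_eq; rewrite /= !(brNl, brNr) ?opprK // opprD.
Qed.

Lemma form_ip_tau x y : form_ip (form_tau x) (form_tau y) = form_ip x y.
Proof. by rewrite /form_ip /= qN qNl opprK. Qed.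

Lemma real_form_br : {in real_form &, forall x y, brC x y \in real_form}.
Proof.
move=> x y /mem_real_form[kx1 kx2 tx1 tx2] /mem_real_form[ky1 ky2 ty1 ty2].
apply/mem_real_form; split; rewrite /= ?memvB ?memvD ?k_br //.
  by rewrite thD thN !th_br tx1 tx2 ty1 ty2 brNr brNl opprK.
by rewrite thD !th_br tx1 tx2 ty1 ty2 brNr brNl opprD.
Qed.

Lemma real_form_dag : {in real_form, forall x, form_dag x \in real_form}.
Proof.
move=> x /mem_real_form[kx1 kx2 tx1 tx2]; apply/mem_real_form.
split; rewrite /= ?memvN ?k_d // ?thN th_d ?tx1 // tx2 dN //.
Qed.

Lemma real_form_tau : {in real_form, forall x, form_tau x \in real_form}.
Proof.
move=> x /mem_real_form[kx1 kx2 tx1 tx2]; apply/mem_real_form.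
by split; rewrite /= ?memvN // thN tx2.
Qed.

(** First and second components lie in opposite eigenspaces of the isometry th, so the cross terms
    vanish. *)
Lemma real_form_fold : {in real_form &, forall x y,
  kappa * q (x.1 + x.2) (y.1 + y.2) = form_ip x y}.
Proof.
move=> x y /mem_real_form[_ _ tx1 tx2] /mem_real_form[_ _ ty1 ty2].
have E (u v : V) : q u v = - q u v -> q u v = 0 by lra.
have E1 : q x.1 y.2 = 0 by apply: E; rewrite -{1}q_th tx1 ty2 qN.
have E2 : q x.2 y.1 = 0 by apply: E; rewrite -{1}q_th tx2 ty1 qNl.
by rewrite /form_ip !(euclDl Eq) !qD E1 E2 addr0 add0r.
Qed.

(** For s = 1 or -1, the orthogonal projection onto the s-eigenspace of th. *)
Let half (s : R) (u : V) : V := 2^-1 *: (u + s *: th u).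

Let th_half s u : s * s = 1 -> th (half s u) = s *: half s u.
Proof.
move=> s2; rewrite /half thZ thD thZ thK [RHS]scalerA mulrC -scalerA; congr (_ *: _).
by rewrite scalerDr scalerA s2 scale1r addrC.
Qed.

Let k_half s u : u \in k -> half s u \in k.
Proof. by move=> ku; rewrite memvZ // memvD // memvZ // k_th. Qed.

Let half_id s u : s * s = 1 -> th u = s *: u -> half s u = u.
Proof.
move=> s2 tu; rewrite /half tu scalerA s2 scale1r -[u in u + _]scale1r.
by rewrite -{2}[u]scale1r -scalerDl scalerA mulVf ?scale1r // pnatr_eq0.
Qed.

Let q_half s u v : s * s = 1 -> q (half s u) v = q u (half s v).
Proof.
move=> s2; rewrite /half (euclZl Eq) (euclDl Eq) (euclZl Eq) qZ qD qZ.
by rewrite -(q_th u (th v)) thK.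
Qed.

Let eigen (s : R) : {vspace V} := vspace_of (fun u => u \in k /\ th u = s *: u).
Let eigenP (s : R) (u : V) : u \in eigen s <-> u \in k /\ th u = s *: u.
Proof.
apply: mem_vspace_of; first by rewrite mem0v linear0 scaler0.
move=> a x y [kx tx] [ky ty]; rewrite memvD ?memvZ // linearP /= tx ty.
by rewrite scalerDr !scalerA mulrC.
Qed.

Let eigen_frame s F : s * s = 1 -> frame q k F -> frame q (eigen s) (map (half s) F).
Proof.
move=> s2 [Fk FE]; have half_lin : linear (half s).
  move=> a u v; rewrite /half thD thZ.
  by apply: q_ext => w; rewrite !(qZ, qD); ring.
split=> [_ /mapP[e Fe ->]|u /eigenP[ku tu]].
  by apply/eigenP; rewrite k_half ?Fk // th_half.
rewrite big_map -{1}(half_id s2 tu) (linear_frame half_lin (conj Fk FE)) //.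
by apply: eq_bigr => e _; rewrite q_half // (half_id s2 tu).
Qed.

Let eigen_split F : frame q k F -> frame q k (map (half 1) F ++ map (half (-1)) F).
Proof.
move=> FF; have s1 : 1 * 1 = 1 :> R by rewrite mulr1.
have s2 : -1 * -1 = 1 :> R by rewrite mulrNN mulr1.
have -> : k = (eigen 1 + eigen (-1))%VS.
  apply/eqP; rewrite eqEsubv; apply/andP; split; last first.
    by rewrite subv_add; apply/andP; split; apply/subvP => u /eigenP[].
  apply/subvP => u ku; have -> : u = half 1 u + half (-1) u.
    by apply: q_ext => w; rewrite /half !(qD, qZ); field.
  by apply: memv_add; apply/eigenP; rewrite k_half // th_half.
apply: frame_cat; [by []|exact: eigen_frame|exact: eigen_frame|].
move=> u v /eigenP[_ tu] /eigenP[_ tv]; rewrite -[u in q u](half_id s1 tu) q_half //.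
by rewrite /half tv scalerA mul1r scaleN1r subrr scaler0 q0.
Qed.

(** Let P and M be frames of the two eigenspaces of th. The vectors (e, 0) for e in P and (0, e) for
    e in M frame the real form. On both kinds ad x ad y acts diagonally as br x.1 (br y.1 e) - br
    x.2 (br y.2 e), and P ++ M frames k, so the trace is a difference of two Killing forms of k. *)
Lemma killing_real_form : {in real_form &, forall x y,
  killing_form brC real_form x y = form_ip x (form_dag y)}.
Proof.
move=> x y gx gy; have [F FF] := frame_ex Eq k.
have s1 : 1 * 1 = 1 :> R by rewrite mulr1.
have s2 : -1 * -1 = 1 :> R by rewrite mulrNN mulr1.
have [P1 PE] := eigen_frame s1 FF; have [M1 ME] := eigen_frame s2 FF.
have kF := eigen_split FF.
have /mem_real_form[kx1 kx2 _ _] := gx; have /mem_real_form[ky1 ky2 _ _] := gy.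
set P := map (half 1) F in P1 PE kF; set M := map (half (-1)) F in M1 ME kF.
clearbody P M.
have kill u v : u \in k -> v \in k ->
    kappa * q u (d v) = \sum_(e <- P ++ M) q e (br u (br v e)).
  move=> ku kv; rewrite -k_killing // /killing_form (trace_on_frame Eq kF) //.
    exact: lbr_linear_comp.
  by move=> z kz; rewrite !k_br.
pose Q0 x y := q x.1 y.1 + q x.2 y.2.
have EQ0 : euclidean Q0.
  split=> [v a u w|v u|v v0].
  - by rewrite /Q0 /= !linearP /=; ring.
  - by rewrite /Q0 (qC v.1) (qC v.2).
  by have := euclidean_pos form_ip_euclidean v0; rewrite pmulr_rgt0.
have FG : frame Q0 real_form (map (fun e => (e, 0)) P ++ map (fun e => (0, e)) M).
  split=> [z|z /mem_real_form[kz1 kz2 tz1 tz2]].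
    rewrite mem_cat => /orP[]/mapP[e /= he ->]; apply/mem_real_form.
      by have /eigenP[ke te] := P1 e he; split; rewrite ?mem0v ?linear0 ?oppr0 // te scale1r.
    by have /eigenP[ke te] := M1 e he; split; rewrite ?mem0v ?linear0 // te scaleN1r.
  rewrite big_cat !big_map /=.
  have sum1 r (f : V -> V * V) : (\sum_(e <- r) f e).1 = \sum_(e <- r) (f e).1.
    exact: (big_morph (fun z => z.1)).
  have sum2 r (f : V -> V * V) : (\sum_(e <- r) f e).2 = \sum_(e <- r) (f e).2.
    exact: (big_morph (fun z => z.2)).
  apply: pair_eq; rewrite /= ?sum1 ?sum2 /Q0 /=.
    rewrite [X in _ + X]big1 ?addr0 => [|e _]; last by rewrite scaler0.
    rewrite {1}(PE z.1); first by apply: eq_bigr => e _; rewrite q0l addr0.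
    by apply/eigenP; rewrite scale1r.
  rewrite [X in X + _]big1 ?add0r => [|e _]; last by rewrite scaler0.
  rewrite {1}(ME z.2); first by apply: eq_bigr => e _; rewrite q0l add0r.
  by apply/eigenP; rewrite scaleN1r.
rewrite /killing_form (trace_on_frame EQ0 FG); first last.
- by move=> z gz; rewrite !real_form_br.
- exact: (lbr_linear_comp complexified_lie).
rewrite big_cat !big_map /= /Q0 /= /form_ip /= qN mulrDr mulrN !kill //.
rewrite !big_cat /= opprD addrACA; congr (_ + _); rewrite -sumrB; apply: eq_bigr => e _.
  by rewrite !(q0l, br0, subr0, addr0, add0r, qD, qN).
by rewrite !(q0l, br0, oppr0, subr0, sub0r, addr0, add0r, qD, qN, brNr).
Qed.


Variables (a : {vspace V}) (L : seq (V * bool)).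
Hypotheses (a_d : {in a, forall A, d A = A}) (a_th : {in a, forall A, th A = A}).
Hypotheses (a_k : {subset a <= k}) (a_abel : {in a &, forall A B, br A B = 0}).
Hypothesis L_k : {in L, forall vb, vb.1 \in k}.
Hypothesis L_th : {in L, forall vb, th vb.1 = if vb.2 then - vb.1 else vb.1}.
Hypothesis L_weight : {in L & a, forall vb A, exists t, br A vb.1 = t *: vb.1}.
Hypothesis L_complete : {in k, forall u, d u = u ->
  {in L, forall vb, q vb.1 u = 0} -> {in a, forall A, q A u = 0} -> u = 0}.

(** Split 2u into its antisymmetric part x and its symmetric part y. Then [A, x] and [A, [A, y]] are
    symmetric and orthogonal to L and a, hence zero; since ad A is self-adjoint, [A, y] = 0 as
    well. *)
Let complete u : u \in k -> {in L, forall vb, q vb.1 u = 0 /\ q (d vb.1) u = 0} ->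
  {in a, forall A, br A u = 0}.
Proof.
move=> ku Lu A aA; have dA := a_d aA; have kA := a_k aA.
have brA v w : q v (br A w) = q (br A v) w by rewrite q_br dA.
have L_br w : {in L, forall vb, q vb.1 w = 0} -> {in L, forall vb, q vb.1 (br A w) = 0}.
  by move=> Lw vb Lvb; rewrite brA; have [t ->] := L_weight Lvb aA; rewrite (euclZl Eq) Lw ?mulr0.
have a_br w : {in a, forall B, q B (br A w) = 0}.
  by move=> B aB; rewrite brA a_abel // q0l.
have kdu := k_d ku; pose x := u - d u; pose y := u + d u.
have Lx : {in L, forall vb, q vb.1 x = 0}.
  by move=> vb Lvb; have [E1 E2] := Lu vb Lvb; rewrite qD qN -(q_d _ (d u)) dK E1 E2 subrr.
have Ly : {in L, forall vb, q vb.1 y = 0}.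
  by move=> vb Lvb; have [E1 E2] := Lu vb Lvb; rewrite qD -(q_d _ (d u)) dK E1 E2 addr0.
have x0 : br A x = 0.
  apply: L_complete; [by rewrite k_br ?memvB| |exact: L_br|exact: a_br].
  by rewrite d_br dA dD dN dK -opprB brNl -(lbr_anti Lbr).
have dy : d (br A y) = - br A y.
  by rewrite d_br dA dD dK [d u + u]addrC (lbr_anti Lbr).
have y0 : br A y = 0.
  apply: (eucl_eq0 Eq); rewrite -brA.
  suff -> : br A (br A y) = 0 by rewrite q0.
  apply: L_complete; [by rewrite !k_br ?memvD| |exact/L_br/L_br|exact: a_br].
  by rewrite d_br dA dy brNl -(lbr_anti Lbr).
have : br A (x + y) = 0 by rewrite brDr x0 y0 addr0.
have -> : x + y = 2%:R *: u by rewrite /x /y addrAC addrA addrK scaler_nat.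
rewrite linearZ => /eqP.
by rewrite scaler_eq0 pnatr_eq0 /= => /eqP.
Qed.

Definition form_emb (vb : V * bool) : V * V :=
  if vb.2 then mul_sqrtm1 (to_complexified vb.1) else to_complexified vb.1.
Let LL : seq (V * V) := [seq v <- map form_emb L | v != 0].

Let embE vb : form_emb vb = if vb.2 then (0, vb.1) else (vb.1, 0).
Proof. by rewrite /form_emb /mul_sqrtm1 /= oppr0. Qed.

Lemma form_emb_mem : {in L, forall vb, form_emb vb \in real_form}.
Proof.
move=> vb Lvb; apply/mem_real_form; rewrite embE; have := L_th Lvb; have := L_k Lvb.
by case: (vb.2) => kv tv; split; rewrite /= ?mem0v ?linear0 ?oppr0.
Qed.

(* vb.1 and the other component of x are in opposite eigenspaces of th. *)
Let q_emb vb x : vb \in L -> x \in real_form -> form_ip (form_emb vb) x = 0 ->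
  q vb.1 x.1 = 0 /\ q vb.1 x.2 = 0.
Proof.
move=> Lvb /mem_real_form[_ _ tx1 tx2]; have := L_th Lvb.
have E v (u : V) : q v u = - q v u -> q v u = 0 by lra.
rewrite embE /form_ip; case: (vb.2) => tv /= /eqP.
  rewrite q0l add0r mulf_eq0 gt_eqF // => /eqP q2; split=> //.
  by apply: E; rewrite -{1}q_th tv tx1 qNl.
rewrite q0l addr0 mulf_eq0 gt_eqF // => /eqP q1; split=> //.
by apply: E; rewrite -{1}q_th tv tx2 qN.
Qed.

Let LLP (P : V * V -> Prop) : P 0 -> {in LL, forall v, P v} -> {in L, forall vb, P (form_emb vb)}.
Proof.
move=> P0 PL vb Lvb; have [->//|v0] := eqVneq (form_emb vb) 0.
by apply: PL; rewrite mem_filter v0 map_f.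
Qed.

(** By [q_emb], orthogonality in the real form passes to both components of x, and [complete]
    applies to each. *)
Lemma real_form_complete : {in real_form, forall x,
  {in LL, forall v, form_ip v x = 0 /\ form_ip (form_dag v) x = 0} ->
  {in a, forall A, brC (to_complexified A) x = 0}}.
Proof.
move=> x gx Lx A aA; have /mem_real_form[kx1 kx2 _ _] := gx.
have Q0 y : form_ip 0 y = 0 by rewrite /form_ip /= !q0l addr0 mulr0.
have dag0 : form_dag 0 = 0 by apply: pair_eq; rewrite /= linear0 ?oppr0.
have H : {in L, forall vb, (q vb.1 x.1 = 0 /\ q (d vb.1) x.1 = 0) /\
    (q vb.1 x.2 = 0 /\ q (d vb.1) x.2 = 0)}.
  move=> vb Lvb; have [|E1 E2] := LLP _ Lx Lvb; first by rewrite dag0 Q0.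
  have E3 : form_ip (form_emb vb) (form_dag x) = 0 by rewrite -form_ip_dag form_dagK.
  have [F1 F2] := q_emb Lvb gx E1; have [F3 F4] := q_emb Lvb (real_form_dag gx) E3.
  split; split=> //; first by rewrite -(dK x.1) q_d.
  by rewrite -(dK x.2) q_d -[d x.2]opprK qN F4 oppr0.
have [c1 c2] : br A x.1 = 0 /\ br A x.2 = 0.
  by split; apply: complete => // vb /H[].
by apply: pair_eq; rewrite /= ?c1 ?c2 ?(lbr_anti Lbr 0) !br0 ?oppr0 ?subr0 ?addr0.
Qed.

(** Being fixed by [form_tau] kills the second component; completeness of k applies to the first. *)
Lemma real_form_complete_sym : {in real_form, forall x, form_dag x = x -> form_tau x = x ->
  {in LL, forall v, form_ip v x = 0} ->
  {in a, forall A, form_ip (to_complexified A) x = 0} -> x = 0}.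
Proof.
move=> x gx dx tx Lx ax; have /mem_real_form[kx1 kx2 _ _] := gx.
have Q0 y : form_ip 0 y = 0 by rewrite /form_ip /= !q0l addr0 mulr0.
have x2 : x.2 = 0.
  have /eqP := congr1 snd tx; rewrite /= eq_sym -addr_eq0 -mulr2n -scaler_nat.
  by rewrite scaler_eq0 pnatr_eq0 /= => /eqP.
apply: pair_eq => //=; apply: L_complete => // [|vb Lvb|A aA].
- by rewrite -{2}dx.
- have E1 := LLP _ Lx Lvb; by case: (q_emb Lvb gx (E1 (Q0 x))).
have /eqP := ax A aA; rewrite /form_ip /= x2 q0 addr0 mulf_eq0 gt_eqF //.
by move=> /eqP.
Qed.

End ComplexifiedForm.

Lemma mem_span_complexified (R : realType) (V : vectType R) (X : seq V) (x : V * V) :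
  x \in <<map (@to_complexified R V) X>>%VS <-> x.1 \in <<X>>%VS /\ x.2 = 0.
Proof.
split; last first.
  case: x => u _ [/= Xu ->]; move: u Xu.
  apply: span_ind => [|a x y Ex Ey|v Xv]; first exact: mem0v.
    have -> : (a *: x + y, 0) = a *: (x, 0) + (y, 0) :> V * V.
      by congr (_, _); rewrite /= scaler0 addr0.
    by rewrite memvD ?memvZ.
  exact/memv_span/(map_f (@to_complexified R V)).
move: x; apply: span_ind => [|a x y [x1 x2] [y1 y2]|_ /mapP[v Xv ->]].
- by rewrite mem0v.
- by rewrite memvD ?memvZ //= x2 y2 scaler0 addr0.
by rewrite memv_span.
Qed.

(** * Positive roots, simple roots and the dual basis *)

Section Roots.
Variables (R : realType) (n : nat).
Local Notation G := (gl R (n + n)).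
Local Notation m := n./2.
Implicit Types (al be ga : 'Hom(G, R^o)) (A : G) (i j k : 'I_m).

(** Chosen so that omega_j takes the value m - j, with j counted from 0: decreasing positive
    integers, hence every positive root takes a positive integer value. *)
Definition height_vector : G :=
  Num.sqrt 2 *: \sum_(k < m) ((m - k)%:R : R) *: (vecH R n k.+1 : G).

Lemma height_vector_a : height_vector \in space_a R n.
Proof.
apply/memvZ/memv_suml => k _; apply: memvZ.
by rewrite -basis_aE; apply/memv_span/mem_nth; rewrite size_tuple.
Qed.

Lemma omega_height j : (omega R j height_vector : R) = (m - j)%:R.
Proof.
rewrite /height_vector linearZ linear_sum /= (bigD1 j) //= big1 => [|k kj].
  rewrite linearZ /= omegaE eqxx mulr1 addr0.
  have s0 : Num.sqrt 2 != 0 :> R by rewrite gt_eqF // sqrtr_gt0.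
  by rewrite [LHS]mulrCA mulfV // mulr1.
by rewrite linearZ /= omegaE eq_sym (negPf kj) mulr0 scaler0.
Qed.

Lemma root_height al : al \in positive_roots R n ->
  exists2 N, (0 < N)%N & (al height_vector : R) = N%:R.
Proof.
have jm j : (0 < m - j)%N by rewrite subn_gt0.
rewrite !mem_cat => /or4P[/mapP[[j k]]|/mapP[[j k]]|/mapP[k _ ->]|].
- rewrite mem_filter => /andP[/= jk _] ->; exists (m - j + (m - k))%N.
    by rewrite addn_gt0 jm.
  by rewrite add_lfunE !omega_height natrD.
- rewrite mem_filter => /andP[/= jk _] ->; exists (k - j)%N; first by rewrite subn_gt0.
  rewrite add_lfunE opp_lfunE !omega_height [LHS](_ : _ = (m - j)%:R - (m - k)%:R) //.
  rewrite -natrB; first by congr (_%:R); have := ltn_ord k; lia.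
  by apply: leq_sub2l; apply: ltnW.
- exists (m - k + (m - k))%N; first by rewrite addn_gt0 jm.
  by rewrite mulr2n add_lfunE !omega_height natrD.
by case: ifP => // _ /mapP[k _ ->]; exists (m - k)%N; rewrite ?omega_height.
Qed.

(** Induction on the value at [height_vector]: a positive root that is not simple is a sum of two
    positive roots of smaller value. *)
Lemma root_simple_sum (r : nat) (alpha : r.-tuple 'Hom(G, R^o)) al :
  alpha =i simple_roots R n -> al \in positive_roots R n ->
  exists c : 'I_r -> nat, al = \sum_i tnth alpha i *+ c i.
Proof.
move=> alphaE pal; have [N0 _ E0] := root_height pal.
have [N leN] : exists N, (N0 < N)%N by exists N0.+1.
elim: N al pal N0 E0 leN => // N IHN al pal N0 E0 leN.
have [/tnthP[i ->]|] := boolP (al \in alpha).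
  exists (fun l => (l == i : nat)); rewrite (bigD1 i) //= big1 => [|j /negPf -> //].
  by rewrite eqxx mulr1n addr0.
rewrite alphaE mem_filter pal andbT => /allPn[be pbe /allPn[ga pga]].
rewrite negbK => /eqP Eal.
have [[Nb Nb0 Eb] [Nc Nc0 Ec]] := (root_height pbe, root_height pga).
have E1 : N0 = (Nb + Nc)%N.
  by apply/eqP; rewrite -(eqr_nat R) -E0 Eal add_lfunE Eb Ec natrD.
have [cb Ecb] := IHN _ pbe Nb Eb ltac:(lia).
have [cc Ecc] := IHN _ pga Nc Ec ltac:(lia).
exists (fun l => cb l + cc l)%N; rewrite Eal {1}Ecb {1}Ecc -big_split.
by apply: eq_bigr => i _; rewrite mulrnDr.
Qed.

End Roots.

Section DualBasis.
Variables (R : realType) (n : nat).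
Local Notation G := (gl R (n + n)).
Local Notation m := n./2.
Variable alpha : m.-tuple 'Hom(G, R^o).
Variable Hd : 'I_m -> G.
Hypothesis alphaE : alpha =i simple_roots R n.
Hypothesis Hd_a : forall j, Hd j \in space_a R n.
Hypothesis Hd_dual : forall i j, tnth alpha i (Hd j) = (i == j)%:R.

(** Duality makes the m vectors independent, and [space_a] is spanned by m vectors. *)
Lemma dual_basis_coord : {in space_a R n, forall A,
  A = \sum_i (tnth alpha i A : R) *: Hd i}.
Proof.
pose X := [tuple Hd i | i < m].
have alX (t : 'I_m -> R) j : tnth alpha j (\sum_i t i *: Hd i) = t j.
  rewrite linear_sum (bigD1 j) //= big1 => [|i ij]; rewrite linearZ /= Hd_dual.
    by rewrite eqxx addr0 [_ *: _]mulr1.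
  by rewrite eq_sym (negPf ij) [_ *: _]mulr0.
have XE (t : 'I_m -> R) : \sum_i t i *: X`_i = \sum_i t i *: Hd i.
  by apply: eq_bigr => i _; rewrite -tnth_nth tnth_mktuple.
have freeX : free X.
  by apply/freeP => t; rewrite XE => /(congr1 (tnth alpha _)) t0 j; rewrite -(alX t j) t0 linear0.
have sX : (<<X>> <= space_a R n)%VS.
  by apply/span_subvP => _ /mapP[i _ ->].
have EX : <<X>>%VS = space_a R n.
  apply/eqP; rewrite eqEdim sX (eqP freeX) size_tuple.
  by apply: leq_trans (dim_span _) _; rewrite size_tuple.
move=> A; rewrite -EX => /coord_span; rewrite XE => EA.
rewrite {1}EA; apply: eq_bigr => i _; congr (_ *: _).
by rewrite {2}EA alX.
Qed.

Variables (I : {set 'I_m}) (c : 'I_m -> nat).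
Hypothesis c_gt0 : forall i, i \in I -> (0 < c i)%N.
Let Z : G := \sum_(i in I) (c i)%:R *: Hd i.

Lemma simple_root_Z i : (tnth alpha i Z : R) = (if i \in I then c i else 0)%:R.
Proof.
rewrite /Z linear_sum /=; case: ifP => Ii.
  rewrite (bigD1 i) //= big1 => [|j /andP[_ ji]]; rewrite linearZ /= Hd_dual.
    by rewrite eqxx addr0 [_ *: _]mulr1.
  by rewrite eq_sym (negPf ji) [_ *: _]mulr0.
rewrite big1 // => j Ij; rewrite linearZ /= Hd_dual.
have -> : (i == j) = false by apply/eqP => ij; rewrite ij Ij in Ii.
by rewrite [_ *: _]mulr0.
Qed.

(** Write al as a natural combination of simple roots, all nonnegative at Z. If al vanishes at Z,
    every term does, and c_i > 0 forces the coefficient of alpha_i to vanish for i in I. *)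
Lemma positive_root_Z al : al \in positive_roots R n ->
  0 <= (al Z : R) /\ ((al Z : R) = 0 -> {in I, forall i, (al (Hd i) : R) = 0}).
Proof.
move=> pal; have [d Eal] := root_simple_sum alphaE pal.
have alE A : (al A : R) = \sum_i (tnth alpha i A : R) *+ d i.
  rewrite Eal sum_lfunE; apply: eq_bigr => i _.
  by elim: (d i) => [|k IH]; rewrite ?mulr0n ?zero_lfunE // !mulrSr add_lfunE IH.
have pos i : 0 <= (tnth alpha i Z : R) *+ d i by rewrite simple_root_Z mulrn_wge0.
rewrite alE sumr_ge0 //; split=> // /psumr_eq0P E i Ii.
have := E (fun i _ => pos i) i isT; rewrite simple_root_Z Ii => /eqP.
rewrite mulrn_eq0 pnatr_eq0 (gtn_eqF (c_gt0 Ii)) orbF => /eqP d0.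
rewrite alE big1 // => j _; rewrite Hd_dual; have [->|_] := eqVneq j i; last exact: mul0rn.
by rewrite d0.
Qed.

Lemma mem_dual_span A : A \in space_a R n ->
  (forall i, (tnth alpha i Z : R) = 0 -> (tnth alpha i A : R) = 0) ->
  A \in <<[seq Hd i | i <- enum I]>>%VS.
Proof.
move=> aA A0; rewrite (dual_basis_coord aA); apply: memv_suml => i _.
have [Ii|nIi] := boolP (i \in I).
  by apply/memvZ/memv_span/map_f; rewrite mem_enum.
by rewrite A0 ?scale0r ?mem0v // simple_root_Z (negPf nIi).
Qed.

End DualBasis.

(** * so(n, H) with theta satisfies the abstract hypotheses *)

Lemma lin0 (R : realType) (U V : lmodType R) (f : U -> V) : linear f -> f 0 = 0.
Proof. by move=> /(_ (-1) 0 0); rewrite scaler0 addr0 scaleN1r addNr. Qed.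

Lemma eucl0r (R : realType) (V : vectType R) (Q : V -> V -> R) : euclidean Q ->
  forall x, Q x 0 = 0.
Proof.
by move=> EQ x; have := euclidean_lin EQ x (-1) 0 0; rewrite scaler0 addr0 mulN1r addNr.
Qed.

Section ConcreteForm.
Variables (R : realType) (n : nat).
Hypothesis n_ge2 : (2 <= n)%N.
Local Notation C := R[i].
Local Notation cj := (@conjc R : {rmorphism C -> C}).
Local Notation M := 'M[C]_(n + n).
Local Notation G := (gl R (n + n)).
Local Notation m := n./2.
Local Notation ii := ('i%C : C).
Local Notation s := (((Num.sqrt 2)^-1)%:C%C : C).
Local Notation Lm := (@Lm C n ii s).
Implicit Types (x y A B v : G).

Definition herm (x : G) : G := dag cj x.
Definition twist (x : G) : G := theta cj Lm x.
Local Notation br := (@commutator R n).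
Local Notation q := (@rtr R (n + n)).
Local Notation k := (so_nH R n).
Local Notation a := (space_a R n).

Let cK := @conjc_invol R.
Let TF := theta_frame_Lm n (@imag_sq R) (@conjc_imag R) (@isqrt2_sq R) (@conjc_isqrt2 R)
  (@two_neq0 R).
Let cr (t : R) : cj t%:C%C = t%:C%C. Proof. exact: conjc_real. Qed.

Let kappa : R := (2 * n - 2)%:R.
Let n_gt0 : (0 < n)%N. Proof. lia. Qed.

Lemma herm_lin : linear herm.
Proof.
move=> t x y; have E : dag cj (t%:C%C *: (x : M) + y) = t%:C%C *: dag cj x + dag cj y.
  by rewrite dagD dagZ cr.
exact: E.
Qed.

Lemma hermK : involutive herm.
Proof. by move=> x; exact: (dagK cK). Qed.

Lemma herm_br x y : herm (br x y) = br (herm y) (herm x).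
Proof. exact: cm_dag. Qed.

Lemma rtr_herm x y : q (herm x) (herm y) = q x y.
Proof.
rewrite [RHS](euclidean_sym (@rtr_euclidean R _)) /rtr /herm (dagK cK).
by rewrite mxtrace_mulC.
Qed.

Lemma twist_lin : linear twist.
Proof.
move=> t x y; have E : theta cj Lm (t%:C%C *: (x : M) + y) =
    t%:C%C *: theta cj Lm x + theta cj Lm y by rewrite thetaD thetaZ cr.
exact: E.
Qed.

Lemma twistK : involutive twist.
Proof. exact: (thetaK cK TF). Qed.

Lemma twist_br x y : twist (br x y) = br (twist x) (twist y).
Proof. exact: (theta_cm TF). Qed.

Lemma twist_herm x : twist (herm x) = herm (twist x).
Proof. exact: (theta_dag cK TF). Qed.

Lemma rtr_twist x y : q (twist x) (twist y) = q x y.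
Proof.
have E : theta cj Lm x *m dag cj (theta cj Lm y) = theta cj Lm (x *m dag cj y).
  by rewrite -(theta_dag cK TF) (thetaM TF).
rewrite /rtr /twist; apply: etrans (f_equal (fun X => complex.Re (\tr X)) E) _.
by rewrite (mxtr_theta TF) Re_conjc.
Qed.

Lemma so_nH_twist : {in k, forall x, twist x \in k}.
Proof. by move=> x /so_nHP hx; apply/so_nHP; exact: (so_star_theta cK TF hx). Qed.

Lemma killing_so_nH_rtr : {in k &, forall x y, killing_form br k x y = kappa * q x (herm y)}.
Proof.
move=> x y kx ky; rewrite (killing_so_nH n_gt0 kx ky) /rtr /herm (dagK cK); exact: erefl.
Qed.

Let m_bounds (j : 'I_m) : (0 < j.+1)%N /\ (2 * j.+1 <= n)%N.
Proof. by have := ltn_ord j; lia. Qed.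

Let a_ind (P : G -> Prop) : P 0 -> (forall t x y, P x -> P y -> P (t *: x + y)) ->
  (forall j : 'I_m, P (Hm n ii s j.+1)) -> {in a, forall A, P A}.
Proof.
move=> P0 PD PH; apply: span_ind => // v /(nthP 0)[j]; rewrite size_tuple => jm <-.
by rewrite (basis_aE R (Ordinal jm)) vecH_Hm; apply: (PH (Ordinal jm)).
Qed.

Lemma space_a_herm : {in a, forall A, herm A = A}.
Proof.
apply: a_ind => [|t x y Ex Ey|j].
- by have := herm_lin (-1) 0 0; rewrite scaler0 addr0 scaleN1r addNr.
- by rewrite herm_lin Ex Ey.
exact: (Hm_dag n (@conjc_imag R) (@conjc_isqrt2 R)).
Qed.

Lemma space_a_so_nH : {subset a <= k}.
Proof.
apply: a_ind => [|t x y kx ky|j]; rewrite ?mem0v ?memvD ?memvZ //.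
have [j0 jn] := m_bounds j.
by apply/so_nHP; exact: (so_star_Hm (@conjc_imag R) (@conjc_isqrt2 R) j0 jn).
Qed.

Lemma space_a_twist : {in a, forall A, twist A = A}.
Proof.
apply: a_ind => [|t x y Ex Ey|j].
- by have := twist_lin (-1) 0 0; rewrite scaler0 addr0 scaleN1r addNr.
- by rewrite twist_lin Ex Ey.
have [j0 jn] := m_bounds j.
exact: (theta_Hm cK (@imag_sq R) (@conjc_imag R) (@isqrt2_sq R) (@conjc_isqrt2 R)
  (@two_neq0 R) j0 jn).
Qed.

Lemma space_a_abel : {in a &, forall A B, br A B = 0}.
Proof.
move=> A B aA; move: B; have Lbr := @commutator_lie R n.
apply: a_ind => [|t x y Ex Ey|j]; first exact: (lin0 (lbr_linr Lbr A)).
  by rewrite (lbr_linr Lbr) Ex Ey scaler0 addr0.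
move: A aA; apply: a_ind => [|t x y Ex Ey|i].
- exact: (lin0 (lbr_linl Lbr (Hm n ii s j.+1 : G))).
- by rewrite (lbr_linl Lbr) Ex Ey scaler0 addr0.
have [[i0 iN] [j0 jN]] := (m_bounds i, m_bounds j).
have e1 : 1 * 1 = 1 :> C by rewrite mulr1.
have e2 : -1 * -1 = 1 :> C by rewrite mulrNN mulr1.
have c1 : cj ((i.+1 == j.+1)%:R * 1) = (i.+1 == j.+1)%:R * 1 by rewrite mulr1 rmorph_nat.
have c2 : cj ((i.+1 == j.+1)%:R * -1) = (i.+1 == j.+1)%:R * -1.
  by rewrite mulrN1 rmorphN rmorph_nat.
have Hu := Hm_av s (@imag_sq R) e1 i0 j0 iN jN.
have Hw := Hm_av s (@imag_sq R) e2 i0 j0 iN jN.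
have E := cm_Hm_rsym (@conjc_imag R) (@conjc_isqrt2 R) (s * 2^-1) i0 iN Hu Hw c1 c2.
have w0 : s * ((i.+1 == j.+1)%:R * 1 + (i.+1 == j.+1)%:R * -1) = 0.
  by rewrite mulr1 mulrN1 subrr mulr0.
have EH := Hm_rsym (@conjc_imag R) (@conjc_isqrt2 R) (@two_neq0 R) j0 jN.
rewrite w0 scale0r in E; rewrite EH; exact: E.
Qed.

Let L := flagged_basis_n R n.

Lemma basis_so_nH : {in L, forall vb, vb.1 \in k}.
Proof. by move=> vb /root_vector_basis[al []]. Qed.

Lemma basis_twist : {in L, forall vb, twist vb.1 = if vb.2 then - vb.1 else vb.1}.
Proof. by move=> vb /root_vector_basis[al []]. Qed.

Lemma basis_weight : {in L & a, forall vb A, exists t, br A vb.1 = t *: vb.1}.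
Proof. by move=> vb A /root_vector_basis[al [_ _ H _]] aA; exists (al A); apply: H. Qed.

Lemma basis_complete : {in k, forall u, herm u = u ->
  {in L, forall vb, q vb.1 u = 0} -> {in a, forall A, q A u = 0} -> u = 0}.
Proof.
move=> u ku du Lu au; apply: hermitian_so_nH_eq0 => // _ /mapP[vb Lvb ->].
exact: Lu.
Qed.

(** ad of [height_vector] is self-adjoint, zero on a, and has a positive eigenvalue on each basis
    vector of n. *)
Lemma space_a_n_orth : {in a & space_n R n, forall A x, q A x = 0}.
Proof.
move=> A x aA; have EQ := @rtr_euclidean R (n + n).
have q0 := eucl0r EQ.
move: x; apply: span_ind => [|t x y Ex Ey|_ /mapP[vb Lvb ->]]; first exact: q0.
  by rewrite (euclidean_lin EQ) Ex Ey mulr0 addr0.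
have [al [_ _ wv pal]] := root_vector_basis Lvb.
have ha := height_vector_a R n; have [N N0 EN] := root_height pal.
have : q (br (height_vector R n) A) vb.1 = 0.
  by rewrite space_a_abel // (euclidean_sym EQ); apply: q0.
rewrite rtr_commutator [dag cj _](space_a_herm ha) wv // EN.
have := euclidean_lin EQ A (N%:R) vb.1 0; rewrite addr0 => -> /eqP.
rewrite q0 addr0 mulf_eq0 pnatr_eq0 gtn_eqF // => /eqP.
by [].
Qed.

End ConcreteForm.

(** * The attached solvmanifold *)

Section Solvmanifold.
Variables (R : realType) (n : nat).
Hypothesis n_ge2 : (2 <= n)%N.
Local Notation G := (gl R (n + n)).
Local Notation m := n./2.
Local Notation br := (@commutator R n).
Local Notation brC := (@bracketC R n).
Local Notation q := (@rtr R (n + n)).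
Local Notation k := (so_nH R n).
Local Notation a := (space_a R n).
Local Notation pos := (positive_roots R n).
Local Notation twist := (@twist R n).
Local Notation herm := (@herm R n).
Local Notation toC := (@to_complexified R G).
Variable alpha : m.-tuple 'Hom(G, R^o).
Hypothesis alphaE : alpha =i simple_roots R n.
Variable Hd : 'I_m -> G.
Hypothesis Hd_a : forall j, Hd j \in a.
Hypothesis Hd_dual : forall i j, tnth alpha i (Hd j) = (i == j)%:R.
Variables (I : {set 'I_m}) (c : 'I_m -> nat).
Hypothesis c_gt0 : forall i, i \in I -> (0 < c i)%N.

Let Z : G := \sum_(i in I) (c i)%:R *: Hd i.
Let kappa : R := (2 * n - 2)%:R.
Let kappa_gt0 : 0 < kappa. Proof. by rewrite ltr0n; lia. Qed.
Let n_gt0 : (0 < n)%N. Proof. lia. Qed.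
Let Q := form_ip q kappa.
Let g := real_form twist k.
Let L := flagged_basis_n R n.
Let LL : seq (G * G) := [seq v <- map (@form_emb R G) L | v != 0].
Let aa : {vspace G * G} := <<map toC (basis_a R n)>>%VS.
Let b : {vspace G * G} := attached_a Hd I.
Let Lbr := @commutator_lie R n.
Let Eq := @rtr_euclidean R (n + n).
Let twist_linear := @twist_lin R n.

(** The first listed root whose root space contains v, and 0 if there is none; [rtP] shows that the
    search succeeds on [LL]. *)
Let rt (v : G * G) : 'Hom(G, R^o) :=
  pos`_(find (fun al => v \in root_space' al) pos).
Let w (v x : G * G) : R := rt v x.1.

Let emb_root vb al : vb \in L -> root_vector vb.1 vb.2 al ->
  in_root_space' al (form_emb vb).
Proof.
move=> Lvb [_ _ wv _]; split; first exact/memv_span/(map_f (@form_emb R G)).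
move=> A aA; rewrite bracketCE /form_emb /mul_sqrtm1 /to_complexified.
have A0 : br A 0 = 0 by apply: (lin0 (lbr_linr Lbr A)).
by case: (vb.2) => /=; rewrite ?oppr0 wv // A0; congr (_, _); rewrite scaler0.
Qed.

Let rtP v : v \in LL -> rt v \in pos /\ in_root_space' (rt v) v.
Proof.
rewrite mem_filter => /andP[_ /mapP[vb Lvb ->]].
have [al rv] := root_vector_basis Lvb.
have has_al : has (fun al => form_emb vb \in root_space' al) pos.
  apply/hasP; exists al; first exact: rv_root rv.
  exact/mem_root_space'/(emb_root Lvb rv).
split; first by apply: mem_nth; rewrite -has_find.
by apply/mem_root_space'; apply: (nth_find 0 has_al).
Qed.

Let mem_aa x : x \in aa <-> x.1 \in a /\ x.2 = 0.
Proof. exact: mem_span_complexified. Qed.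

Let mem_b x : x \in b <-> x.1 \in <<[seq Hd i | i <- enum I]>>%VS /\ x.2 = 0.
Proof.
rewrite -mem_span_complexified /b /attached_a -map_comp.
by [].
Qed.

Let aaE x : x \in aa -> x = toC x.1.
Proof. by case: x => u v /mem_aa[/= _ ->]. Qed.

Let Hd_span x : x \in <<[seq Hd i | i <- enum I]>>%VS -> x \in a.
Proof. by apply/subvP/span_subvP => _ /mapP[i _ ->]. Qed.

Let b_aa : (b <= aa)%VS.
Proof. by apply/subvP => x /mem_b[x1 x2]; apply/mem_aa; rewrite Hd_span. Qed.

Let Z_span : Z \in <<[seq Hd i | i <- enum I]>>%VS.
Proof.
apply: memv_suml => i Ii; apply/memvZ/memv_span/map_f.
by rewrite mem_enum.
Qed.

Let Z_b : toC Z \in b. Proof. by apply/mem_b. Qed.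

Let LL_weight : {in LL & aa, forall v A, brC A v = w v A *: v}.
Proof. by move=> v A /rtP[_ [_ wv]] /[dup] /aaE -> /mem_aa[aA _]; apply: wv. Qed.

Let wZ_ge0 : {in LL, forall v, 0 <= w v (toC Z)}.
Proof. by move=> v /rtP[/(positive_root_Z alphaE Hd_dual c_gt0)[]]. Qed.

Let wb0 : {in LL, forall v, w v (toC Z) = 0 -> {in b, forall A, w v A = 0}}.
Proof.
move=> v /rtP[/(positive_root_Z alphaE Hd_dual c_gt0)[_ al0] _] vZ A /mem_b[A1 _].
rewrite /w; move: (A.1) A1; apply: span_ind => [|t x y Ex Ey|_ /mapP[i Ii ->]].
- by rewrite linear0.
- by rewrite linearP /= Ex Ey [_ *: _]mulr0 addr0.
by apply: al0; rewrite // -mem_enum.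
Qed.

(** Each simple root is the weight of a nonzero vector of [LL]. Hence simple roots vanishing at Z
    also vanish at A, which leaves only components of A along the chosen H^i. *)
Let mem_b_aa : {in aa, forall A,
  {in LL, forall v, w v (toC Z) = 0 -> w v A = 0} -> A \in b}.
Proof.
move=> A /mem_aa[aA A2] wA; apply/mem_b; split=> //.
apply: (mem_dual_span (c := c) Hd_a Hd_dual) => // i Zi.
have [vb [Lvb v0 rv]] : exists vb, [/\ vb \in L, vb.1 != 0
    & root_vector vb.1 vb.2 (tnth alpha i)].
  by apply: root_vector_ex; have := mem_tnth i alpha; rewrite alphaE mem_filter => /andP[].
have e0 : form_emb vb != 0.
  rewrite /form_emb /mul_sqrtm1 /to_complexified; apply: contra v0.
  by case: (vb.2) => /eqP [] => [_|] ->.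
have LLv : form_emb vb \in LL by rewrite mem_filter e0 map_f.
have wE B : B \in a -> w (form_emb vb) (toC B) = (tnth alpha i B : R).
  move=> aB; have [_ [_ w1]] := rtP LLv; have [_ w2] := emb_root Lvb rv.
  have := w1 B aB; rewrite w2 // => /eqP; rewrite -subr_eq0 -scalerBl scaler_eq0.
  by rewrite (negPf e0) orbF subr_eq0 => /eqP ->.
have := wA _ LLv; rewrite wE ?Hd_span // => /(_ Zi).
have -> : w (form_emb vb) A = w (form_emb vb) (toC A.1) by [].
by rewrite wE.
Qed.

Let w_neq0 : {in LL, forall v, exists2 A, A \in aa & w v A != 0}.
Proof.
move=> v /rtP[pv _]; exists (toC (height_vector R n)).
  by apply/mem_aa; rewrite height_vector_a.
by have [N N0 E] := root_height pv; rewrite /w E pnatr_eq0 -lt0n.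
Qed.

Let LL_g : {subset LL <= g}.
Proof.
move=> v; rewrite mem_filter => /andP[_ /mapP[vb Lvb ->]].
exact: (form_emb_mem twist_linear (@basis_so_nH R n) (@basis_twist R n)).
Qed.

Let LL_neq0 : 0 \notin LL. Proof. by rewrite mem_filter eqxx. Qed.


Let st := form_dag herm.
Let tau := @form_tau R G.
Let hl := @herm_lin R n.
Let Lc := complexified_lie Lbr Eq.
Let EQ := form_ip_euclidean Eq kappa_gt0.

Let gP x : x \in g <-> in_form twist k x.
Proof. exact: mem_real_form. Qed.

Let aa_g : (aa <= g)%VS.
Proof.
apply/subvP => x /mem_aa[ax x2]; apply/gP; rewrite /in_form x2.
by rewrite (space_a_so_nH n_ge2 ax) mem0v (space_a_twist n_ge2 ax) (lin0 twist_linear) oppr0.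
Qed.

Let aa_st : {in aa, forall A, st A = A}.
Proof.
move=> A /[dup] /aaE -> /mem_aa[aA _]; rewrite /st /form_dag /= (space_a_herm aA).
by rewrite (lin0 hl) oppr0.
Qed.

Let aa_tau : {in aa, forall A, tau A = A}.
Proof. by move=> A /aaE ->; rewrite /tau /form_tau /= oppr0. Qed.

Let br0 A : br A 0 = 0. Proof. exact: (lin0 (lbr_linr Lbr A)). Qed.

Let aa_abel : {in aa &, forall A B, brC A B = 0}.
Proof.
move=> A B /[dup] /aaE -> /mem_aa[aA _] /[dup] /aaE -> /mem_aa[aB _].
by rewrite bracketCE /= (space_a_abel n_ge2) // br0.
Qed.

Let LL_tau : {in LL, forall v, tau v = v \/ tau v = - v}.
Proof.
move=> v; rewrite mem_filter => /andP[_ /mapP[vb _ ->]].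
rewrite /form_emb /mul_sqrtm1 /to_complexified /tau /form_tau.
case: (vb.2) => /=; [right|left]; last by rewrite oppr0.
by rewrite -[RHS]/(- - 0, - _) opprK oppr0.
Qed.

Let LL_complete : {in g, forall x, {in LL, forall v, Q v x = 0 /\ Q (st v) x = 0} ->
  {in aa, forall A, brC A x = 0}}.
Proof.
move=> x gx Lx A /[dup] /aaE -> /mem_aa[aA _].
have H := (real_form_complete Lbr Eq hl (@hermK R n) (@herm_br R n) (@rtr_herm R n)
  (@rtr_commutator R n) twist_linear (@rtr_twist R n) (@twist_herm R n) kappa_gt0
  (@so_nH_br R n) (@so_nH_dag R n) (@space_a_herm R n)
  (@space_a_so_nH R n n_ge2) (@space_a_abel R n n_ge2)
  (@basis_twist R n) (@basis_weight R n) (@basis_complete R n)).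
exact: (H x gx Lx A.1 aA).
Qed.

Let LL_complete_sym : {in g, forall x, st x = x -> tau x = x ->
  {in LL, forall v, Q v x = 0} -> {in aa, forall A, Q A x = 0} -> x = 0}.
Proof.
move=> x gx sx tx Lx ax.
have H := real_form_complete_sym Eq (d := herm) twist_linear (@rtr_twist R n) kappa_gt0
  (a := a) (@basis_twist R n) (@basis_complete R n).
apply: (H x gx sx tx Lx) => A aA; apply: ax.
by apply/mem_aa.
Qed.

Let nn : {vspace G * G} := nilrad LL w (toC Z).

Let space_n'_g : {subset space_n' R n <= g}.
Proof.
move=> x; move: x; apply/subvP/span_subvP => _ /mapP[vb Lvb ->].
exact: (form_emb_mem twist_linear (@basis_so_nH R n) (@basis_twist R n)).
Qed.

(** A vector of a root space positive on Z is an eigenvector of ad Z with positive eigenvalue, so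
    [eigen_mem] writes it through vectors of [LL] with that eigenvalue. *)
Let attached_nE : attached_n' Z = nn.
Proof.
apply/eqP; rewrite eqEsubv; apply/andP; split.
  rewrite /attached_n' big_seq_cond; apply: (big_ind (fun U => U <= nn)%VS) => [|U V UN VN|al /andP[pal alZ]].
  - exact: sub0v.
  - by rewrite subv_add UN.
  apply/subvP => x /mem_root_space'[nx wx].
  have br_x : brC (toC Z) x = (al Z : R) *: x by apply/wx/Hd_span/Z_span.
  have ex := eigen_mem Lc EQ (form_dag_lin hl) (form_dag_br Lbr hl (@herm_br R n))
    (form_ip_br Lbr Eq (@rtr_commutator R n) kappa) aa_st LL_g LL_weight LL_complete
    b_aa Z_b wZ_ge0 (space_n'_g nx) alZ br_x.
  move: x {nx wx br_x} ex; apply/subvP/sub_span => v; rewrite !mem_filter.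
  by move=> /andP[/eqP E ->]; rewrite E alZ.
apply/span_subvP => v; rewrite mem_filter => /andP[vZ Lv]; have [pv rv] := rtP Lv.
have sub : (root_space' (rt v) <= attached_n' Z)%VS.
  rewrite /attached_n'; elim: pos pv => // be r IH; rewrite inE big_cons => /predU1P[Ev|rv'].
    by rewrite -Ev vZ addvSl.
  by case: ifP => _; [apply: subv_trans (IH rv') (addvSr _ _)|apply: IH].
by apply: (subvP sub); apply/mem_root_space'.
Qed.


Let a_n_0 : (a :&: space_n R n)%VS = 0%VS.
Proof.
apply/eqP; rewrite -subv0; apply/subvP => x /memv_capP[ax nx]; rewrite memv0.
by apply/eqP/(eucl_eq0 Eq)/(space_a_n_orth n_ge2).
Qed.

Let n_a_0 : (space_n R n :&: a)%VS = 0%VS. Proof. by rewrite capvC. Qed.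

Let space_n_so_nH : {subset space_n R n <= k}.
Proof.
by move=> x; apply/subvP/span_subvP => _ /mapP[vb /basis_so_nH kv ->].
Qed.

(** a and n are orthogonal, hence independent, so the projections in [ip_s] return the two
    summands. *)
Let ip_sE A B x y : A \in a -> B \in a -> x \in space_n R n -> y \in space_n R n ->
  ip_s (A + x) (B + y) = 2 * (kappa * q A B) + kappa * q x y.
Proof.
have kill_a u v : u \in a -> v \in space_n R n -> daddv_pi a (space_n R n) (u + v) = u.
  move=> au nv; rewrite linearD /= daddv_pi_id //.
  by have /eqP := daddv_pi_add a_n_0 (subvP (addvSr a (space_n R n)) v nv); rewrite (daddv_pi_id n_a_0) // -subr_eq0 addrK => /eqP ->; rewrite addr0.
have kill_n u v : u \in a -> v \in space_n R n -> daddv_pi (space_n R n) a (u + v) = v.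
  move=> au nv; rewrite linearD /= [X in _ + X]daddv_pi_id //.
  by have /eqP := daddv_pi_add n_a_0 (subvP (addvSr (space_n R n) a) u au); rewrite (daddv_pi_id a_n_0) // -subr_eq0 addrK => /eqP ->; rewrite add0r.
move=> aA aB nx ny; rewrite /ip_s !kill_a // !kill_n //.
rewrite (B_sigmaE n_gt0 (space_a_so_nH n_ge2 aA) (space_a_so_nH n_ge2 aB)).
by rewrite (B_sigmaE n_gt0 (space_n_so_nH nx) (space_n_so_nH ny)).
Qed.

Let fold_basis : [seq x.1 + x.2 | x <- basis_s' R n] = basis_s R n.
Proof.
rewrite map_cat; congr (_ ++ _); rewrite -map_comp.
  have fold0 (X : seq G) : [seq ((fun x : G * G => x.1 + x.2) \o toC) u | u <- X] = X.
    by elim: X => //= u X ->; rewrite addr0.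
  exact: fold0.
apply: eq_map => vb; rewrite /= /mul_sqrtm1 /to_complexified.
by case: (vb.2); rewrite /= ?oppr0 ?add0r ?addr0.
Qed.

(** Each vector of [basis_s'] folds to its counterpart in [basis_s]. Whatever coordinates [coord]
    returns, they recombine to x, and folding is linear. *)
Let s'_to_sE x : x \in <<basis_s' R n>>%VS -> s'_to_s x = x.1 + x.2.
Proof.
move=> sx; have Ex := coord_span (X := in_tuple (basis_s' R n)) sx.
have fold_lin (f : 'I_(size (basis_s' R n)) -> G * G) :
    (\sum_i f i).1 + (\sum_i f i).2 = \sum_i ((f i).1 + (f i).2).
  rewrite (big_morph (fun z : G * G => z.1) (id1 := 0) (op1 := +%R)) //.
  by rewrite (big_morph (fun z : G * G => z.2) (id1 := 0) (op1 := +%R)) // -big_split.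
rewrite [in RHS]Ex fold_lin; apply: eq_bigr => i _ /=.
by rewrite -scalerDr -fold_basis (nth_map 0).
Qed.

Let nn_n' : {subset nn <= space_n' R n}.
Proof.
move=> x; apply/subvP/span_subvP => v; rewrite !mem_filter => /and3P[_ _ Lv].
exact: memv_span.
Qed.

Let fold_n x : x \in space_n' R n -> x.1 + x.2 \in space_n R n.
Proof.
move: x; apply: span_ind => [|t x y Ex Ey|_ /mapP[vb Lvb ->]].
- by rewrite addr0 mem0v.
- by rewrite /= addrACA -scalerDr memvD ?memvZ.
have -> : (if vb.2 then mul_sqrtm1 (to_complexified vb.1) else to_complexified vb.1).1 +
  (if vb.2 then mul_sqrtm1 (to_complexified vb.1) else to_complexified vb.1).2 = vb.1.
  by rewrite /mul_sqrtm1 /to_complexified; case: (vb.2); rewrite /= ?oppr0 ?add0r ?addr0.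
exact/memv_span/map_f.
Qed.

(** Elements of b have zero second component, and on n' folding is an isometry by
    [real_form_fold]. *)
Let ip_s'E : {in b & nn, forall A x, {in b & nn, forall B y,
  ip_s' (A + x) (B + y) = 2 * Q A B + Q x y}}.
Proof.
have sub_s A x : A \in b -> x \in nn -> s'_to_s (A + x) = A.1 + (x.1 + x.2).
  move=> /(subvP b_aa) aA nx; rewrite s'_to_sE; last first.
    by rewrite span_cat memv_add // nn_n'.
  by have [_ A2] := (mem_aa A).1 aA; rewrite /= A2 add0r addrA.
move=> A x bA nx B y bB ny; rewrite /ip_s' !sub_s //.
have [aA A2] := (mem_aa A).1 (subvP b_aa _ bA).
have [aB B2] := (mem_aa B).1 (subvP b_aa _ bB).
have [n'x n'y] := (nn_n' nx, nn_n' ny).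
rewrite ip_sE ?fold_n //; congr (_ * _ + _).
  by rewrite /Q /form_ip A2 B2 (eucl0r Eq) addr0.
exact: (real_form_fold Eq twist_linear (@rtr_twist R n) kappa (space_n'_g n'x) (space_n'_g n'y)).
Qed.

Lemma attached_einstein :
  einstein_solvmanifold brC (attached_a Hd I + attached_n' Z)%VS (@ip_s' R n).
Proof.
have [F FF] := frame_ex EQ nn; rewrite attached_nE.
exact: (einstein_solvmanifold_nilrad Lc EQ (form_dag_lin hl) (form_dagK hl (@hermK R n))
  (form_dag_br Lbr hl (@herm_br R n)) (form_ip_dag Eq (@rtr_herm R n) kappa)
  (form_ip_br Lbr Eq (@rtr_commutator R n) kappa) (@form_tau_lin R G) (@form_tauK R G)
  (form_tau_br Lbr) (form_ip_tau Eq kappa)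
  (real_form_br Lbr twist_linear (@twist_br R n) (@so_nH_br R n))
  (real_form_dag hl twist_linear (@twist_herm R n) (@so_nH_dag R n))
  (real_form_tau twist_linear (k := k))
  (killing_real_form Lbr Eq twist_linear (@twistK R n) (@twist_br R n) (@rtr_twist R n)
    kappa_gt0 (@so_nH_br R n) (@so_nH_twist R n) (@killing_so_nH_rtr R n n_ge2))
  aa_g aa_st aa_tau aa_abel LL_g LL_neq0 LL_weight LL_tau LL_complete LL_complete_sym
  b_aa Z_b wZ_ge0 wb0 mem_b_aa FF w_neq0 ip_s'E).
Qed.

End Solvmanifold.

Theorem proposition3p2 (R : realType) (n : nat) (n_ge2 : (2 <= n)%N)
    (* alpha_1, ..., alpha_m are the simple roots *)
    (alpha : (n./2).-tuple 'Hom(gl R (n + n), R^o))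
    (alpha_uniq : uniq alpha) (alphaE : alpha =i simple_roots R n)
    (* H^1, ..., H^m is the dual basis of a *)
    (Hd : 'I_(n./2) -> gl R (n + n))
    (Hd_a : forall j, Hd j \in space_a R n)
    (Hd_dual : forall i j, tnth alpha i (Hd j) = (i == j)%:R)
    (I : {set 'I_(n./2)}) (I_neq0 : I != set0)
    (c : 'I_(n./2) -> nat) (c_gt0 : forall i, i \in I -> (0 < c i)%N) :
  let Z : gl R (n + n) := \sum_(i in I) (c i)%:R *: Hd i in
  einstein_solvmanifold (@bracketC R n) (attached_a Hd I + attached_n' Z)%VS
    (@ip_s' R n).
Proof. by move=> Z; apply: (attached_einstein n_ge2 alphaE Hd_a Hd_dual c_gt0). Qed.
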